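(* There exists a constant $C<\infty$, depending only on $K$ and on bounds on the support of $P$, such that for every integer $N\ge1$ and uniformly over $(t,h)\in\mathbb{R}_+\times S^K_+$, $$0\le\partial_t\bar F_N-2|\nabla\bar F_N|^2\le C\,\kappa(h)\,N^{-\frac14}\left(\Delta\bar F_N+C\left|h^{-1}\right|\right)^{\frac14}+C\,\mathbb{E}\left[\left|\nabla F_N-\nabla\bar F_N\right|^2\right].$$ Here the right-hand side is understood to be $+\infty$ when $h\in S^K_+\setminus S^K_{++}$, and the statement includes the assertion that $\Delta\bar F_N+C|h^{-1}|\ge0$.
   Context: Matrices. $K\ge1$ is a fixed integer. $S^K$ is the space of real symmetric $K\times K$ matrices; $S^K_+$ and $S^K_{++}$ are the subsets of positive semidefinite and positive definite matrices. For matrices $A,B$ of the same size, $A\cdot B=\mathrm{tr}(A^{\mathsf t}B)$ and $|A|=\sqrt{A\cdot A}$. For $h\in S^K_+$, the condition number is $\kappa(h)=|h|\,|h^{-1}|$ if $h\in S^K_{++}$ and $\kappa(h)=+\infty$ otherwise. $\nabla$ acts on the variable $h$ only: $\nabla f(h)\in S^K$ is characterized by $\nabla f(h)\cdot a=\lim_{\varepsilon\to0}\varepsilon^{-1}(f(h+\varepsilon a)-f(h))$ for all $a\in S^K$ (at boundary points of the domain, derivatives in $t$ and $h$ are understood as one-sided derivatives/continuous extensions). $\Delta=\nabla\cdot\nabla$ is the corresponding Laplacian in $h$, i.e. the sum of second directional derivatives along an orthonormal basis of $(S^K,\cdot)$. $\mathbb{R}_+=[0,\infty)$. Model. $P$ is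 a probability measure on $\mathbb{R}^K$ with bounded support and $P_N=P^{\otimes N}$, seen as a law on $\mathbb{R}^{N\times K}$ (rows i.i.d. with law $P$). Let $\bar x\in\mathbb{R}^{N\times K}$ have law $P_N$, and let $W\in\mathbb{R}^{N\times N}$, $z\in\mathbb{R}^{N\times K}$ have i.i.d. standard Gaussian entries, with $\bar x,W,z$ independent; $\mathbb{E}$ is the expectation over $(\bar x,W,z)$. For $t\ge0$, $h\in S^K_+$, $x\in\mathbb{R}^{N\times K}$ set $$H_N(t,h,x)=\sqrt{\tfrac tN}\,x\cdot Wx+\tfrac tN|x^{\mathsf t}\bar x|^2-\tfrac t{2N}|x^{\mathsf t}x|^2+\sqrt h\cdot x^{\mathsf t}z+h\cdot x^{\mathsf t}\bar x-\tfrac12 h\cdot x^{\mathsf t}x,$$ $$F_N(t,h)=\frac1N\log\int_{\mathbb{R}^{N\times K}}e^{H_N(t,h,x)}\,\mathrm{d}P_N(x),\qquad \bar F_N(t,h)=\mathbb{E}[F_N(t,h)].$$ *)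

(* Defs.v *)
From HB Require Import structures.
From mathcomp Require Import all_boot all_order all_algebra.
From mathcomp Require Import all_classical all_reals all_analysis.

Set Implicit Arguments.
Unset Strict Implicit.
Unset Printing Implicit Defensive.

Import Order.TTheory GRing.Theory Num.Theory.
Import numFieldNormedType.Exports.

Local Open Scope classical_set_scope.
Local Open Scope ring_scope.

Section Matrices.
Context {R : realType}.

Definition mxdot m n (A B : 'M[R]_(m, n)) : R := \tr (A^T *m B).

(* The library norm `|A| on matrices is the sup norm; this is the Frobenius
   norm. *)
Definition fnorm m n (A : 'M[R]_(m, n)) : R := Num.sqrt (mxdot A A).

Definition sym_mx K : set 'M[R]_K := [set h | h^T = h].

Definition psd K : set 'M[R]_K :=
  [set h | sym_mx h /\ forall v : 'cV[R]_K, 0 <= (v^T *m h *m v) 0 0].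

Definition posdef K : set 'M[R]_K :=
  [set h | sym_mx h /\
    forall v : 'cV[R]_K, v != 0 -> 0 < (v^T *m h *m v) 0 0].

(* The positive semidefinite square root (unique when h is itself positive
   semidefinite; 0 if there is none). *)
Definition psd_sqrt K (h : 'M[R]_K) : 'M[R]_K :=
  xget 0 [set s | psd s /\ s *m s = h].

Definition condition_number K (h : 'M[R]_K) : \bar R :=
  if `[< posdef h >] then (fnorm h * fnorm (invmx h))%:E else +oo%E.

End Matrices.

Section Derivatives.
Context {R : realType}.

(* d is the derivative at x of the function g, whose domain is D: the limit is
   taken along the nonzero increments that stay in D, hence it is two-sided in
   the interior of D and one-sided at a boundary point. *)
Definition is_derive_within (D : set R) (g : R -> R) (x d : R) : Prop :=
  (fun e : R => e^-1 * (g (x + e) - g x)) @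
    within [set e | D (x + e)] 0^' --> d.

(* Derivative of a function on [0, +oo[, one-sided at 0. *)
Definition is_time_derivative (f : R -> R) (t d : R) : Prop :=
  is_derive_within [set s | 0 <= s] f t d.

Definition time_derivative (f : R -> R) (t : R) : R :=
  xget 0 [set d | is_time_derivative f t d].

(* Gradient of a function on the cone of positive semidefinite matrices. At a
   positive definite h every symmetric direction a is tested by a two-sided
   limit. At a boundary point the condition is void for the directions that
   leave the cone on both sides, but the remaining ones span the symmetric
   matrices, so that G is still unique. *)
Definition is_gradient K (f : 'M[R]_K -> R) (h G : 'M[R]_K) : Prop :=
  sym_mx G /\
  forall a, sym_mx a ->
    is_derive_within [set e : R | psd (h + e *: a)]
      (fun e => f (h + e *: a)) 0 (mxdot G a).

Definition gradient K (f : 'M[R]_K -> R) (h : 'M[R]_K) : 'M[R]_K :=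
  xget 0 [set G | is_gradient f h G].

(* For i <= j these matrices form an orthonormal basis of the symmetric
   matrices for mxdot. *)
Definition sym_basis K (i j : 'I_K) : 'M[R]_K :=
  if i == j then delta_mx i i
  else (Num.sqrt 2)^-1 *: (delta_mx i j + delta_mx j i).

Definition laplacian K (f : 'M[R]_K -> R) (h : 'M[R]_K) : R :=
  \sum_(i < K) \sum_(j < K | (i <= j)%N)
    derive1n 2 (fun e : R => f (h + e *: sym_basis i j)) 0.

End Derivatives.

Section PowerProbability.
Context d (T : measurableType d) (R : realType).

Definition cons_pair n (x : T * n.-tuple T) : n.+1.-tuple T :=
  [the n.+1.-tuple T of x.1 :: x.2].

Lemma measurable_cons_pair n : measurable_fun setT (@cons_pair n).
Proof. exact: measurable_cons. Qed.

HB.instance Definition _ n :=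
  isMeasurableFun.Build _ _ _ _ (@cons_pair n) (@measurable_cons_pair n).

(* The law of n independent samples from P. *)
Fixpoint power_prob (P : probability T R) n : probability (n.-tuple T) R :=
  match n with
  | 0 => dirac [tuple]
  | n'.+1 => distribution (P \x power_prob P n')%E (@cons_pair n')
  end.

End PowerProbability.

Section StandardGaussian.
Context (R : realType).

(* normal_prob lives on measurableTypeR R, an alias of R that has the same
   Borel sets under another measure_display; std_normal is the same law on R. *)
Definition to_real (x : measurableTypeR R) : R := x.

Lemma measurable_to_real : measurable_fun setT to_real.
Proof. by move=> _ Y mY; rewrite setTI. Qed.

HB.instance Definition _ :=
  isMeasurableFun.Build _ _ _ _ to_real measurable_to_real.

Definition std_normal : probability R R :=
  distribution (normal_prob (0 : R) 1) to_real.

End StandardGaussian.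

Definition tuple_mx (R : realType) m n (x : m.-tuple (n.-tuple R)) :
    'M[R]_(m, n) :=
  \matrix_(i, j) tnth (tnth x i) j.

Section Model.
Context {R : realType} {K : nat} (P : probability (K.-tuple R) R) (N : nat).

(* The values of the triple (xbar, W, z). *)
Definition sample : Type :=
  N.-tuple (K.-tuple R) * N.-tuple (N.-tuple R) * N.-tuple (K.-tuple R).

Definition gaussian_prob m n : probability (m.-tuple (n.-tuple R)) R :=
  power_prob (power_prob (std_normal R) n) m.

Definition sample_law :
    probability (N.-tuple (K.-tuple R) * N.-tuple (N.-tuple R)
                 * N.-tuple (K.-tuple R))%type R :=
  ((power_prob P N \x gaussian_prob N N) \x gaussian_prob N K)%E.

Definition hamiltonian (w : sample) (t : R) (h : 'M[R]_K)
    (x : 'M[R]_(N, K)) : R :=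
  let xbar := tuple_mx w.1.1 in
  let W := tuple_mx w.1.2 in
  let z := tuple_mx w.2 in
  Num.sqrt (t / N%:R) * mxdot x (W *m x)
  + t / N%:R * fnorm (x^T *m xbar) ^+ 2
  - t / (2 * N%:R) * fnorm (x^T *m x) ^+ 2
  + mxdot (psd_sqrt h) (x^T *m z)
  + mxdot h (x^T *m xbar)
  - 2^-1 * mxdot h (x^T *m x).

Definition free_energy (w : sample) (t : R) (h : 'M[R]_K) : R :=
  N%:R^-1 *
  ln (\int[power_prob P N]_x expR (hamiltonian w t h (tuple_mx x))).

Definition mean_free_energy (t : R) (h : 'M[R]_K) : R :=
  fine 'E_sample_law[fun w => free_energy w t h].

Definition gradient_variance (t : R) (h : 'M[R]_K) : \bar R :=
  'E_sample_law[fun w =>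
    fnorm (gradient (free_energy w t) h
           - gradient (mean_free_energy t) h) ^+ 2].

End Model.

(* Main.v *)
From HB Require Import structures.
Require Import Defs.
From mathcomp Require Import all_boot all_order all_algebra.
From mathcomp Require Import complex.
From mathcomp Require Import all_classical all_reals all_analysis.
From mathcomp Require Import measurable_realfun simple_functions lebesgue_integral_under.
From mathcomp Require Import ring lra.

(** The Hamiltonian is the log-likelihood of a signal [x], observed in Gaussian
    noise through the quantities [sg *: (x *m x^T)] and [x *m s], where
    [sg ^+ 2 = t / N] and [s *m s = h]. Hence the Gibbs measure is the law of the
    signal given the observation (the Nishimori identity, [planted_mean]), and
    after a change of measure that turns the observation into pure noise, N times
    the mean free energy is the mean of [Z * ln Z], the [entropy]. Its derivative
    along any path of the coefficients obeys a heat equation ([entropy_derive]),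
    and so does the mean of a product of Gibbs averages ([overlap_derive]). With
    [b] the mean replica, this identifies the derivatives of the mean free energy:
    the one in [t] is the mean square overlap [square_mean] over [2 * N ^+ 2], the
    gradient is the mean overlap [overlap_mean], the mean of [b^T *m b], over
    [2 * N], and the second derivatives are the means of [curvature] over [2 * N],
    nonnegative because they are means of squares over two independent replicas.
    So twice the difference of the statement is the amount by which the mean
    square overlap exceeds the square of the mean overlap, over [N ^+ 2]; it is
    nonnegative by Jensen's inequality ([overlap_le_square]).

    The upper bound treats apart the two sources of fluctuation of the overlap.
    At a fixed observation, [square_overlap_gap] bounds them by the covariances of
    the coordinates of a replica, [coord_var], and by the fluctuation
    [overlap_var] of the overlap of a replica with [b]. The mean of [coord_var] is,
    up to the factor [2 * N], the sum of the second derivatives in the diagonal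
    directions, hence at most the Laplacian, and [overlap_var] is at most of the
    order of [N] times the square root of [coord_var].

    The fluctuations of [b^T *m b] with the observation are compared to those of
    the gradient of the free energy ([overlap_fluctuation]). The derivative of
    [ln Z] in a symmetric direction [a] is tested against the overlap of the
    signal with [b], weighted by [a]; Gaussian integration by parts computes the
    mean of the product, and a square that has a nonnegative mean yields the
    comparison. The derivative [D] of the square root [s] of [h] solves
    [D *m s + s *m D = a] but need not commute with [s]. The antisymmetric part of
    [s *m D] contributes an error, which sees only the deviations of the overlap
    and is thus bounded by the mean of [overlap_var]. Its size is at most
    [fnorm s * fnorm D], and that is where the condition number of [h] comes from.

    If the Laplacian is at most of the order of [N], all powers of the Laplacian
    over [N] that occur are dominated by the fourth root; otherwise the trivial
    bound on the overlap is enough ([final_bound]). The gradient at a singular [h]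
    and the time derivative at 0, where the coefficients are not differentiable,
    exist because the derivatives of the functionals at hand are controlled by
    those of [sg ^+ 2] and [s *m s] ([coef_lipschitz]): the estimates hold at
    [h + (e ^+ 2)%:M] uniformly in [e] and pass to the limit. *)

Set Implicit Arguments.
Unset Strict Implicit.
Unset Printing Implicit Defensive.

Import Order.TTheory GRing.Theory Num.Theory.
Import numFieldNormedType.Exports.

Local Open Scope classical_set_scope.
Local Open Scope ring_scope.

(** * Square roots of positive semidefinite matrices *)

Section Spectrum.
Context {R : realType}.

Lemma poly_interpolation (s : seq R) (f : R -> R) :
  exists p : {poly R}, forall x, x \in s -> p.[x] = f x.
Proof.
elim: s => [|a s [p pf]]; first by exists 0.
have [as_|as_] := boolP (a \in s).
  by exists p => x; rewrite inE => /predU1P[->|]; exact: pf.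
pose q := \prod_(b <- s) ('X - b%:P).
have qa : q.[a] != 0.
  by rewrite -/(root q a) root_prod_XsubC.
exists (p + ((f a - p.[a]) / q.[a])%:P * q) => x.
rewrite inE hornerD hornerM hornerC => /predU1P[->|xs].
  by rewrite divfK// addrC subrK.
have /rootP -> : root q x by rewrite root_prod_XsubC.
by rewrite mulr0 addr0 pf.
Qed.

Lemma psd_eigenvalue_ge0 n (h : 'M[R]_n) (a : R) :
  psd h -> eigenvalue h a -> 0 <= a.
Proof.
move=> [hs hp] /eigenvalueP[v vh v0].
have := hp v^T; rewrite trmxK vh -scalemxAl mxE.
have vv : 0 < (v *m v^T) 0 0.
  rewrite mxE (eq_bigr (fun i => v 0 i ^+ 2)); last first.
    by move=> i _; rewrite mxE expr2.
  rewrite lt_def sumr_ge0 ?andbT; last by move=> i _; exact: sqr_ge0.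
  apply: contra v0 => /eqP/psumr_eq0P e; apply/eqP/rowP => i.
  rewrite mxE; apply/eqP; rewrite -sqrf_eq0; apply/eqP.
  by apply: e => // j _; exact: sqr_ge0.
by rewrite pmulr_lge0.
Qed.

Lemma horner_mx_conj_diag (F : fieldType) n (A Q : 'M[F]_n.+1) (d : 'rV[F]_n.+1)
    (p : {poly F}) : Q \in unitmx -> A = invmx Q *m diag_mx d *m Q ->
  horner_mx A p = invmx Q *m diag_mx (map_mx (horner p) d) *m Q.
Proof. by move=> Qu ->; rewrite horner_mx_uconjC// horner_mx_diag. Qed.

(** The functional calculus of a symmetric matrix: a polynomial in it depends
    only on the values of the polynomial on the spectrum. The eigenvectors are
    taken over the complex numbers, but the eigenvalues are real because a
    Hermitian matrix has a real spectrum. *)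
Lemma psd_functional_calculus n (h : 'M[R]_n.+1) : psd h ->
  exists s : seq R, (forall x, x \in s -> 0 <= x) /\
  forall p q : {poly R}, (forall x, x \in s -> p.[x] = q.[x]) ->
    horner_mx h p = horner_mx h q.
Proof.
move=> hpsd; have [hsym _] := hpsd.
pose C := R[i]; pose emb : {rmorphism R -> C} := real_complex R.
pose hC := map_mx emb h.
have hherm : hC \is hermsymmx.
  apply: realsym_hermsym.
    apply/is_hermitianmxP; rewrite expr0 scale1r map_mx_id//.
    by rewrite /hC map_trmx -[in LHS]hsym.
  by apply/mxOverP => i j; rewrite mxE complex_real.
have spE := @orthomx_spectralP C _ hC (hermitian_normalmx hherm).
have dreal := hermitian_spectral_diag_real hherm.
have Pu := spectral_unit hC.
move: spE dreal Pu; move: (spectralmx hC) (spectral_diag hC) => P d spE dreal Pu.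
have hornerE (p : {poly R}) : map_mx emb (horner_mx h p) =
    invmx P *m diag_mx (map_mx (horner (map_poly emb p)) d) *m P.
  by rewrite map_horner_mx; exact: horner_mx_conj_diag Pu spE.
have dE j : emb (complex.Re (d 0 j)) = d 0 j.
  exact: RRe_real (mxOverP dreal 0 j).
exists [seq complex.Re (d 0 j) | j <- enum 'I_n.+1]; split.
  move=> x /mapP[j _ ->]; apply: (psd_eigenvalue_ge0 hpsd).
  rewrite -(eigenvalue_map emb) -/hC dE.
  apply/eigenvalueP; exists (row j P).
    rewrite -row_mul; have -> : P *m hC = diag_mx d *m P.
      by rewrite [in LHS]spE !mulmxA mulmxV// mul1mx.
    by apply/rowP => k; rewrite mxE mul_diag_mx !mxE.
  apply/eqP => /(congr1 (mulmx^~ (invmx P))).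
  rewrite -row_mul mulmxV// mul0mx => /rowP/(_ j); rewrite !mxE eqxx => /eqP.
  by rewrite oner_eq0.
move=> p q pq; apply: (map_mx_inj (f := emb)).
etransitivity; first exact: hornerE.
etransitivity; last by symmetry; exact: hornerE.
apply: (congr1 (fun e => invmx P *m diag_mx e *m P)).
apply/rowP => j; rewrite !mxE -dE !horner_map/= pq//; apply/mapP; exists j => //.
exact: mem_enum.
Qed.

Lemma trmx_horner_mx n (h : 'M[R]_n.+1) p : h^T = h ->
  (horner_mx h p)^T = horner_mx h p.
Proof.
move=> hs; elim/poly_ind: p => [|p c ih]; first by rewrite rmorph0 trmx0.
rewrite rmorphD rmorphM/= horner_mx_X horner_mx_C linearD/= tr_scalar_mx.
rewrite trmx_mul ih hs; congr (_ + _).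
exact: (comm_mx_horner p (commr_refl h)).
Qed.

Lemma psd_tr_mul m n (r : 'M[R]_(m, n)) : psd (r^T *m r).
Proof.
split; first by rewrite /sym_mx/= trmx_mul trmxK.
move=> v; rewrite mulmxA -trmx_mul -mulmxA mxE sumr_ge0// => i _.
by rewrite mxE -expr2 sqr_ge0.
Qed.

(** The root of [h] is the polynomial in [h] that interpolates the square root
    on the spectrum; it is positive because it is itself the square of the
    polynomial that interpolates the fourth root. *)
Lemma psd_has_sqrt n (h : 'M[R]_n) : psd h -> exists s, psd s /\ s *m s = h.
Proof.
case: n h => [|n] h hp.
  exists 0; split; last by apply/matrixP => -[].
  split; first by rewrite /sym_mx/= trmx0.
  by move=> v; rewrite mulmx0 mul0mx mxE.
have [s [s0 hs]] := psd_functional_calculus hp.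
have [p pE] := poly_interpolation s (fun x => Num.sqrt (Num.sqrt x)).
pose r := horner_mx h p.
have rs : r^T = r by apply: trmx_horner_mx; case: hp.
exists (r *m r); split; first by rewrite -{1}rs; exact: psd_tr_mul.
rewrite mulmxE /r -!rmorphM/= -[RHS]horner_mx_X; apply: hs => x xs.
rewrite !hornerM !pE// hornerX -!expr2 !sqr_sqrtr ?sqrtr_ge0//.
exact: s0.
Qed.

End Spectrum.

(** * The Frobenius inner product *)

Section Frobenius.
Context {R : realType}.

Lemma mxdotE m n (A B : 'M[R]_(m, n)) :
  mxdot A B = \sum_i \sum_j A i j * B i j.
Proof.
rewrite /mxdot /mxtrace exchange_big/=; apply: eq_bigr => j _.
by rewrite mxE; apply: eq_bigr => i _; rewrite mxE.
Qed.

Lemma mxdotC m n (A B : 'M[R]_(m, n)) : mxdot A B = mxdot B A.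
Proof.
by rewrite !mxdotE; apply: eq_bigr => i _; apply: eq_bigr => j _; rewrite mulrC.
Qed.

Lemma mxdotDr m n (A B C : 'M[R]_(m, n)) :
  mxdot A (B + C) = mxdot A B + mxdot A C.
Proof. by rewrite /mxdot mulmxDr mxtraceD. Qed.

Lemma mxdotDl m n (A B C : 'M[R]_(m, n)) :
  mxdot (A + B) C = mxdot A C + mxdot B C.
Proof. by rewrite mxdotC mxdotDr !(mxdotC C). Qed.

Lemma mxdotZr m n c (A B : 'M[R]_(m, n)) :
  mxdot A (c *: B) = c * mxdot A B.
Proof. by rewrite /mxdot -scalemxAr mxtraceZ. Qed.

Lemma mxdotZl m n c (A B : 'M[R]_(m, n)) :
  mxdot (c *: A) B = c * mxdot A B.
Proof. by rewrite mxdotC mxdotZr mxdotC. Qed.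

Lemma mxdotNr m n (A B : 'M[R]_(m, n)) : mxdot A (- B) = - mxdot A B.
Proof. by rewrite -scaleN1r mxdotZr mulN1r. Qed.

Lemma mxdotNl m n (A B : 'M[R]_(m, n)) : mxdot (- A) B = - mxdot A B.
Proof. by rewrite mxdotC mxdotNr mxdotC. Qed.

Lemma mxdotBr m n (A B C : 'M[R]_(m, n)) :
  mxdot A (B - C) = mxdot A B - mxdot A C.
Proof. by rewrite mxdotDr mxdotNr. Qed.

Lemma mxdotBl m n (A B C : 'M[R]_(m, n)) :
  mxdot (A - B) C = mxdot A C - mxdot B C.
Proof. by rewrite mxdotDl mxdotNl. Qed.

Lemma mxdot0r m n (A : 'M[R]_(m, n)) : mxdot A 0 = 0.
Proof. by rewrite -(scale0r A) mxdotZr mul0r. Qed.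

Lemma mxdot_tr m n (A B : 'M[R]_(m, n)) : mxdot A^T B^T = mxdot A B.
Proof. by rewrite /mxdot trmxK mxtrace_mulC -mxtrace_tr trmx_mul trmxK mxtrace_mulC mxtrace_mulC. Qed.

Lemma mxdot_mull m n p (A : 'M[R]_(m, n)) (B : 'M[R]_(n, p)) C :
  mxdot (A *m B) C = mxdot B (A^T *m C).
Proof. by rewrite /mxdot trmx_mul mulmxA. Qed.

Lemma mxdot_mulr m n p (A : 'M[R]_(m, n)) (B : 'M[R]_(n, p)) C :
  mxdot (A *m B) C = mxdot A (C *m B^T).
Proof. by rewrite -mxdot_tr trmx_mul mxdot_mull trmxK -mxdot_tr !trmxK trmx_mul trmxK. Qed.

Lemma mxdot_ge0 m n (A : 'M[R]_(m, n)) : 0 <= mxdot A A.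
Proof.
by rewrite mxdotE sumr_ge0// => i _; rewrite sumr_ge0// => j _; rewrite -expr2 sqr_ge0.
Qed.

Lemma fnorm_ge0 m n (A : 'M[R]_(m, n)) : 0 <= fnorm A.
Proof. exact: sqrtr_ge0. Qed.

Lemma fnorm_sqr m n (A : 'M[R]_(m, n)) : fnorm A ^+ 2 = mxdot A A.
Proof. by rewrite sqr_sqrtr// mxdot_ge0. Qed.

Lemma fnorm_sqrE m n (A : 'M[R]_(m, n)) : fnorm A ^+ 2 = \sum_i \sum_j A i j ^+ 2.
Proof. by rewrite fnorm_sqr mxdotE. Qed.

Lemma mxdot_eq0 m n (A : 'M[R]_(m, n)) : mxdot A A = 0 -> A = 0.
Proof.
rewrite mxdotE => /psumr_eq0P A0; apply/matrixP => i j; rewrite mxE.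
have /psumr_eq0P Ai0 : \sum_j A i j * A i j = 0.
  by apply: A0 => // k _; rewrite sumr_ge0// => l _; rewrite -expr2 sqr_ge0.
apply/eqP; rewrite -sqrf_eq0 expr2 Ai0// => k _.
by rewrite -expr2 sqr_ge0.
Qed.

Lemma fnorm_eq0 m n (A : 'M[R]_(m, n)) : fnorm A = 0 -> A = 0.
Proof. by move=> A0; apply: mxdot_eq0; rewrite -fnorm_sqr A0 expr0n. Qed.

Lemma fnorm0 m n : fnorm (0 : 'M[R]_(m, n)) = 0.
Proof. by rewrite /fnorm mxdot0r sqrtr0. Qed.

Lemma fnormZ m n c (A : 'M[R]_(m, n)) : fnorm (c *: A) = `|c| * fnorm A.
Proof.
by rewrite /fnorm mxdotZl mxdotZr mulrA -expr2 sqrtrM ?sqr_ge0// sqrtr_sqr.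
Qed.

Lemma fnormN m n (A : 'M[R]_(m, n)) : fnorm (- A) = fnorm A.
Proof. by rewrite -scaleN1r fnormZ normrN1 mul1r. Qed.

Lemma fnorm_tr m n (A : 'M[R]_(m, n)) : fnorm A^T = fnorm A.
Proof. by rewrite /fnorm mxdot_tr. Qed.

Lemma le_sqr (a b : R) : 0 <= b -> a ^+ 2 <= b ^+ 2 -> a <= b.
Proof.
move=> b0 ab; have [a0|a0] := lerP 0 a; last by apply: le_trans b0; exact: ltW.
by rewrite -(@ler_pXn2r _ 2%N)// nnegrE.
Qed.

Lemma mxdot_le_sqr m n (A B : 'M[R]_(m, n)) :
  mxdot A B ^+ 2 <= mxdot A A * mxdot B B.
Proof.
have [B0|B0] := eqVneq (mxdot B B) 0.
  by rewrite (mxdot_eq0 B0) !mxdot0r mulr0 expr0n.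
have Bp : 0 < mxdot B B by rewrite lt_def B0 mxdot_ge0.
have := mxdot_ge0 (mxdot B B *: A - mxdot A B *: B).
rewrite mxdotBl !mxdotBr !(mxdotZl, mxdotZr) (mxdotC B A) => H.
have : 0 <= mxdot B B * (mxdot A A * mxdot B B - mxdot A B ^+ 2) by lra.
by rewrite pmulr_rge0// subr_ge0.
Qed.

Lemma mxdot_le m n (A B : 'M[R]_(m, n)) : `|mxdot A B| <= fnorm A * fnorm B.
Proof.
apply: le_sqr; first by rewrite mulr_ge0 ?fnorm_ge0.
by rewrite real_normK ?num_real// exprMn !fnorm_sqr mxdot_le_sqr.
Qed.

Lemma mxdot_ler m n (A B : 'M[R]_(m, n)) : mxdot A B <= fnorm A * fnorm B.
Proof. exact: le_trans (ler_norm _) (mxdot_le A B). Qed.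

Lemma fnormD m n (A B : 'M[R]_(m, n)) : fnorm (A + B) <= fnorm A + fnorm B.
Proof.
apply: le_sqr; first by rewrite addr_ge0 ?fnorm_ge0.
rewrite sqrrD !fnorm_sqr mxdotDl !mxdotDr (mxdotC B A).
have := mxdot_ler A B; lra.
Qed.

Lemma fnormB m n (A B : 'M[R]_(m, n)) : fnorm (A - B) <= fnorm A + fnorm B.
Proof. by rewrite -(fnormN B) fnormD. Qed.

Lemma fnormM m n p (A : 'M[R]_(m, n)) (B : 'M[R]_(n, p)) :
  fnorm (A *m B) <= fnorm A * fnorm B.
Proof.
apply: le_sqr; first by rewrite mulr_ge0 ?fnorm_ge0.
rewrite exprMn !fnorm_sqrE mulr_suml; apply: ler_sum => i _.
rewrite exchange_big/= mulr_sumr; apply: ler_sum => k _.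
have := mxdot_le_sqr (row i A)^T (col k B).
have colE (u v : 'cV[R]_n) : mxdot u v = \sum_j u j 0 * v j 0.
  by rewrite mxdotE; apply: eq_bigr => j _; rewrite big_ord1.
have E : mxdot (row i A)^T (col k B) = (A *m B) i k.
  by rewrite colE mxE; apply: eq_bigr => j _; rewrite !mxE.
have EA : mxdot (row i A)^T (row i A)^T = \sum_j A i j ^+ 2.
  by rewrite colE; apply: eq_bigr => j _; rewrite !mxE expr2.
have EB : mxdot (col k B) (col k B) = \sum_j B j k ^+ 2.
  by rewrite colE; apply: eq_bigr => j _; rewrite !mxE expr2.
by rewrite E EA EB.
Qed.

Lemma entry_le_fnorm m n (A : 'M[R]_(m, n)) i j : `|A i j| <= fnorm A.
Proof.
apply: le_sqr; rewrite ?fnorm_ge0// real_normK ?num_real// fnorm_sqrE.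
rewrite (bigD1 i)//= (bigD1 j)//= -addrA lerDl addr_ge0// ?sumr_ge0// => k _.
  exact: sqr_ge0.
by rewrite sumr_ge0// => l _; exact: sqr_ge0.
Qed.

Lemma fnorm_scalar n (c : R) : fnorm (c%:M : 'M[R]_n) = `|c| * Num.sqrt n%:R.
Proof.
rewrite -scalemx1 fnormZ /fnorm /mxdot trmx1 mul1mx; congr (_ * Num.sqrt _).
exact: mxtrace1.
Qed.

Lemma mxtrace_le n (A : 'M[R]_n) : \tr A <= Num.sqrt n%:R * fnorm A.
Proof.
have := mxdot_ler 1%:M A; rewrite fnorm_scalar normr1 mul1r.
by rewrite /mxdot trmx1 mul1mx.
Qed.

End Frobenius.

(** * Regularity of the square root *)

Section SquareRoot.
Context {R : realType} {n : nat}.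
Implicit Types h s a X : 'M[R]_n.

Lemma quadE h (v : 'cV[R]_n) : (v^T *m h *m v) 0 0 = mxdot v (h *m v).
Proof. by rewrite /mxdot mulmxA /mxtrace big_ord1. Qed.

Lemma psd_sqrtP h : psd h -> psd (psd_sqrt h) /\ psd_sqrt h *m psd_sqrt h = h.
Proof. by move=> /psd_has_sqrt; exact: xgetPex. Qed.

Lemma psd_sqrt_psd h : psd h -> psd (psd_sqrt h).
Proof. by move=> /psd_sqrtP[]. Qed.

Lemma psd_sqrtK h : psd h -> psd_sqrt h *m psd_sqrt h = h.
Proof. by move=> /psd_sqrtP[]. Qed.

Lemma psd_sym h : psd h -> h^T = h. Proof. by case. Qed.

Lemma psd_dotE h m (X : 'M[R]_(n, m)) : psd h ->
  mxdot X (h *m X) = fnorm (psd_sqrt h *m X) ^+ 2.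
Proof.
move=> hp; rewrite fnorm_sqr mxdot_mull (psd_sym (psd_sqrt_psd hp)) mulmxA.
by rewrite psd_sqrtK.
Qed.

Lemma psd_dot_ge0 h m (X : 'M[R]_(n, m)) : psd h -> 0 <= mxdot X (h *m X).
Proof. by move=> /psd_dotE ->; exact: sqr_ge0. Qed.

Lemma psd_dot_mulr_ge0 h m (X : 'M[R]_(m, n)) : psd h -> 0 <= mxdot X (X *m h).
Proof.
by move=> hp; rewrite -mxdot_tr trmx_mul (psd_sym hp) psd_dot_ge0.
Qed.

Lemma posdef_psd h : posdef h -> psd h.
Proof.
move=> [hs hp]; split=> // v; have [->|v0] := eqVneq v 0; last exact/ltW/hp.
by rewrite mulmx0 mxE.
Qed.

Lemma posdef_unit h : posdef h -> h \in unitmx.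
Proof.
move=> [hs hp]; rewrite -row_free_unit -kermx_eq0; apply/eqP/row_matrixP => i.
rewrite row0; apply/eqP/negPn/negP => v0.
have v0' : (row i (kermx h))^T != 0.
  by apply: contra v0 => /eqP/(congr1 trmx); rewrite trmxK trmx0 => ->.
by have := hp _ v0'; rewrite trmxK -row_mul mulmx_ker row0 mul0mx mxE ltxx.
Qed.

Lemma psd_unit_posdef h : psd h -> h \in unitmx -> posdef h.
Proof.
move=> hp hu; split; first exact: psd_sym.
move=> v v0; rewrite quadE psd_dotE// exprn_gt0// lt_def fnorm_ge0 andbT.
apply: contra v0 => /eqP/fnorm_eq0 /(congr1 (mulmx (psd_sqrt h))).
by rewrite mulmxA psd_sqrtK// mulmx0 => /(congr1 (mulmx (invmx h))); rewrite mulKmx// mulmx0 => ->.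
Qed.

Lemma posdef_sqrt h : posdef h -> posdef (psd_sqrt h).
Proof.
move=> hp; have hp' := posdef_psd hp; apply: psd_unit_posdef.
  exact: psd_sqrt_psd.
have := posdef_unit hp; rewrite -{1}(psd_sqrtK hp') unitmx_mul => /andP[]//.
Qed.

(** The best constant [mu] in [|X|^2 <= mu (X . sqrt h X)] is the inverse of
    the least eigenvalue of the root; this is the simplest upper bound for it
    that involves only norms. *)
Definition coercivity h : R := fnorm (invmx (psd_sqrt (psd_sqrt h))) ^+ 2.

Lemma coercivity_ge0 h : 0 <= coercivity h. Proof. exact: sqr_ge0. Qed.

Lemma sqrt_coercive h m (X : 'M[R]_(n, m)) : posdef h ->
  fnorm X ^+ 2 <= coercivity h * mxdot X (psd_sqrt h *m X).
Proof.
move=> /posdef_sqrt/[dup] /posdef_sqrt/posdef_unit ru /posdef_psd sp.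
rewrite psd_dotE// -exprMn; apply: lerXn2r.
- by rewrite nnegrE fnorm_ge0.
- by rewrite nnegrE mulr_ge0// fnorm_ge0.
by rewrite -{1}[X](mulKmx ru); exact: fnormM.
Qed.

Lemma coercivity_sqr_le h : posdef h ->
  coercivity h ^+ 2 <= n%:R * Num.sqrt n%:R * fnorm (invmx h).
Proof.
move=> hp; have sp := posdef_sqrt hp; have rp := posdef_sqrt sp.
have inv_sqr (k : 'M[R]_n) : posdef k ->
    fnorm (invmx (psd_sqrt k)) ^+ 2 <= Num.sqrt n%:R * fnorm (invmx k).
  move=> kp; have kpsd := posdef_psd kp; have ku := posdef_unit (posdef_sqrt kp).
  have tE : (invmx (psd_sqrt k))^T = invmx (psd_sqrt k).
    by rewrite trmx_inv (psd_sym (psd_sqrt_psd kpsd)).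
  rewrite fnorm_sqr /mxdot tE.
  have -> : invmx (psd_sqrt k) *m invmx (psd_sqrt k) = invmx k.
    rewrite -[in RHS](psd_sqrtK kpsd).
    apply: (can_inj (mulKmx (posdef_unit kp))).
    rewrite -{1}(psd_sqrtK kpsd) -mulmxA mulKVmx// mulmxV//.
    by rewrite psd_sqrtK// mulmxV// posdef_unit.
  exact: mxtrace_le.
apply: (@le_trans _ _ ((Num.sqrt n%:R * fnorm (invmx (psd_sqrt h))) ^+ 2)).
  rewrite lerXn2r ?nnegrE ?coercivity_ge0 ?mulr_ge0 ?fnorm_ge0//.
  exact: inv_sqr.
rewrite exprMn sqr_sqrtr// -mulrA ler_wpM2l//.
exact: inv_sqr.
Qed.

Lemma sqrt_fnorm_sqr_le h : psd h ->
  fnorm (psd_sqrt h) ^+ 2 <= Num.sqrt n%:R * fnorm h.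
Proof.
move=> hp; rewrite fnorm_sqr /mxdot (psd_sym (psd_sqrt_psd hp)) psd_sqrtK//.
exact: mxtrace_le.
Qed.

(** Pairing the equation with [X] leaves two nonnegative terms, one of which is
    coercive. *)
Lemma sylvester_bound h s X : posdef h -> psd s ->
  fnorm X <= coercivity h * fnorm (X *m s + psd_sqrt h *m X).
Proof.
move=> hp sp; have [->|X0] := eqVneq X 0.
  by rewrite fnorm0 mulr_ge0 ?coercivity_ge0 ?fnorm_ge0.
have Xp : 0 < fnorm X.
  by rewrite lt_def fnorm_ge0 andbT; apply: contra X0 => /eqP/fnorm_eq0->.
rewrite -(ler_pM2l Xp) -expr2 (le_trans (sqrt_coercive X hp))// mulrCA.
rewrite ler_wpM2l ?coercivity_ge0//.
apply: le_trans (mxdot_ler _ _); rewrite mxdotDr lerDr.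
exact: psd_dot_mulr_ge0.
Qed.

Lemma psd_sqrt_lipschitz h k : posdef h -> psd k ->
  fnorm (psd_sqrt k - psd_sqrt h) <= coercivity h * fnorm (k - h).
Proof.
move=> hp kp; have := sylvester_bound (psd_sqrt k - psd_sqrt h) hp (psd_sqrt_psd kp).
suff -> : (psd_sqrt k - psd_sqrt h) *m psd_sqrt k +
    psd_sqrt h *m (psd_sqrt k - psd_sqrt h) = k - h by [].
rewrite mulmxBl mulmxBr psd_sqrtK// psd_sqrtK; last exact: posdef_psd.
by rewrite addrA subrK.
Qed.

Lemma sym_mxD a b : sym_mx a -> sym_mx b -> sym_mx (a + b).
Proof. by rewrite /sym_mx/= linearD/= => -> ->. Qed.

Lemma sym_mxZ c a : sym_mx a -> sym_mx (c *: a).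
Proof. by rewrite /sym_mx/= linearZ/= => ->. Qed.

Lemma quad_scalar c (v : 'cV[R]_n) : mxdot v (c%:M *m v) = c * fnorm v ^+ 2.
Proof. by rewrite mul_scalar_mx mxdotZr fnorm_sqr. Qed.

Lemma psd_addscalar h c : psd h -> 0 <= c -> psd (h + c%:M).
Proof.
move=> [hs hp] c0; split; first by rewrite /sym_mx/= linearD/= hs tr_scalar_mx.
move=> v; rewrite quadE mulmxDl mxdotDr -quadE addr_ge0//.
by rewrite quad_scalar mulr_ge0// sqr_ge0.
Qed.

Lemma posdef_addscalar h c : psd h -> 0 < c -> posdef (h + c%:M).
Proof.
move=> [hs hp] c0; split; first by rewrite /sym_mx/= linearD/= hs tr_scalar_mx.
move=> v v0; rewrite quadE mulmxDl mxdotDr -quadE ltr_wpDl//.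
rewrite quad_scalar mulr_gt0// exprn_gt0// lt_def fnorm_ge0 andbT.
by apply: contra v0 => /eqP/fnorm_eq0->.
Qed.

(** The root is only Hoelder continuous on the boundary of the cone, so that
    the distance is of the order of the square root of the perturbation. *)
Lemma psd_sqrt_addscalar h c : psd h -> 0 < c ->
  fnorm (psd_sqrt (h + c%:M) - psd_sqrt h) ^+ 2 <= n%:R ^+ 3 * c.
Proof.
move=> hp c0; have kp := posdef_addscalar hp c0; set k := h + c%:M in kp *.
have ku := posdef_unit kp.
have inv_le : c * fnorm (invmx k) <= Num.sqrt n%:R.
  have [z0|z0] := eqVneq (fnorm (invmx k)) 0; first by rewrite z0 mulr0.
  have zp : 0 < fnorm (invmx k) by rewrite lt_def z0 fnorm_ge0.
  rewrite -(ler_pM2l zp); apply: (@le_trans _ _ (mxdot (invmx k) (k *m invmx k))).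
    rewrite mulmxDl mxdotDr mulrCA -expr2 mul_scalar_mx mxdotZr fnorm_sqr lerDr.
    exact: psd_dot_ge0.
  rewrite mulmxV// (le_trans (mxdot_ler _ _))// fnorm_scalar normr1 mul1r.
  by [].
have H : fnorm (psd_sqrt k - psd_sqrt h) <= coercivity k * (c * Num.sqrt n%:R).
  rewrite -fnormN opprB; apply: (le_trans (psd_sqrt_lipschitz kp hp)).
  by rewrite -(fnormN (h - k)) opprB /k [h + _]addrC addrK fnorm_scalar gtr0_norm.
apply: (@le_trans _ _ ((coercivity k * (c * Num.sqrt n%:R)) ^+ 2)).
  by rewrite lerXn2r ?nnegrE ?fnorm_ge0// (le_trans (fnorm_ge0 _) H).
rewrite exprMn; apply: (@le_trans _ _ (n%:R * Num.sqrt n%:R * fnorm (invmx k)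
    * (c * Num.sqrt n%:R) ^+ 2)).
  by rewrite ler_wpM2r ?sqr_ge0 ?coercivity_sqr_le.
rewrite exprMn sqr_sqrtr//.
have -> : n%:R * Num.sqrt n%:R * fnorm (invmx k) * (c ^+ 2 * n%:R)
  = c * n%:R ^+ 2 * Num.sqrt n%:R * (c * fnorm (invmx k)) by ring.
apply: (@le_trans _ _ (c * n%:R ^+ 2 * Num.sqrt n%:R * Num.sqrt n%:R)).
  by rewrite ler_wpM2l// !mulr_ge0// ltW.
rewrite -mulrA -expr2 sqr_sqrtr// le_eqVlt; apply/orP; left; apply/eqP; ring.
Qed.

(** The solution [D] of the Lyapunov equation [D s + s D = a]. *)
Definition lyapunov s a : 'M[R]_n :=
  vec_mx (mxvec a *m invmx (lin_mulmxr s + lin_mulmx s)).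

Lemma lyapunov_sum s (J : Type) (r : seq J) (F : J -> R) (a : J -> 'M[R]_n) :
  lyapunov s (\sum_(j <- r) F j *: a j) = \sum_(j <- r) F j *: lyapunov s (a j).
Proof.
rewrite /lyapunov linear_sum/= mulmx_suml linear_sum/=; apply: eq_bigr => j _.
by rewrite linearZ/= -scalemxAl linearZ.
Qed.

Lemma lyapunovE h a : posdef h ->
  lyapunov (psd_sqrt h) a *m psd_sqrt h + psd_sqrt h *m lyapunov (psd_sqrt h) a
  = a.
Proof.
move=> hp; set s := psd_sqrt h; set L := lin_mulmxr s + lin_mulmx s.
have LE X : mxvec X *m L = mxvec (X *m s + s *m X).
  by rewrite mulmxDr !mul_vec_lin/= linearD.
have Lu : L \in unitmx.
  rewrite -row_free_unit -kermx_eq0; apply/eqP/row_matrixP => i; rewrite row0.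
  have := mulmx_ker L => /(congr1 (row i)); rewrite row_mul row0.
  rewrite -[row i (kermx L)]vec_mxK LE => /(congr1 vec_mx).
  rewrite mxvecK linear0 => e.
  rewrite (_ : vec_mx (row i (kermx L)) = 0) ?linear0//.
  apply: fnorm_eq0; apply/eqP; rewrite eq_le fnorm_ge0 andbT.
  have := sylvester_bound (vec_mx (row i (kermx L))) hp
    (psd_sqrt_psd (posdef_psd hp)).
  by rewrite -/s e fnorm0 mulr0.
apply: (can_inj mxvecK); rewrite -LE /lyapunov -/s -/L.
by rewrite vec_mxK mulmxKV.
Qed.

Lemma lyapunov_unique h a X : posdef h ->
  X *m psd_sqrt h + psd_sqrt h *m X = a -> X = lyapunov (psd_sqrt h) a.
Proof.
move=> hp Xa; apply/eqP; rewrite -subr_eq0; apply/eqP/fnorm_eq0/eqP.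
rewrite eq_le fnorm_ge0 andbT.
have := sylvester_bound (X - lyapunov (psd_sqrt h) a) hp
  (psd_sqrt_psd (posdef_psd hp)).
by rewrite mulmxBl mulmxBr addrACA -opprD lyapunovE// Xa subrr fnorm0 mulr0.
Qed.

Lemma lyapunov_sym h a : posdef h -> sym_mx a ->
  (lyapunov (psd_sqrt h) a)^T = lyapunov (psd_sqrt h) a.
Proof.
move=> hp sa; apply: lyapunov_unique => //.
have ss := psd_sym (psd_sqrt_psd (posdef_psd hp)).
have := congr1 trmx (lyapunovE a hp).
by rewrite linearD/= !trmx_mul ss sa addrC.
Qed.

(** The difference of the root is the solution of a Lyapunov equation up to a
    quadratic error, because the root is already known to be Lipschitz. *)
Lemma psd_sqrt_taylor h a (e : R) : posdef h -> psd (h + e *: a) ->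
  fnorm (psd_sqrt (h + e *: a) - psd_sqrt h - e *: lyapunov (psd_sqrt h) a)
  <= coercivity h ^+ 3 * fnorm a ^+ 2 * e ^+ 2.
Proof.
move=> hp kp; have hp' := posdef_psd hp; have c0 := coercivity_ge0 h.
set k := h + e *: a in kp *; set s := psd_sqrt h; set X := psd_sqrt k - s.
set D := lyapunov s a.
have kh : k - h = e *: a by rewrite /k addrAC subrr add0r.
have Xl : fnorm X <= coercivity h * (`|e| * fnorm a).
  have := psd_sqrt_lipschitz hp kp.
  by rewrite kh fnormZ.
have E : (X - e *: D) *m s + s *m (X - e *: D) = - (X *m X).
  rewrite mulmxBl mulmxBr addrACA -opprD -scalemxAl -scalemxAr -scalerDr.
  rewrite lyapunovE// -/s.
  have -> : e *: a = psd_sqrt k *m psd_sqrt k - s *m s by rewrite !psd_sqrtK.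
  rewrite /X.
  rewrite !(mulmxBl, mulmxBr).
  move: (psd_sqrt k *m psd_sqrt k) (psd_sqrt k *m s) (s *m psd_sqrt k) (s *m s).
  by move=> p q r u; apply/matrixP => i j; rewrite !mxE; ring.
apply: (le_trans (sylvester_bound _ hp (psd_sqrt_psd hp'))).
rewrite -/s E fnormN.
have -> : coercivity h ^+ 3 * fnorm a ^+ 2 * e ^+ 2 = coercivity h *
    (coercivity h * (`|e| * fnorm a) * (coercivity h * (`|e| * fnorm a))).
  by rewrite -(real_normK (num_real e)); ring.
rewrite ler_wpM2l// (le_trans (fnormM _ _))//.
by apply: ler_pM => //; exact: fnorm_ge0.
Qed.

Lemma lyapunov_fnorm_le h a : posdef h ->
  fnorm (lyapunov (psd_sqrt h) a) <= coercivity h * fnorm a.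
Proof.
move=> hp; have := sylvester_bound (lyapunov (psd_sqrt h) a) hp
  (psd_sqrt_psd (posdef_psd hp)).
by rewrite lyapunovE.
Qed.

(** Near a positive definite matrix the derivative of the root is bounded
    uniformly, because the root stays coercive. *)
Lemma lyapunov_bounded_near h a : posdef h -> sym_mx a ->
  exists r : R, 0 < r /\ forall e, `|e| < r -> posdef (h + e *: a) /\
    fnorm (lyapunov (psd_sqrt (h + e *: a)) a) <= coercivity h * fnorm a /\
    fnorm (psd_sqrt (h + e *: a)) <= fnorm (psd_sqrt h) + 1.
Proof.
move=> hp sa; have hp' := posdef_psd hp; have c0 := coercivity_ge0 h.
pose nu := fnorm (invmx (psd_sqrt h)) ^+ 2.
have nu0 : 0 <= nu by exact: sqr_ge0.
have a0 := fnorm_ge0 a.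
pose S := 1 + 2 * coercivity h ^+ 2 * fnorm a + coercivity h * fnorm a
  + nu * fnorm a.
have t1 : 0 <= 2 * coercivity h ^+ 2 * fnorm a.
  by apply: mulr_ge0 => //; apply: mulr_ge0 => //; exact: sqr_ge0.
have t2 : 0 <= coercivity h * fnorm a by rewrite mulr_ge0.
have t3 : 0 <= nu * fnorm a by rewrite mulr_ge0.
have S1 : 1 <= S by rewrite /S; lra.
have S0 : 0 < S by apply: lt_le_trans S1.
exists S^-1; split; first by rewrite invr_gt0.
move=> e eS; have eS' : `|e| * S < 1.
  by rewrite -(mulVf (lt0r_neq0 S0)) ltr_pM2r.
have e0 : 0 <= `|e| by [].
have posde : posdef (h + e *: a).
  split; first by apply: sym_mxD; [case: hp|exact: sym_mxZ].
  move=> v v0; rewrite quadE mulmxDl mxdotDr -scalemxAl mxdotZr.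
  have vp : 0 < fnorm v ^+ 2.
    rewrite exprn_gt0// lt_def fnorm_ge0 andbT.
    by apply: contra v0 => /eqP/fnorm_eq0->.
  have vh : fnorm v ^+ 2 <= nu * mxdot v (h *m v).
    rewrite psd_dotE// -exprMn lerXn2r ?nnegrE ?mulr_ge0 ?fnorm_ge0//.
    have su := posdef_unit (posdef_sqrt hp).
    by rewrite -{1}[v](mulKmx su); exact: fnormM.
  have va : `|mxdot v (a *m v)| <= fnorm a * fnorm v ^+ 2.
    apply: le_trans (mxdot_le _ _) _; rewrite expr2 mulrCA ler_wpM2l ?fnorm_ge0//.
    exact: fnormM.
  have q0 := psd_dot_ge0 v hp'.
  have nup : 0 < nu.
    rewrite lt_def nu0 andbT; apply: contraTneq vh => ->.
    by rewrite mul0r -ltNge.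
  have ev : `|e * mxdot v (a *m v)| <= `|e| * (fnorm a * fnorm v ^+ 2).
    by rewrite normrM ler_wpM2l.
  suff : nu * (`|e| * (fnorm a * fnorm v ^+ 2)) < nu * mxdot v (h *m v).
    rewrite ltr_pM2l// => lt; move: ev; rewrite ler_norml => /andP[ev _].
    lra.
  apply: lt_le_trans vh.
  have -> : nu * (`|e| * (fnorm a * fnorm v ^+ 2))
    = (`|e| * (nu * fnorm a)) * fnorm v ^+ 2 by ring.
  rewrite -[ltRHS]mul1r ltr_pM2r//; apply: le_lt_trans eS'.
  by rewrite ler_wpM2l// /S; lra.
split=> //; have kp := posdef_psd posde.
set s := psd_sqrt (h + e *: a); set D := lyapunov s a.
have sl : fnorm (s - psd_sqrt h) <= coercivity h * (`|e| * fnorm a).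
  have := psd_sqrt_lipschitz hp kp.
  by rewrite [_ + _ - h]addrAC subrr add0r fnormZ.
split; last first.
  rewrite -[s](subrK (psd_sqrt h)) addrC (le_trans (fnormD _ _))// lerD2l.
  apply: (le_trans sl); apply: ltW; apply: le_lt_trans eS'.
  by rewrite mulrCA ler_wpM2l// /S; lra.
have DT : D^T = D := lyapunov_sym posde sa.
have Da : 2 * mxdot D (s *m D) = mxdot D a.
  have <- : mxdot D (D *m s) + mxdot D (s *m D) = mxdot D a.
    by rewrite -mxdotDr lyapunovE.
  have -> : mxdot D (D *m s) = mxdot D (s *m D).
    by rewrite -mxdot_tr trmx_mul DT (psd_sym (psd_sqrt_psd kp)).
  by ring.
have D1 := sqrt_coercive D hp.
have D2 : mxdot D ((psd_sqrt h - s) *m D) <= coercivity h * (`|e| * fnorm a) * fnorm D ^+ 2.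
  apply: le_trans (mxdot_ler _ _) _; rewrite expr2 mulrCA ler_wpM2l ?fnorm_ge0//.
  apply: (le_trans (fnormM _ _)); rewrite ler_wpM2r ?fnorm_ge0//.
  by rewrite -fnormN opprB.
have D3 := mxdot_ler D a.
have [D0|D0] := eqVneq (fnorm D) 0; first by rewrite D0 mulr_ge0.
have Dp : 0 < fnorm D by rewrite lt_def D0 fnorm_ge0.
rewrite -(ler_pM2l Dp) -expr2.
have half : 2 * coercivity h ^+ 2 * (`|e| * fnorm a) <= 1.
  apply: ltW; apply: le_lt_trans eS'; rewrite mulrCA ler_wpM2l//.
  by rewrite /S; lra.
move: D2; rewrite mulmxBl mxdotBr => D2.
have : coercivity h * (mxdot D (psd_sqrt h *m D) - mxdot D (s *m D)) <=
  coercivity h * (coercivity h * (`|e| * fnorm a) * fnorm D ^+ 2).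
  by rewrite ler_wpM2l.
have : coercivity h * mxdot D a <= coercivity h * (fnorm D * fnorm a).
  by rewrite ler_wpM2l.
have : 2 * coercivity h ^+ 2 * (`|e| * fnorm a) * fnorm D ^+ 2 <= 1 * fnorm D ^+ 2.
  by rewrite ler_wpM2r// sqr_ge0.
by rewrite -Da; lra.
Qed.

End SquareRoot.

(** * Gaussian vectors *)

Section Density.
Context d (T : measurableType d) (R : realType).
Local Open Scope ereal_scope.
Import HBNNSimple.

(** Simple functions, then monotone limits. *)
Lemma ge0_integral_density (mu nu : {measure set T -> \bar R}) (p : T -> R)
    (f : T -> \bar R) :
  measurable_fun setT p -> (forall x, (0 <= p x)%R) ->
  (forall A, measurable A -> nu A = \int[mu]_(x in A) (p x)%:E) ->
  measurable_fun setT f -> (forall x, 0 <= f x) ->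
  \int[nu]_x f x = \int[mu]_x (f x * (p x)%:E).
Proof.
move=> mp p0 nuE mf f0.
pose f_ := nnsfun_approx measurableT mf.
have fcvg x : (f_ n x)%:E @[n --> \oo] --> f x.
  by apply: cvg_nnsfun_approx => //.
have fnd x : {homo (fun n => (f_ n x)%:E) : m n / (m <= n)%N >-> m <= n}.
  by move=> m n mn; rewrite lee_fin; exact/lefP/nd_nnsfun_approx.
transitivity (limn (fun n => \int[nu]_x (f_ n x)%:E)).
  rewrite -monotone_convergence//.
  - by apply: eq_integral => x _; apply/esym/cvg_lim.
  - by move=> n; exact/measurable_EFinP.
  - by move=> n x _; rewrite lee_fin.
rewrite [X in limn X](_ : _ = fun n => \int[mu]_x ((f_ n x)%:E * (p x)%:E)).
  rewrite -monotone_convergence//.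
  - apply: eq_integral => x _; apply/cvg_lim => //.
    by apply: cvgeZr => //; exact: fcvg.
  - by move=> n; apply: emeasurable_funM => //; exact/measurable_EFinP.
  - by move=> n x _; rewrite mule_ge0// lee_fin.
  - by move=> x _ m n mn; rewrite lee_wpmul2r ?lee_fin//; exact: fnd.
apply/funext => n.
rewrite integralT_nnsfun sintegralE.
transitivity (\sum_(k \in range (f_ n))
    \int[mu]_x ((k * \1_(f_ n @^-1` [set k]) x)%:E * (p x)%:E)).
  apply: eq_fsbigr => k; rewrite inE => -[z _ <-].
  rewrite [RHS](eq_integral (fun x => (f_ n z)%:E *
    ((\1_(f_ n @^-1` [set f_ n z]) x)%:E * (p x)%:E))); last first.
    by move=> x _; rewrite muleA -EFinM.
  rewrite [RHS]ge0_integralZl//.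
  - rewrite nuE// [in LHS]integral_mkcond; congr (_ * _).
    apply: eq_integral => x _; rewrite patchE indicE.
    by case: ifPn; rewrite ?mul1e ?mul0e.
  - by apply: emeasurable_funM; exact/measurable_EFinP.
  - by move=> x _; rewrite mule_ge0// lee_fin.
  - by rewrite lee_fin.
rewrite -ge0_integral_fsum//.
- apply: eq_integral => x _.
  rewrite [in RHS]fimfunE -fsumEFin//.
  rewrite ge0_mule_fsuml// => k.
  by have := nnfun_muleindic_ge0 (f_ n) k x.
- by move=> k; apply: emeasurable_funM; apply/measurable_EFinP => //; exact: measurable_funM.
- move=> k x _; rewrite mule_ge0 ?lee_fin//.
  by have := nnfun_muleindic_ge0 (f_ n) k x.
Qed.

End Density.

Section GaussianVector.
Context {R : realType}.

(** The Cameron-Martin formula as a definition of the standard Gaussian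
    vectors: translating the vector amounts to changing the density. It
    characterizes the law, is stable under products, and yields exponential
    moments, integration by parts and the Nishimori identity directly. *)
Definition gaussian_vector (I : finType) d (G : measurableType d)
    (gam : probability G R) (g : G -> I -> R) : Prop :=
  (forall i, measurable_fun setT (g^~ i)) /\
  forall b : I -> R, exists tau : G -> G, [/\ measurable_fun setT tau,
    forall w i, g (tau w) i = g w i + b i &
    forall f : G -> \bar R, measurable_fun setT f -> (forall w, 0 <= f w)%E ->
    (\int[gam]_w f (tau w) = \int[gam]_w
      (f w * (expR (\sum_i b i * g w i - 2^-1 * \sum_i b i ^+ 2))%:E))%E].

Lemma lebesgue_integral_shift (c : R) (f : R -> \bar R) :
  measurable_fun setT f -> (forall x, 0 <= f x)%E ->
  (\int[@lebesgue_measure R]_x f ((x : R) + c)%R = \int[@lebesgue_measure R]_x f x)%E.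
Proof.
move=> mf f0.
have msh : measurable_fun [set: measurableTypeR R] (fun x : measurableTypeR R => (x + c) : measurableTypeR R).
  exact: measurable_funD.
pose mu := pushforward (@lebesgue_measure R) (fun x : measurableTypeR R => (x + c) : measurableTypeR R).
transitivity (\int[mu]_x f x)%E.
  by rewrite ge0_integral_pushforward.
apply: eq_measure_integral => A mA _; apply/esym.
apply: lebesgue_measure_unique => // X [[a b] /= _ <-].
rewrite /pushforward.
have -> : (fun x : R => x + c) @^-1` `]a, b]%classic = `]a - c, b - c]%classic.
  by apply/seteqP; split => x /=; rewrite !in_itv/= ltrBlDr lerBrDr.
rewrite !lebesgue_measure_itv/= !lte_fin ltrD2r; case: ifP => // _.
by rewrite -!EFinB opprB addrA addrAC -!addrA; congr _%:E; ring.
Qed.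

Lemma std_normal_gaussian_vector :
  gaussian_vector (std_normal R) (fun (x : R) (_ : 'I_1) => x).
Proof.
split=> [_|b]; first exact: measurable_id.
exists (fun x => x + b ord0); split.
- by apply: measurable_funD; [exact: measurable_id|exact: measurable_cst].
- by move=> w i; rewrite (ord1 i).
move=> f mf f0; under [RHS]eq_integral do rewrite !big_ord1.
have stdE (k : R -> \bar R) : measurable_fun setT k -> (forall x, 0 <= k x)%E ->
    (\int[std_normal R]_x k x =
     \int[@lebesgue_measure R]_x (k x * (normal_pdf 0 1 x)%:E))%E.
  move=> mk k0; rewrite ge0_integral_distribution//.
  apply: ge0_integral_density => //.
  - exact: measurable_normal_pdf.
  - by move=> x; exact: normal_pdf_ge0.
have mfe : measurable_fun setT (fun x : R =>
    (f x * (expR (b ord0 * x - 2^-1 * b ord0 ^+ 2))%:E)%E).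
  apply: emeasurable_funM => //; apply/measurable_EFinP.
  apply: measurableT_comp => //.
  by apply: measurable_funB => //; exact: measurable_funM.
have mfb : measurable_fun setT (fun x : R => f (x + b ord0)).
  by apply: measurableT_comp => //; exact: measurable_funD.
rewrite !stdE//; last by move=> x; rewrite mule_ge0// lee_fin expR_ge0.
have npdf x : normal_pdf 0 1 x = normal_peak 1 * expR (- x ^+ 2 / 2) :> R.
  by rewrite /normal_pdf oner_eq0 /normal_fun subr0 expr1n.
under [RHS]eq_integral do rewrite -muleA.
rewrite -[RHS](lebesgue_integral_shift (b ord0)); last 2 first.
- under eq_fun do rewrite muleA; apply: emeasurable_funM => //.
  by apply/measurable_EFinP; exact: measurable_normal_pdf.
- by move=> x; rewrite !mule_ge0// lee_fin ?expR_ge0 ?normal_pdf_ge0.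
apply: eq_integral => x _; congr *%E.
rewrite !npdf -EFinM mulrCA; congr (_ * _)%:E.
rewrite -expRD; congr expR; by field.
Qed.

Lemma tnth_cons_pair0 d (T : measurableType d) n (p : T * n.-tuple T) :
  tnth (cons_pair p) ord0 = p.1.
Proof. by rewrite (tnth_nth p.1). Qed.

Lemma tnth_cons_pairS d (T : measurableType d) n (p : T * n.-tuple T) i :
  tnth (cons_pair p) (lift ord0 i) = tnth p.2 i.
Proof. by rewrite !(tnth_nth p.1). Qed.

(** Change of density for a product law is proved coordinate by coordinate. *)
Lemma power_prob_change d (T : measurableType d) (P : probability T R) n
    (tau : 'I_n -> T -> T) (rho : 'I_n -> T -> R) :
  (forall i, measurable_fun setT (tau i)) ->
  (forall i, measurable_fun setT (rho i)) ->
  (forall i x, 0 <= rho i x) ->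
  (forall i (f : T -> \bar R), measurable_fun setT f ->
    (forall x, 0 <= f x)%E ->
    (\int[P]_x f (tau i x) = \int[P]_x (f x * (rho i x)%:E))%E) ->
  forall f : n.-tuple T -> \bar R, measurable_fun setT f ->
    (forall x, 0 <= f x)%E ->
  (\int[power_prob P n]_x f [tuple tau i (tnth x i) | i < n] =
   \int[power_prob P n]_x (f x * (\prod_(i < n) rho i (tnth x i))%:E))%E.
Proof.
elim: n tau rho => [|n ih] tau rho mtau mrho rho0 H f mf f0.
  apply: eq_integral => x _; rewrite big_ord0 mule1; congr f.
  by apply: eq_from_tnth => -[].
have mtau' : measurable_fun setT
    (fun x : n.+1.-tuple T => [tuple tau i (tnth x i) | i < n.+1]).
  apply/measurable_fun_tnthP => i.
  rewrite (_ : _ \o _ = tau i \o (@tnth _ T ^~ i)).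
    by apply: measurableT_comp => //; exact: measurable_tnth.
  by apply/funext => x /=; rewrite tnth_mktuple.
have mprod : measurable_fun setT
    (fun x : n.+1.-tuple T => \prod_(i < n.+1) rho i (tnth x i)).
  apply: measurable_prod => i _; apply: measurableT_comp => //.
  exact: measurable_tnth.
have prod0 (x : n.+1.-tuple T) : 0 <= \prod_(i < n.+1) rho i (tnth x i).
  by rewrite prodr_ge0.
pose f1 := fun x : n.+1.-tuple T => f [tuple tau i (tnth x i) | i < n.+1].
pose f2 := fun x : n.+1.-tuple T =>
  (f x * (\prod_(i < n.+1) rho i (tnth x i))%:E)%E.
have mf1 : measurable_fun setT f1 by exact: measurableT_comp.
have mf2 : measurable_fun setT f2.
  by apply: emeasurable_funM => //; exact/measurable_EFinP.
have f20 x : (0 <= f2 x)%E by rewrite mule_ge0// lee_fin.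
rewrite -[LHS]/(\int[_]_x f1 x)%E -[RHS]/(\int[_]_x f2 x)%E.
rewrite !ge0_integral_distribution//; last by move=> y; exact: f0.
rewrite !fubini_tonelli1//=; last 3 first.
- exact: measurableT_comp mf2 (@measurable_cons_pair _ _ _).
- exact: measurableT_comp mf1 (@measurable_cons_pair _ _ _).
- by move=> x; exact: f0.
rewrite /fubini_F.
pose F x := (\int[power_prob P n]_y f (cons_pair (x, [tuple tau (lift ord0 i) (tnth y i) | i < n])))%E.
transitivity (\int[P]_x F (tau ord0 x))%E.
  apply: eq_integral => x _; apply: eq_integral => y _; congr f.
  apply: eq_from_tnth => i; rewrite tnth_mktuple.
  have [->|] := eqVneq i ord0; first by rewrite !tnth_cons_pair0.
  rewrite eq_sym => /unlift_some[j -> _].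
  by rewrite !tnth_cons_pairS tnth_mktuple.
have mtaun : measurable_fun setT
    (fun y : n.-tuple T => [tuple tau (lift ord0 i) (tnth y i) | i < n]).
  apply/measurable_fun_tnthP => i.
  rewrite (_ : _ \o _ = tau (lift ord0 i) \o (@tnth _ T ^~ i)).
    by apply: measurableT_comp => //; exact: measurable_tnth.
  by apply/funext => x /=; rewrite tnth_mktuple.
have mprodn : measurable_fun setT
    (fun x : n.-tuple T => \prod_(i < n) rho (lift ord0 i) (tnth x i)).
  apply: measurable_prod => i _; apply: measurableT_comp => //.
  exact: measurable_tnth.
have mfc : measurable_fun setT (f \o @cons_pair _ T n).
  exact: measurableT_comp mf (@measurable_cons_pair _ _ _).
rewrite (H ord0); last 2 first.
- apply: (measurable_fun_fubini_tonelli_F (fun p : T * n.-tuple T =>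
    f (cons_pair (p.1, [tuple tau (lift ord0 i) (tnth p.2 i) | i < n])))).
    apply: (@measurableT_comp _ _ _ _ _ _ _ _ (fun p : T * n.-tuple T =>
      (p.1, [tuple tau (lift ord0 i) (tnth p.2 i) | i < n])) mfc).
    apply/measurable_fun_pair => //.
    exact: (measurableT_comp mtaun).
  by move=> p; exact: f0.
- by move=> x; exact: integral_ge0.
apply: eq_integral => x _.
have mfx : measurable_fun setT (fun y => f (cons_pair (x, y))).
  exact: (measurableT_comp mfc (pair1_measurable x)).
rewrite /F (ih (fun i => tau (lift ord0 i)) (fun i => rho (lift ord0 i)) _ _ _ _
  (fun y => f (cons_pair (x, y))))//; last first.
  by move=> i; exact: H.
rewrite -ge0_integralZr//.
- apply: eq_integral => y _; rewrite /f2/= big_ord_recl tnth_cons_pair0/=.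
  rewrite -muleA -EFinM mulrC; congr (_ * (_ * _)%:E)%E.
  by apply: eq_bigr => i _; rewrite tnth_cons_pairS.
- by apply: emeasurable_funM => //; exact/measurable_EFinP.
- by move=> y _; rewrite mule_ge0// lee_fin prodr_ge0.
- by rewrite lee_fin.
Qed.

Lemma gaussian_vector_power (I : finType) d (T : measurableType d)
    (gam : probability T R) (g : T -> I -> R) n :
  gaussian_vector gam g ->
  gaussian_vector (power_prob gam n) (fun x (i : 'I_n * I) => g (tnth x i.1) i.2).
Proof.
move=> [mg CM]; split=> [[i k]|b].
  by apply: (measurableT_comp (mg k)); exact: measurable_tnth.
have /choice[tau tauP] : forall i : 'I_n, exists tau : T -> T, _ :=
  fun i => CM (fun k => b (i, k)).
exists (fun x => [tuple tau i (tnth x i) | i < n]); split.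
- apply/measurable_fun_tnthP => i.
  rewrite (_ : _ \o _ = tau i \o (@tnth _ T ^~ i)).
    by apply: measurableT_comp; [case: (tauP i)|exact: measurable_tnth].
  by apply/funext => x /=; rewrite tnth_mktuple.
- by move=> w [i k]; rewrite tnth_mktuple/=; case: (tauP i) => _ ->.
move=> f mf f0; rewrite (@power_prob_change _ _ gam n tau (fun i x =>
  expR (\sum_k b (i, k) * g x k - 2^-1 * \sum_k b (i, k) ^+ 2)))//.
- apply: eq_integral => x _; rewrite -expR_sum; congr (_ * (expR _)%:E)%E.
  rewrite sumrB -mulr_sumr !pair_bigA/=.
  by congr (_ - _ * _); apply: eq_bigr => -[i k].
- by move=> i; case: (tauP i).
- move=> i; apply: measurableT_comp => //; apply: measurable_funB => //.
  by apply: measurable_sum => k _; exact: measurable_funM.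
- by move=> i; case: (tauP i).
Qed.

Lemma gaussian_vector_prod (I J : finType) d1 (G1 : measurableType d1)
    d2 (G2 : measurableType d2) (gam1 : probability G1 R)
    (gam2 : probability G2 R) (g1 : G1 -> I -> R) (g2 : G2 -> J -> R) :
  gaussian_vector gam1 g1 -> gaussian_vector gam2 g2 ->
  gaussian_vector (gam1 \x gam2)%E (fun w (k : I + J) =>
    match k with inl i => g1 w.1 i | inr j => g2 w.2 j end).
Proof.
move=> [mg1 CM1] [mg2 CM2]; split=> [[i|j]|b].
- exact: (measurableT_comp (mg1 i) measurable_fst).
- exact: (measurableT_comp (mg2 j) measurable_snd).
have [t1 [mt1 gt1 T1]] := CM1 (fun i => b (inl i)).
have [t2 [mt2 gt2 T2]] := CM2 (fun j => b (inr j)).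
have mt : measurable_fun setT (fun w : G1 * G2 => (t1 w.1, t2 w.2)).
  apply/measurable_fun_pair; first exact: (measurableT_comp mt1 measurable_fst).
  exact: (measurableT_comp mt2 measurable_snd).
exists (fun w => (t1 w.1, t2 w.2)); split => //.
  by move=> w [i|j] /=; rewrite ?gt1 ?gt2.
move=> f mf f0.
pose r1 x := expR (\sum_i b (inl i) * g1 x i - 2^-1 * \sum_i b (inl i) ^+ 2).
pose r2 y := expR (\sum_j b (inr j) * g2 y j - 2^-1 * \sum_j b (inr j) ^+ 2).
have mr1 : measurable_fun setT r1.
  apply: measurableT_comp => //; apply: measurable_funB => //.
  by apply: measurable_sum => k; exact: measurable_funM.
have mr2 : measurable_fun setT r2.
  apply: measurableT_comp => //; apply: measurable_funB => //.
  by apply: measurable_sum => k; exact: measurable_funM.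
under [RHS]eq_integral => w _.
  rewrite (_ : expR _ = r1 w.1 * r2 w.2); last first.
    rewrite /r1 /r2 -expRD; congr expR.
    by rewrite !big_sumType/=; ring.
  over.
have mf1 : measurable_fun setT (fun w : G1 * G2 => f (t1 w.1, t2 w.2)).
  exact: (measurableT_comp mf mt).
have mf2 : measurable_fun setT (fun w : G1 * G2 => (f w * (r1 w.1 * r2 w.2)%:E)%E).
  apply: emeasurable_funM => //; apply/measurable_EFinP; apply: measurable_funM.
    exact: (measurableT_comp mr1 measurable_fst).
  exact: (measurableT_comp mr2 measurable_snd).
rewrite [LHS]fubini_tonelli1// [RHS]fubini_tonelli1//; last first.
  by move=> w; rewrite mule_ge0// lee_fin mulr_ge0// expR_ge0.
rewrite /fubini_F/=.
pose F x := (\int[gam2]_y f (x, t2 y))%E.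
have F0 x : (0 <= F x)%E by exact: integral_ge0.
rewrite -[LHS]/(\int[gam1]_x F (t1 x))%E T1//; last first.
  apply: (measurable_fun_fubini_tonelli_F (fun p : G1 * G2 => f (p.1, t2 p.2))) => //.
  apply: (@measurableT_comp _ _ _ _ _ _ _ _ (fun p : G1 * G2 =>
    (p.1, t2 p.2)) mf).
  by apply/measurable_fun_pair => //; exact: (measurableT_comp mt2).
apply: eq_integral => x _; rewrite /F (T2 (fun y => f (x, y)))//; last first.
  exact: (measurableT_comp mf (pair1_measurable _)).
rewrite -ge0_integralZr//.
- by apply: eq_integral => y _; rewrite -muleA -EFinM mulrC.
- apply: emeasurable_funM.
    exact: (measurableT_comp mf (pair1_measurable _)).
  by apply/measurable_EFinP.
- by move=> y _; rewrite mule_ge0// lee_fin expR_ge0.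
Qed.

Lemma gaussian_vector_reindex (I J : finType) d (G : measurableType d)
    (gam : probability G R) (g : G -> I -> R) (s : J -> I) (s' : I -> J) :
  cancel s s' -> cancel s' s -> gaussian_vector gam g ->
  gaussian_vector gam (fun w j => g w (s j)).
Proof.
move=> ss' s's [mg CM]; split=> [j|b]; first exact: mg.
have [tau [mtau gtau H]] := CM (b \o s').
exists tau; split.
- exact: mtau.
- by move=> w j; rewrite gtau/= ss'.
move=> f mf f0; rewrite (H f mf f0); apply: eq_integral => w _.
have E (F : I -> R) : \sum_i F i = \sum_j F (s j).
  by rewrite (reindex s)//; exists s' => ? _; rewrite ?ss' ?s's.
have E1 : \sum_i (b \o s') i * g w i = \sum_j b j * g w (s j).
  by rewrite E; apply: eq_bigr => j _; rewrite /= ss'.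
have E2 : \sum_i (b \o s') i ^+ 2 = \sum_j b j ^+ 2.
  by rewrite E; apply: eq_bigr => j _; rewrite /= ss'.
by rewrite E1 E2.
Qed.

End GaussianVector.

(** * Differentiation under the Gaussian expectation *)

Lemma Rintegral_is_derive {R : realType} d (T : measurableType d)
    (mu : {measure set T -> \bar R}) (F F' : R -> T -> R) (H : T -> R) (a r : R) :
  0 < r ->
  (forall s, `|s - a| < r -> mu.-integrable setT (EFin \o F s)) ->
  (forall s x, `|s - a| < r -> is_derive s 1 (F^~ x) (F' s x)) ->
  mu.-integrable setT (EFin \o H) ->
  (forall s x, `|s - a| < r -> `|F' s x| <= H x) ->
  is_derive a 1 (fun s => \int[mu]_x F s x) (\int[mu]_x F' a x).
Proof.
move=> r0 iF dF iH FH.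
have inr s : `]a - r, a + r[%classic s -> `|s - a| < r.
  by rewrite /= in_itv/= -ltr_distl.
have Ia : `]a - r, a + r[%classic a.
  by rewrite /= in_itv/= ltrDl gtrDl oppr_lt0 r0.
have d1 s x : `|s - a| < r -> partial1of2 F s x = F' s x.
  by move=> /dF sr; rewrite partial1of2E; apply: derive_val.
have H0 x : 0 <= H x.
  by apply: le_trans (FH a x _); rewrite // subrr normr0.
have dF1 s x : `]a - r, a + r[%classic s -> setT x -> derivable (F^~ x) s 1.
  by move=> /inr/dF sr _; exact: ex_derive.
have iF1 s : `]a - r, a + r[%classic s -> mu.-integrable setT (EFin \o F s).
  by move=> /inr; exact: iF.
have bF1 s x : `]a - r, a + r[%classic s -> setT x -> `|partial1of2 F s x| <= H x.
  by move=> /inr sr _; rewrite d1//; exact: FH.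
have D1 := derivable_under_integral measurableT Ia iF1 dF1 H0 iH bF1.
apply: DeriveDef => //; rewrite -derive1E.
rewrite (differentiation_under_integral measurableT Ia iF1 dF1 H0 iH bF1).
by apply: eq_Rintegral => x _; rewrite d1// subrr normr0.
Qed.

Section DerivativeRules.
Context {R : realType}.
Implicit Types (f h : R -> R) (x a b k : R).

Lemma der_eq f x a b : is_derive x 1 f a -> a = b -> is_derive x 1 f b.
Proof. by move=> + <-. Qed.

Lemma der_cst k x : is_derive x 1 (fun=> k) (0 : R).
Proof. exact: is_derive_cst. Qed.

Lemma der_id x : is_derive x 1 (fun t : R => t) (1 : R).
Proof. exact: is_derive_id. Qed.

Lemma derD f h x a b : is_derive x 1 f a -> is_derive x 1 h b ->
  is_derive x 1 (fun t => f t + h t) (a + b).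
Proof. exact: is_deriveD. Qed.

Lemma derN f x a : is_derive x 1 f a -> is_derive x 1 (fun t => - f t) (- a).
Proof. exact: is_deriveN. Qed.

Lemma derB f h x a b : is_derive x 1 f a -> is_derive x 1 h b ->
  is_derive x 1 (fun t => f t - h t) (a - b).
Proof. by move=> fa hb; apply: derD => //; exact: derN. Qed.

Lemma derM f h x a b : is_derive x 1 f a -> is_derive x 1 h b ->
  is_derive x 1 (fun t => f t * h t) (a * h x + f x * b).
Proof.
move=> fa hb; apply: der_eq (is_deriveM fa hb) _.
by rewrite /GRing.scale/= addrC (mulrC a).
Qed.

Lemma derZ k f x a : is_derive x 1 f a -> is_derive x 1 (fun t => k * f t) (k * a).
Proof. by move=> fa; apply: der_eq (derM (der_cst k x) fa) _; rewrite mul0r add0r. Qed.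

Lemma der_sum (J : Type) (r : seq J) (f : J -> R -> R) (a : J -> R) x :
  (forall j, is_derive x 1 (f j) (a j)) ->
  is_derive x 1 (fun t => \sum_(j <- r) f j t) (\sum_(j <- r) a j).
Proof.
move=> fa; elim: r => [|j r ih].
  by rewrite big_nil; under eq_fun do rewrite big_nil; exact: der_cst.
by rewrite big_cons; under eq_fun do rewrite big_cons; exact: derD.
Qed.

Lemma der_comp f h x a b : is_derive (h x) 1 f a -> is_derive x 1 h b ->
  is_derive x 1 (fun t => f (h t)) (a * b).
Proof. exact: is_derive1_comp. Qed.

Lemma der_expR f x a : is_derive x 1 f a ->
  is_derive x 1 (fun t => expR (f t)) (expR (f x) * a).
Proof. by move=> fa; apply: der_comp fa; exact: is_derive_expR. Qed.

Lemma der_ln f x a : 0 < f x -> is_derive x 1 f a ->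
  is_derive x 1 (fun t => ln (f t)) (a / f x).
Proof.
by move=> f0 fa; rewrite mulrC; apply: (der_comp _ fa); exact: is_derive1_ln.
Qed.

Lemma derV f x a : f x != 0 -> is_derive x 1 f a ->
  is_derive x 1 (fun t => (f t)^-1) (- (a / f x ^+ 2)).
Proof.
move=> f0 fa; apply: (der_eq (realfun.is_deriveV f0 fa)).
by rewrite /GRing.scale/= mulNr mulrC.
Qed.

Lemma der_div f h x a b : h x != 0 -> is_derive x 1 f a -> is_derive x 1 h b ->
  is_derive x 1 (fun t => f t / h t) ((a - f x / h x * b) / h x).
Proof.
move=> h0 fa hb; apply: der_eq (derM fa (derV h0 hb)) _.
by field.
Qed.

Lemma der_shift f (c x l : R) :
  is_derive (0 : R) 1 (fun e => f (c + e)) l -> c = x -> is_derive x 1 f l.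
Proof.
move=> df <-; rewrite (_ : f = (fun t => f (c + (t - c)))); last first.
  by apply/funext => t /=; rewrite addrCA subrr addr0.
rewrite -[l]mulr1; apply: (@der_comp (fun e => f (c + e)) (fun t => t - c)).
  by rewrite subrr.
exact: (der_eq (derB (der_id c) (der_cst c c)) (subr0 _)).
Qed.

End DerivativeRules.

Section Growth.
Context {R : realType} {I : finType}.
Implicit Types (y b : I -> R).

Definition dot (a b : I -> R) : R := \sum_i a i * b i.

(** Bounded below by 1, so that [expR (c * size1 y)] also dominates constants and
    products of such bounds are bounds of the same form. *)
Definition size1 y : R := 1 + \sum_i `|y i|.

Lemma size1_ge1 y : 1 <= size1 y.
Proof. by rewrite lerDl sumr_ge0. Qed.

Lemma size1_ge0 y : 0 <= size1 y.
Proof. exact: le_trans ler01 (size1_ge1 y). Qed.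

Lemma normr_le_size1 y i : `|y i| <= size1 y.
Proof.
rewrite /size1 (bigD1 i)//= addrCA lerDl addr_ge0// sumr_ge0//.
Qed.

(** The parameter [s] makes the bound uniform along a path, as domination under
    the expectation requires. *)
Definition growth S (D : set S) (f : S -> (I -> R) -> R) : Prop :=
  exists2 c, 0 <= c & forall s, D s -> forall y, `|f s y| <= expR (c * size1 y).

Section Closure.
Context {S : Type} {D : set S}.
Implicit Types f h : S -> (I -> R) -> R.

Lemma growth_le f h : (forall s, D s -> forall y, `|f s y| <= `|h s y|) ->
  growth D h -> growth D f.
Proof. by move=> fh [c c0 hc]; exists c => // s Ds y; exact: le_trans (fh _ _ _) (hc _ _ _). Qed.

Lemma growth_cst (k : R) : growth D (fun _ _ => k).
Proof.
exists `|k| => // s _ y; apply: (@le_trans _ _ (expR `|k|)).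
  apply: le_trans (expR_ge1Dx _); lra.
by rewrite ler_expR ler_peMr// size1_ge1.
Qed.

Lemma growth_coord i : growth D (fun _ y => y i).
Proof.
exists 1 => // s _ y; rewrite mul1r; apply: le_trans (normr_le_size1 y i) _.
by apply: le_trans (expR_ge1Dx _); rewrite lerDr.
Qed.

Lemma growthM f h : growth D f -> growth D h ->
  growth D (fun s y => f s y * h s y).
Proof.
move=> [c c0 fc] [e e0 he]; exists (c + e); first exact: addr_ge0.
by move=> s Ds y; rewrite normrM mulrDl expRD ler_pM// ?fc ?he.
Qed.

Lemma growthN f : growth D f -> growth D (fun s y => - f s y).
Proof. by move=> [c c0 fc]; exists c => // s Ds y; rewrite normrN fc. Qed.

Lemma growthD f h : growth D f -> growth D h ->
  growth D (fun s y => f s y + h s y).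
Proof.
move=> [c c0 fc] [e e0 he]; exists (c + e + 1); first by rewrite !addr_ge0.
move=> s Ds y; apply: le_trans (ler_normD _ _) _.
have y1 := size1_ge1 y; have y0 := size1_ge0 y.
apply: (@le_trans _ _ (2 * expR ((c + e) * size1 y))).
  have H1 : `|f s y| <= expR ((c + e) * size1 y).
    by apply: le_trans (fc _ Ds _) _; rewrite ler_expR ler_wpM2r// lerDl.
  have H2 : `|h s y| <= expR ((c + e) * size1 y).
    by apply: le_trans (he _ Ds _) _; rewrite ler_expR ler_wpM2r// lerDr.
  lra.
rewrite [(c + e + 1) * _]mulrDl mul1r expRD mulrC ler_wpM2l ?expR_ge0//.
by apply: le_trans (expR_ge1Dx _); lra.
Qed.

Lemma growthB f h : growth D f -> growth D h ->
  growth D (fun s y => f s y - h s y).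
Proof. by move=> ff hh; apply: growthD => //; exact: growthN. Qed.

Lemma growth_sum (J : Type) (r : seq J) (f : J -> S -> (I -> R) -> R) :
  (forall j, growth D (f j)) -> growth D (fun s y => \sum_(j <- r) f j s y).
Proof.
move=> ff; elim: r => [|j r ih].
  by under eq_fun do under eq_fun do rewrite big_nil; exact: growth_cst.
by under eq_fun do under eq_fun do rewrite big_cons; exact: growthD.
Qed.

End Closure.

(** The functions of a vector are not given a sigma-algebra on their domain; they
    are measurable if they turn measurable coordinates, on any space, into a
    measurable function. *)
Definition vector_measurable (f : (I -> R) -> R) : Prop :=
  forall d (T : measurableType d) (y : T -> I -> R),
    (forall i, measurable_fun setT (y^~ i)) -> measurable_fun setT (f \o y).

(** The class of functions of the observation that are integrable under every
    Gaussian shift; it is an algebra and contains the Gibbs averages. *)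
Definition tame (f : (I -> R) -> R) : Prop :=
  vector_measurable f /\ growth setT (fun (_ : unit) => f).

Lemma tame_growth S (D : set S) f : tame f -> growth D (fun _ => f).
Proof. by case=> _ [c c0 fc]; exists c => // s _ y; exact: (fc tt). Qed.

Lemma tame_cst k : tame (fun=> k).
Proof. by split; [move=> *; exact: measurable_cst|exact: growth_cst]. Qed.

Lemma tame_coord i : tame (fun y => y i).
Proof. by split; [move=> d T y my; exact: my|exact: growth_coord]. Qed.

Lemma tameD f h : tame f -> tame h -> tame (fun y => f y + h y).
Proof.
move=> [mf ff] [mh hh]; split; last exact: growthD.
by move=> d T y my; apply: measurable_funD; [exact: mf|exact: mh].
Qed.

Lemma tameM f h : tame f -> tame h -> tame (fun y => f y * h y).
Proof.
move=> [mf ff] [mh hh]; split; last exact: growthM.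
by move=> d T y my; apply: measurable_funM; [exact: mf|exact: mh].
Qed.

Lemma tameN f : tame f -> tame (fun y => - f y).
Proof.
by move=> tf; under eq_fun do rewrite -mulN1r; apply: tameM => //; exact: tame_cst.
Qed.

Lemma tameB f h : tame f -> tame h -> tame (fun y => f y - h y).
Proof. by move=> tf th; apply: tameD => //; exact: tameN. Qed.

Lemma tame_sum (J : Type) (r : seq J) (f : J -> (I -> R) -> R) :
  (forall j, tame (f j)) -> tame (fun y => \sum_(j <- r) f j y).
Proof.
move=> ff; elim: r => [|j r ih].
  by under eq_fun do rewrite big_nil; exact: tame_cst.
by under eq_fun do rewrite big_cons; exact: tameD.
Qed.

End Growth.

Section GaussianExpectation.
Context {R : realType} {I : finType} d (G : measurableType d)
  (gam : probability G R) (g : G -> I -> R).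
Hypothesis gv : gaussian_vector gam g.
Implicit Types (f : (I -> R) -> R) (b : I -> R).

Let mg i : measurable_fun setT (g^~ i). Proof. by case: gv. Qed.

Lemma gaussian_exp_integrable b :
  gam.-integrable setT (EFin \o (fun w => expR (dot b (g w)))).
Proof.
have [_ /(_ b)[tau [_ _ CM]]] := gv.
pose r w := expR (\sum_i b i * g w i - 2^-1 * \sum_i b i ^+ 2).
have mr : measurable_fun setT r.
  apply: measurableT_comp => //; apply: measurable_funB => //.
  by apply: measurable_sum => i; exact: measurable_funM.
have ir : gam.-integrable setT (EFin \o r).
  apply/integrableP; split; first exact/measurable_EFinP.
  have := CM (cst 1%E) (measurable_cst _) (fun _ => @lee01 R).
  rewrite integral_cst//= mul1e [X in X = _ -> _]probability_setT => H.
  rewrite (eq_integral (fun w => 1 * (r w)%:E)%E) -?H ?ltry//.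
  by move=> w _; rewrite mul1e /= ger0_norm// expR_ge0.
have := integrableZl measurableT (expR (2^-1 * \sum_i b i ^+ 2)) ir.
apply: eq_integrable => // w _ /=; rewrite -EFinM -expRD; congr (expR _)%:E.
by rewrite /dot; ring.
Qed.

Lemma size1_exp_integrable c :
  gam.-integrable setT (EFin \o (fun w => expR (c * size1 (g w)))).
Proof.
pose b (s : {ffun I -> bool}) i : R := (-1) ^+ (s i) * `|c|.
have mS : measurable_fun setT (fun w => expR (c * size1 (g w))).
  apply: measurableT_comp => //; apply: measurable_funM => //.
  apply: measurable_funD => //; apply: measurable_sum => i.
  exact: measurableT_comp.
apply: (@le_integrable _ _ _ gam setT _ _
  (EFin \o (fun w => expR `|c| * \sum_s expR (dot (b s) (g w))))) => //.
- exact/measurable_EFinP.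
- move=> w _ /=; rewrite lee_fin ger0_norm ?expR_ge0//.
  rewrite ger0_norm; last first.
    by rewrite mulr_ge0 ?expR_ge0// sumr_ge0// => s _; exact: expR_ge0.
  apply: (@le_trans _ _ (expR (`|c| * size1 (g w)))).
    by rewrite ler_expR ler_wpM2r ?size1_ge0 ?ler_norm.
  rewrite /size1 mulrDr mulr1 expRD ler_wpM2l ?expR_ge0//.
  pose s := [ffun i => g w i < 0].
  rewrite (bigD1 s)//= -[leLHS]addr0 lerD//; last first.
    by apply: sumr_ge0 => t _; exact: expR_ge0.
  rewrite ler_expR mulr_sumr; apply: ler_sum => i _.
  rewrite /b ffunE; case: ltP => h; last by rewrite expr0 mul1r (ger0_norm h).
  by rewrite expr1 (ltr0_norm h) mulN1r mulrN mulNr.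
- have iS : gam.-integrable setT
      (fun w => \sum_s (expR (dot (b s) (g w)))%:E)%E.
    by apply: integrable_sum => // s _; exact: gaussian_exp_integrable.
  have := integrableZl measurableT (expR `|c|) iS.
  by apply: eq_integrable => // w _; rewrite sumEFin -EFinM.
Qed.

Definition expect f : R := \int[gam]_w f (g w).

Lemma tame_integrable f : tame f -> gam.-integrable setT (EFin \o (f \o g)).
Proof.
move=> [mf [c c0 fc]]; apply: le_integrable (size1_exp_integrable c) => //.
- by apply/measurable_EFinP; exact: mf.
- move=> w _ /=; rewrite lee_fin [leRHS]ger0_norm ?expR_ge0//.
  exact: (fc tt).
Qed.

Lemma expectD f h : tame f -> tame h ->
  expect (fun y => f y + h y) = expect f + expect h.
Proof. by move=> /tame_integrable tf /tame_integrable th; exact: RintegralD. Qed.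

Lemma expectB f h : tame f -> tame h ->
  expect (fun y => f y - h y) = expect f - expect h.
Proof. by move=> /tame_integrable tf /tame_integrable th; exact: RintegralB. Qed.

Lemma expectZ k f : tame f -> expect (fun y => k * f y) = k * expect f.
Proof. by move=> /tame_integrable tf; exact: RintegralZl. Qed.

Lemma expect_sum (J : Type) (r : seq J) (f : J -> (I -> R) -> R) :
  (forall j, tame (f j)) ->
  expect (fun y => \sum_(j <- r) f j y) = \sum_(j <- r) expect (f j).
Proof.
move=> tf; elim: r => [|j r ih].
  rewrite big_nil /expect; under eq_Rintegral do rewrite big_nil.
  by rewrite Rintegral_cst// mul0r.
rewrite big_cons -ih -expectD//; last exact: tame_sum.
by apply: eq_Rintegral => w _; rewrite big_cons.
Qed.

Lemma expect_le f h : tame f -> tame h -> (forall y, f y <= h y) ->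
  expect f <= expect h.
Proof.
by move=> /tame_integrable tf /tame_integrable th fh; apply: le_Rintegral.
Qed.

Lemma eq_expect f h : f =1 h -> expect f = expect h.
Proof. by move=> fh; apply: eq_Rintegral => w _; rewrite fh. Qed.

Lemma gaussian_shift f b : tame f ->
  expect (fun y => f (fun i => y i + b i)) =
  expect (fun y => f y * expR (dot b y - 2^-1 * dot b b)).
Proof.
move=> [mf _]; have [_ /(_ b)[tau [mtau gtau CM]]] := gv.
pose r w := expR (\sum_i b i * g w i - 2^-1 * \sum_i b i ^+ 2).
rewrite /expect /Rintegral; congr fine.
transitivity (\int[gam]_w (f (g (tau w)))%:E)%E.
  by apply: eq_integral => w _ /=; congr (f _)%:E; apply/funext => i; rewrite gtau.
transitivity (\int[gam]_w ((f (g w) * r w)%:E))%E; last first.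
  apply: eq_integral => w _; congr (_ * expR (_ - _ * _))%:E.
have mfg : measurable_fun setT (f \o g) by exact: mf.
have r0 w : 0 <= r w by exact: expR_ge0.
have part (h : G -> R) : measurable_fun setT h -> (forall w, 0 <= h w) ->
    (\int[gam]_w (h (tau w))%:E = \int[gam]_w (h w * r w)%:E)%E.
  move=> mh h0; rewrite (CM (EFin \o h))//.
  exact/measurable_EFinP.
rewrite [LHS]integralE [RHS]integralE; congr (_ - _)%E.
- transitivity (\int[gam]_w (Num.max (f (g (tau w))) 0)%:E)%E.
    by apply: eq_integral => w _; rewrite !funeposE EFin_max.
  rewrite (part (fun w => Num.max (f (g w)) 0)).
  + apply: eq_integral => w _; rewrite !funeposE -EFin_max; congr _%:E.
    by rewrite maxr_pMl// mul0r.
  + exact: measurable_maxr.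
  + by move=> w; rewrite le_max lexx orbT.
- transitivity (\int[gam]_w (Num.max (- f (g (tau w))) 0)%:E)%E.
    by apply: eq_integral => w _; rewrite !funenegE EFin_max.
  rewrite (part (fun w => Num.max (- f (g w)) 0)).
  + apply: eq_integral => w _; rewrite !funenegE -EFin_max; congr _%:E.
    by rewrite maxr_pMl// mul0r mulNr.
  + by apply: measurable_maxr => //; exact: measurableT_comp.
  + by move=> w; rewrite le_max lexx orbT.
Qed.

Lemma expect_is_derive (F F' : R -> (I -> R) -> R) (a r : R) :
  0 < r ->
  (forall s, `|s - a| < r -> vector_measurable (F s)) ->
  growth [set s | `|s - a| < r] F -> growth [set s | `|s - a| < r] F' ->
  (forall s y, `|s - a| < r -> is_derive s 1 (F^~ y) (F' s y)) ->
  is_derive a 1 (fun s => expect (F s)) (expect (F' a)).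
Proof.
move=> r0 mF [c c0 Fc] [e e0 Fe] dF.
apply: (@Rintegral_is_derive _ _ _ gam (fun s w => F s (g w))
  (fun s w => F' s (g w)) (fun w => expR (e * size1 (g w))) _ r) => //.
- move=> s sr; apply: tame_integrable; split; first exact: mF.
  by exists c => // _ _ y; exact: Fc.
- exact: size1_exp_integrable.
- by move=> s w sr; exact: Fe.
Qed.

Definition perturb y (i : I) (c : R) : I -> R := fun j => y j + c * (j == i)%:R.

Lemma perturb0 y i : perturb y i 0 = y.
Proof. by apply/funext => j; rewrite /perturb mul0r addr0. Qed.

Lemma perturbD y i c e : perturb (perturb y i c) i e = perturb y i (c + e).
Proof. by apply/funext => j; rewrite /perturb mulrDl addrA. Qed.

Lemma size1_perturb y i c : `|c| <= 1 -> size1 (perturb y i c) <= 2 * size1 y.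
Proof.
move=> c1; apply: (@le_trans _ _ (size1 y + 1)); last first.
  by have := size1_ge1 y; lra.
rewrite /size1 -addrA lerD2l; apply: (@le_trans _ _
    (\sum_j (`|y j| + (j == i)%:R))).
  apply: ler_sum => j _; apply: le_trans (ler_normD _ _) _; rewrite lerD2l.
  by case: (j == i); rewrite ?mulr1// mulr0 normr0.
rewrite big_split/= lerD2l (bigD1 i)//= eqxx big1 ?addr0// => j /negbTE ->.
by [].
Qed.

(** Both sides of the translation formula are differentiable in the
    translation; the integration by parts formula is the equality of the
    derivatives at the origin. *)
Lemma gaussian_ibp f f' i : tame f -> tame f' ->
  (forall y, is_derive (0 : R) 1 (fun c => f (perturb y i c)) (f' y)) ->
  expect (fun y => y i * f y) = expect f'.
Proof.
move=> tf tf' df.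
have [mf gf] := tf; have [mf' [c c0 fc]] := tf'.
have dfc (s : R) y : is_derive s 1 (fun c : R => f (perturb y i c)) (f' (perturb y i s)).
  apply: (@der_shift _ _ s) => //.
  by under eq_fun do rewrite -perturbD; exact: df.
have mbump h s : vector_measurable h -> vector_measurable (fun y => h (perturb y i s)).
  move=> mh d' T y my; apply: (mh _ _ (fun t => perturb (y t) i s)) => j.
  by apply: measurable_funD.
have gbump h : tame h -> growth [set s | `|s - 0| < 1] (fun s y => h (perturb y i s)).
  move=> [_ [e e0 he]]; exists (e * 2); first by rewrite mulr_ge0.
  move=> s /=; rewrite subr0 => s1 y; apply: le_trans (he tt Logic.I _) _.
  by rewrite ler_expR -mulrA ler_wpM2l// size1_perturb// ltW.
have D1 : is_derive (0 : R) 1 (fun s => expect (fun y => f (perturb y i s)))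
    (expect (fun y => f' (perturb y i 0))).
  apply: (@expect_is_derive _ (fun s y => f' (perturb y i s)) _ 1) => //.
  - by move=> s _; exact: mbump.
  - exact: gbump.
  - exact: gbump.
have D2 : is_derive (0 : R) 1 (fun s => expect (fun y => f y * expR (s * y i - 2^-1 * s ^+ 2)))
    (expect (fun y => f y * ((y i - 0) * expR (0 * y i - 2^-1 * 0 ^+ 2)))).
  have gexp : growth [set s : R | `|s - 0| < 1]
      (fun s y => expR (s * y i - 2^-1 * s ^+ 2)).
    exists 1 => // s /=; rewrite subr0 => s1 y.
    rewrite ger0_norm ?expR_ge0// ler_expR mul1r.
    apply: le_trans (normr_le_size1 y i).
    apply: (@le_trans _ _ (s * y i)); first by rewrite gerBl mulr_ge0// sqr_ge0.
    apply: le_trans (ler_norm _) _; rewrite normrM ler_piMl// ltW//.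
  apply: (@expect_is_derive _ (fun s y => f y * ((y i - s) * expR (s * y i - 2^-1 * s ^+ 2))) _ 1) => //.
  - move=> s _ d' T y my; apply: measurable_funM; first exact: mf.
    apply: measurableT_comp => //; apply: measurable_funB => //.
    exact: measurable_funM.
  - apply: growthM => //; exact: tame_growth.
  - apply: growthM; first exact: tame_growth.
    apply: growthM => //; apply: growthB; first exact: growth_coord.
    exists 1 => // s /=; rewrite subr0 => s1 y; rewrite mul1r.
    apply: le_trans (ltW s1) _; apply: le_trans (size1_ge1 y) _.
    by apply: le_trans (expR_ge1Dx _); rewrite lerDr.
  - move=> s y _; apply: derZ.
    apply: der_eq (der_expR (derB (derM (der_id s) (der_cst (y i) s))
      (derZ 2^-1 (derM (der_id s) (der_id s))))) _.
    by rewrite -expr2; field.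
have E s : expect (fun y => f (perturb y i s)) =
    expect (fun y => f y * expR (s * y i - 2^-1 * s ^+ 2)).
  rewrite (gaussian_shift (fun j => s * (j == i)%:R) tf).
  have dotE y : dot (fun j => s * (j == i)%:R) y = s * y i.
    rewrite /dot (bigD1 i)//= eqxx mulr1 big1 ?addr0// => j /negbTE ->.
    by rewrite mulr0 mul0r.
  by apply: eq_expect => y; rewrite !dotE eqxx mulr1 expr2.
rewrite (funext E) in D1.
have := etrans (esym (@derive_val _ _ _ _ _ _ _ D1)) (@derive_val _ _ _ _ _ _ _ D2).
under eq_expect do rewrite perturb0.
move=> ->; apply: eq_expect => y.
by rewrite expr0n/= mulr0 mul0r !subr0 expR0 mulr1 mulrC.
Qed.

End GaussianExpectation.

(** * Gibbs averages *)

Section Bounded.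
Context {R : realType} {dX} {X : measurableType dX} (prior : probability X R).
Implicit Types (al be : X -> R).

Definition obs al : Prop :=
  measurable_fun setT al /\ exists L, forall x, `|al x| <= L.

Lemma obs_cst k : obs (fun=> k).
Proof. by split; [exact: measurable_cst|exists `|k|]. Qed.

Lemma obsD al be : obs al -> obs be -> obs (fun x => al x + be x).
Proof.
move=> [mal [L aL]] [mbe [L' bL]]; split; first exact: measurable_funD.
by exists (L + L') => x; apply: le_trans (ler_normD _ _) _; exact: lerD.
Qed.

Lemma obsM al be : obs al -> obs be -> obs (fun x => al x * be x).
Proof.
move=> [mal [L aL]] [mbe [L' bL]]; split; first exact: measurable_funM.
by exists (L * L') => x; rewrite normrM ler_pM.
Qed.

Lemma obsZ k al : obs al -> obs (fun x => k * al x).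
Proof. by apply: obsM; exact: obs_cst. Qed.

Lemma obsN al : obs al -> obs (fun x => - al x).
Proof. by under eq_fun do rewrite -mulN1r; exact: obsZ. Qed.

Lemma obsB al be : obs al -> obs be -> obs (fun x => al x - be x).
Proof. by move=> oa ob; apply: obsD => //; exact: obsN. Qed.

Lemma obs_sum (J : Type) (r : seq J) (al : J -> X -> R) :
  (forall j, obs (al j)) -> obs (fun x => \sum_(j <- r) al j x).
Proof.
move=> oa; elim: r => [|j r ih].
  by under eq_fun do rewrite big_nil; exact: obs_cst.
by under eq_fun do rewrite big_cons; exact: obsD.
Qed.

Lemma obs_integrable al : obs al -> prior.-integrable setT (EFin \o al).
Proof.
move=> [mal [L aL]]; apply: (@le_integrable _ _ _ prior setT _ _ (cst `|L|%:E)) => //.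
- exact/measurable_EFinP.
- move=> x _ /=; rewrite lee_fin normr_id; apply: le_trans (aL x) (ler_norm _).
- exact: finite_measure_integrable_cst.
Qed.

End Bounded.

Section Gibbs.
Context {R : realType} {I : finType} {dX} {X : measurableType dX}
  (prior : probability X R).
Implicit Types (al be : X -> R) (phi psi : X -> I -> R) (y : I -> R).

(** The density of the observation [phi x + noise] with respect to pure noise. *)
Definition dens phi y x : R := expR (dot (phi x) y - 2^-1 * dot (phi x) (phi x)).

Definition moment phi al y : R := \int[prior]_x (al x * dens phi y x).

Definition partition_function phi y : R := moment phi (fun=> 1) y.

Definition gibbs phi al y : R := moment phi al y / partition_function phi y.

Definition obs_features phi := forall i, obs (fun x => phi x i).

Lemma obs_dot phi psi : obs_features phi -> obs_features psi ->
  obs (fun x => dot (phi x) (psi x)).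
Proof. by move=> op oq; apply: obs_sum => i; exact: obsM. Qed.

Lemma dot_le (L : R) (a y : I -> R) : 0 <= L -> (forall i, `|a i| <= L) ->
  `|dot a y| <= L * size1 y.
Proof.
move=> L0 aL.
apply: le_trans (ler_norm_sum _ _ _) _; rewrite /size1 mulrDr mulr1.
apply: (@le_trans _ _ (L * \sum_i `|y i|)); last by rewrite lerDr.
by rewrite mulr_sumr; apply: ler_sum => i _; rewrite normrM ler_wpM2r.
Qed.

Lemma features_bound phi : obs_features phi ->
  exists2 L, 0 <= L & forall x i, `|phi x i| <= L.
Proof.
move=> op; have /choice[L HL] : forall i, exists L, forall x, `|phi x i| <= L.
  by move=> i; case: (op i).
exists (\sum_i `|L i|); first exact: sumr_ge0.
move=> x i; apply: le_trans (HL i x) _; apply: le_trans (ler_norm _) _.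
by rewrite (bigD1 i)//= lerDl sumr_ge0.
Qed.

Lemma dens_le phi (L : R) : 0 <= L -> (forall x i, `|phi x i| <= L) ->
  forall x y, dens phi y x <= expR (L * size1 y).
Proof.
move=> L0 pL x y; rewrite ler_expR.
apply: (@le_trans _ _ (dot (phi x) y)).
  by rewrite gerBl mulr_ge0// sumr_ge0// => i _; rewrite -expr2 sqr_ge0.
by apply: le_trans (ler_norm _) _; apply: dot_le.
Qed.

Lemma dens_ge phi (L : R) : 0 <= L -> (forall x i, `|phi x i| <= L) ->
  forall x y, expR (- ((L + L ^+ 2 * #|I|%:R) * size1 y)) <= dens phi y x.
Proof.
move=> L0 pL x y; rewrite ler_expR.
have := dot_le y L0 (pL x); rewrite ler_norml => /andP[d1 _].
have d2 : dot (phi x) (phi x) <= L ^+ 2 * #|I|%:R * size1 y.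
  apply: (@le_trans _ _ (L ^+ 2 * #|I|%:R)); last first.
    by rewrite ler_peMr ?size1_ge1// mulr_ge0// sqr_ge0.
  apply: (@le_trans _ _ (\sum_(i : I) L ^+ 2)); last first.
    by rewrite sumr_const mulr_natr.
  apply: ler_sum => i _; rewrite -expr2 -[leLHS]real_normK ?num_real//.
  by rewrite lerXn2r ?nnegrE.
have := size1_ge1 y; rewrite mulrDl.
have : 0 <= L ^+ 2 * #|I|%:R by rewrite mulr_ge0// sqr_ge0.
have : 0 <= dot (phi x) (phi x).
  by rewrite sumr_ge0// => i _; rewrite -expr2 sqr_ge0.
lra.
Qed.

Lemma measurable_dens phi y : obs_features phi -> measurable_fun setT (dens phi y).
Proof.
move=> op; apply: measurableT_comp => //; apply: measurable_funB.
  by apply: measurable_sum => i; apply: measurable_funM => //; case: (op i).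
by apply: measurable_funM => //; case: (obs_dot op op).
Qed.

Lemma obs_dens phi y : obs_features phi -> obs (dens phi y).
Proof.
move=> op; split; first exact: measurable_dens.
have [L L0 pL] := features_bound op; exists (expR (L * size1 y)) => x.
by rewrite ger0_norm ?expR_ge0//; exact: dens_le.
Qed.

Lemma moment_integrable phi al y : obs_features phi -> obs al ->
  prior.-integrable setT (EFin \o (fun x => al x * dens phi y x)).
Proof.
by move=> op oa; apply: obs_integrable; apply: obsM => //; exact: obs_dens.
Qed.

Section FixedFeatures.
Variable phi : X -> I -> R.
Hypothesis op : obs_features phi.

Lemma momentD al be y : obs al -> obs be ->
  moment phi (fun x => al x + be x) y = moment phi al y + moment phi be y.
Proof.
move=> oa ob; rewrite -RintegralD//; [|exact: moment_integrable..].
by apply: eq_Rintegral => x _; rewrite mulrDl.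
Qed.

Lemma momentZ k al y : obs al ->
  moment phi (fun x => k * al x) y = k * moment phi al y.
Proof.
move=> oa; rewrite -RintegralZl//; last exact: moment_integrable.
by apply: eq_Rintegral => x _; rewrite mulrA.
Qed.

Lemma le_moment al be y : obs al -> obs be -> (forall x, al x <= be x) ->
  moment phi al y <= moment phi be y.
Proof.
move=> oa ob ab; apply: le_Rintegral => //; [exact: moment_integrable..|].
by move=> x _; rewrite ler_wpM2r ?expR_ge0.
Qed.

(** A lower bound of inverse exponential growth is what [Z^-1] and [ln Z] need in
    order to be tame. *)
Lemma partition_function_ge (L : R) : 0 <= L -> (forall x i, `|phi x i| <= L) ->
  forall y, expR (- ((L + L ^+ 2 * #|I|%:R) * size1 y)) <= partition_function phi y.
Proof.
move=> L0 pL y.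
have -> : expR (- ((L + L ^+ 2 * #|I|%:R) * size1 y)) =
    \int[prior]_x (expR (- ((L + L ^+ 2 * #|I|%:R) * size1 y))).
  rewrite Rintegral_cst//= [X in _ * fine X]probability_setT /= mulr1//.
apply: le_Rintegral => //.
- by apply: obs_integrable; exact: obs_cst.
- exact/moment_integrable/obs_cst.
- by move=> x _; rewrite mul1r; exact: dens_ge.
Qed.

Lemma partition_function_gt0 y : 0 < partition_function phi y.
Proof.
have [L L0 pL] := features_bound op.
by apply: lt_le_trans (partition_function_ge L0 pL y); exact: expR_gt0.
Qed.

Lemma partition_function_neq0 y : partition_function phi y != 0.
Proof. exact/lt0r_neq0/partition_function_gt0. Qed.

Lemma gibbsD al be y : obs al -> obs be ->
  gibbs phi (fun x => al x + be x) y = gibbs phi al y + gibbs phi be y.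
Proof. by move=> oa ob; rewrite /gibbs momentD// mulrDl. Qed.

Lemma gibbsZ k al y : obs al -> gibbs phi (fun x => k * al x) y = k * gibbs phi al y.
Proof. by move=> oa; rewrite /gibbs momentZ// mulrA. Qed.

Lemma gibbs_cst k y : gibbs phi (fun=> k) y = k.
Proof.
rewrite -[X in gibbs phi X](_ : (fun=> k * 1) = _); last first.
  by apply/funext => x; rewrite mulr1.
rewrite (gibbsZ k (al := fun=> 1)); last exact: obs_cst.
by rewrite /gibbs divff ?mulr1// partition_function_neq0.
Qed.

Lemma gibbsN al y : obs al -> gibbs phi (fun x => - al x) y = - gibbs phi al y.
Proof.
move=> oa; rewrite -mulN1r -gibbsZ//; congr (gibbs phi _ y).
by apply/funext => x; rewrite mulN1r.
Qed.

Lemma gibbsB al be y : obs al -> obs be ->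
  gibbs phi (fun x => al x - be x) y = gibbs phi al y - gibbs phi be y.
Proof. by move=> oa ob; rewrite gibbsD// ?gibbsN//; exact: obsN. Qed.

Lemma gibbs_sum (J : Type) (r : seq J) (al : J -> X -> R) y :
  (forall j, obs (al j)) ->
  gibbs phi (fun x => \sum_(j <- r) al j x) y = \sum_(j <- r) gibbs phi (al j) y.
Proof.
move=> oa; elim: r => [|j r ih].
  rewrite big_nil -[RHS](gibbs_cst 0 y); congr (gibbs phi _ y).
  by apply/funext => x; rewrite big_nil.
rewrite big_cons -ih -gibbsD//; last exact: obs_sum.
by congr (gibbs phi _ y); apply/funext => x; rewrite big_cons.
Qed.

Lemma le_gibbs al be y : obs al -> obs be -> (forall x, al x <= be x) ->
  gibbs phi al y <= gibbs phi be y.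
Proof.
by move=> oa ob ab; rewrite ler_pM2r ?invr_gt0 ?partition_function_gt0// le_moment.
Qed.

Lemma gibbs_ge0 al y : obs al -> (forall x, 0 <= al x) -> 0 <= gibbs phi al y.
Proof.
by move=> oa a0; rewrite -(gibbs_cst 0 y); apply: le_gibbs => //; exact: obs_cst.
Qed.

Lemma gibbs_abs_le al y (L : R) : obs al -> (forall x, `|al x| <= L) ->
  `|gibbs phi al y| <= L.
Proof.
move=> oa aL; rewrite ler_norml; apply/andP; split.
  rewrite -[leLHS](gibbs_cst (- L) y); apply: le_gibbs => //; first exact: obs_cst.
  by move=> x; have := aL x; rewrite ler_norml => /andP[].
rewrite -[leRHS](gibbs_cst L y); apply: le_gibbs => //; first exact: obs_cst.
by move=> x; have := aL x; rewrite ler_norml => /andP[].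
Qed.

Lemma gibbs_sqr_le al y : obs al -> gibbs phi al y ^+ 2 <= gibbs phi (fun x => al x ^+ 2) y.
Proof.
move=> oa; set m := gibbs phi al y.
have o2 : obs (fun x => al x ^+ 2).
  by under eq_fun do rewrite expr2; exact: obsM.
have := @gibbs_ge0 (fun x => al x ^+ 2 - (2 * m) * al x + m ^+ 2) y.
rewrite gibbsD; [|apply: obsB => //; exact: obsZ|exact: obs_cst].
rewrite gibbsB//; last exact: obsZ.
rewrite gibbsZ// gibbs_cst -/m => H.
suff : 0 <= gibbs phi (fun x => al x ^+ 2) y - 2 * m * m + m ^+ 2 by lra.
apply: H; last by move=> x; have := sqr_ge0 (al x - m); lra.
apply: obsD; last exact: obs_cst.
by apply: obsB => //; exact: obsZ.
Qed.

End FixedFeatures.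

End Gibbs.

Section GibbsGrowth.
Context {R : realType} {I : finType} {dX} {X : measurableType dX}
  (prior : probability X R).
Implicit Types (al be : X -> R) (phi psi : X -> I -> R) (y : I -> R).

Lemma growth_expR S (D : set S) (c : R) : 0 <= c ->
  growth D (fun _ y => expR (c * @size1 R I y)).
Proof. by move=> c0; exists c => // s _ y; rewrite ger0_norm ?expR_ge0. Qed.

Lemma moment_le phi al y (L L' : R) : obs_features phi -> obs al ->
  0 <= L -> (forall x i, `|phi x i| <= L) -> (forall x, `|al x| <= L') ->
  `|moment prior phi al y| <= L' * expR (L * size1 y).
Proof.
move=> op oa L0 pL aL.
apply: le_trans (le_normr_Rintegral _ _) _ => //; first exact: moment_integrable.
have -> : L' * expR (L * size1 y) = \int[prior]_x (cst (L' * expR (L * size1 y)) x).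
  by rewrite Rintegral_cst//= [X in _ * fine X]probability_setT /= mulr1.
apply: le_Rintegral => //.
- rewrite (_ : _ \o _ = EFin \o (fun x => `|al x * dens phi y x|))//.
  apply: obs_integrable; have [mo [B oB]] := obsM oa (obs_dens y op).
  split; first exact: measurableT_comp.
  by exists B => x; rewrite normr_id.
- by apply: obs_integrable; exact: obs_cst.
- move=> x _; rewrite normrM ler_pM//.
  by rewrite ger0_norm ?expR_ge0//; exact: dens_le.
Qed.

Section Family.
Context {S : Type} (D : set S) (phi : S -> X -> I -> R) (L : R).
Hypothesis op : forall s, D s -> obs_features (phi s).
Hypothesis L0 : 0 <= L.
Hypothesis pL : forall s, D s -> forall x i, `|phi s x i| <= L.

Lemma growth_moment (al : S -> X -> R) (L' : R) : 0 <= L' ->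
  (forall s, D s -> obs (al s)) -> (forall s, D s -> forall x, `|al s x| <= L') ->
  growth D (fun s => moment prior (phi s) (al s)).
Proof.
move=> L'0 oa aL; apply: (@growth_le _ _ _ _ _ (fun _ y => L' * expR (L * size1 y))).
  move=> s Ds y; rewrite [leRHS]ger0_norm; last by rewrite mulr_ge0 ?expR_ge0.
  by apply: moment_le => //; [exact: op|exact: oa|exact: pL|exact: aL].
by apply: growthM; [exact: growth_cst|exact: growth_expR].
Qed.

Lemma growth_partition_inv : growth D (fun s y => (partition_function prior (phi s) y)^-1).
Proof.
exists (L + L ^+ 2 * #|I|%:R); first by rewrite addr_ge0// mulr_ge0// sqr_ge0.
move=> s Ds y; have Zp := partition_function_gt0 prior (op Ds) y.
rewrite ger0_norm; last by rewrite invr_ge0 ltW.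
rewrite -[leRHS]invrK lef_pV2 ?posrE ?invr_gt0 ?expR_gt0//.
rewrite -expRN; apply: partition_function_ge => //; [exact: op|exact: pL].
Qed.

(** The bounds on [Z] from above and from below are both exponentials, so that its
    logarithm grows linearly. *)
Lemma growth_ln_partition : growth D (fun s y => ln (partition_function prior (phi s) y)).
Proof.
pose c := L + L ^+ 2 * #|I|%:R.
have c0 : 0 <= c by rewrite addr_ge0// mulr_ge0// sqr_ge0.
exists c => // s Ds y; have Zp := partition_function_gt0 prior (op Ds) y.
apply: (@le_trans _ _ (c * size1 y)); last first.
  by apply: le_trans (expR_ge1Dx _); rewrite lerDr.
rewrite ler_norml; apply/andP; split.
  rewrite -(expRK (- _)) ler_ln ?posrE ?expR_gt0//.
  by apply: partition_function_ge => //; [exact: op|exact: pL].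
rewrite -(expRK (c * _)) ler_ln ?posrE ?expR_gt0//.
apply: le_trans (ler_norm _) _.
have H : `|partition_function prior (phi s) y| <= 1 * expR (L * size1 y).
  by apply: moment_le => //; [exact: op|exact: obs_cst|exact: pL|move=> x; rewrite normr1].
apply: le_trans H _; rewrite mul1r ler_expR ler_wpM2r ?size1_ge0// lerDl.
by rewrite mulr_ge0// sqr_ge0.
Qed.

End Family.

Lemma vector_measurable_moment phi al : obs_features phi -> obs al ->
  vector_measurable (moment prior phi al).
Proof.
move=> op oa d T y my.
pose F (p : T * X) : R := al p.2 * dens phi (y p.1) p.2.
have mF : measurable_fun setT F.
  have [mal _] := oa.
  have mphi i : measurable_fun [set: T * X] (fun p => phi p.2 i).
    by case: (op i) => m _; exact: (measurableT_comp m measurable_snd).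
  have my2 i : measurable_fun [set: T * X] (fun p => y p.1 i).
    exact: (measurableT_comp (my i) measurable_fst).
  apply: measurable_funM; first exact: (measurableT_comp mal measurable_snd).
  apply: measurableT_comp => //; apply: measurable_funB.
    by apply: measurable_sum => i; exact: measurable_funM.
  apply: measurable_funM => //.
  by apply: measurable_sum => i; exact: measurable_funM.
have mEF : measurable_fun setT (EFin \o F) by exact/measurable_EFinP.
rewrite /comp /moment /Rintegral.
apply: (measurableT_comp (f := @fine R)); first exact: fine_measurable.
under eq_fun do rewrite integralE.
apply: emeasurable_funB.
- rewrite [X in measurable_fun _ X](_ : _ = fubini_F prior (funepos (EFin \o F))).
    apply: measurable_fun_fubini_tonelli_F; first exact: measurable_funepos.
    by move=> p; exact: funepos_ge0.
  by apply/funext => t; apply: eq_integral => x _; rewrite !funeposE.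
- rewrite [X in measurable_fun _ X](_ : _ = fubini_F prior (funeneg (EFin \o F))).
    apply: measurable_fun_fubini_tonelli_F; first exact: measurable_funeneg.
    by move=> p; exact: funeneg_ge0.
  by apply/funext => t; apply: eq_integral => x _; rewrite !funenegE.
Qed.

Section TameGibbs.
Variable phi : X -> I -> R.
Hypothesis op : obs_features phi.

Lemma tame_moment al : obs al -> tame (moment prior phi al).
Proof.
move=> oa; split; first exact: vector_measurable_moment.
have [L L0 pL] := features_bound op; have [_ [L' aL]] := oa.
exact: (@growth_moment _ _ (fun _ : unit => phi) L (fun _ _ => op) L0
  (fun _ _ => pL) (fun _ => al) `|L'| (normr_ge0 _) (fun _ _ => oa)
  (fun _ _ x => le_trans (aL x) (ler_norm _))).
Qed.

Lemma tame_partition : tame (partition_function prior phi).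
Proof. exact: (tame_moment (obs_cst 1)). Qed.

Lemma tame_partition_inv : tame (fun y => (partition_function prior phi y)^-1).
Proof.
split.
  move=> d T y my.
  rewrite (_ : _ \o _ = (fun t => expR (- ln (partition_function prior phi (y t))))).
    apply: measurableT_comp => //; apply: measurableT_comp => //.
    apply: (measurableT_comp (f := @ln R)); first exact: measurable_ln.
    exact: (vector_measurable_moment op (obs_cst _)).
  by apply/funext => t /=; rewrite expRN lnK// posrE partition_function_gt0.
have [L L0 pL] := features_bound op.
exact: (@growth_partition_inv _ _ (fun _ : unit => phi) L (fun _ _ => op) L0
  (fun _ _ => pL)).
Qed.

Lemma tame_ln_partition : tame (fun y => ln (partition_function prior phi y)).
Proof.
split.
  move=> d T y my; apply: (measurableT_comp (f := @ln R)).
    exact: measurable_ln.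
  exact: (vector_measurable_moment op (obs_cst _)).
have [L L0 pL] := features_bound op.
exact: (@growth_ln_partition _ _ (fun _ : unit => phi) L (fun _ _ => op) L0
  (fun _ _ => pL)).
Qed.

Lemma tame_gibbs al : obs al -> tame (gibbs prior phi al).
Proof. by move=> oa; apply: tameM; [exact: tame_moment|exact: tame_partition_inv]. Qed.

End TameGibbs.

End GibbsGrowth.

(** * The heat equation along a path of features *)

Section FeaturePath.
Context {R : realType} {I : finType} {dX} {X : measurableType dX}
  (prior : probability X R).
Implicit Types (al be : X -> R) (phi psi : R -> X -> I -> R) (y : I -> R).

(** The bounds are uniform in the parameter and in the point, which is what
    differentiation under the integral needs. *)
Record feature_path phi phi' (a r L : R) : Prop := FeaturePath {
  path_radius : 0 < r;
  path_bound_ge0 : 0 <= L;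
  path_obs : forall s, `|s - a| < r -> obs_features (phi s);
  path_obs' : forall s, `|s - a| < r -> obs_features (phi' s);
  path_bound : forall s, `|s - a| < r -> forall x i, `|phi s x i| <= L;
  path_bound' : forall s, `|s - a| < r -> forall x i, `|phi' s x i| <= L;
  path_derive : forall s, `|s - a| < r -> forall x i,
    is_derive s 1 (fun t => phi t x i) (phi' s x i) }.

Lemma path_recenter phi phi' a r L b : feature_path phi phi' a r L ->
  `|b - a| < r -> feature_path phi phi' b (r - `|b - a|) L.
Proof.
move=> [r0 L0 o o' l l' d] ba.
have H s : `|s - b| < r - `|b - a| -> `|s - a| < r.
  move=> sb; have -> : s - a = (s - b) + (b - a) by ring.
  by apply: le_lt_trans (ler_normD _ _) _; rewrite -ltrBrDr.
by split=> //; first (by rewrite subr_gt0); move=> s /H; auto.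
Qed.

Lemma path_center phi phi' a r L : feature_path phi phi' a r L -> `|a - a| < r.
Proof. by case=> r0 *; rewrite subrr normr0. Qed.

Lemma size1_le (y : I -> R) (B : R) : (forall i, `|y i| <= B) ->
  size1 y <= 1 + B * #|I|%:R.
Proof.
move=> yB; rewrite /size1 lerD2l; apply: (@le_trans _ _ (\sum_(i : I) B)).
  by apply: ler_sum.
by rewrite sumr_const mulr_natr.
Qed.

(** Both the features and the vector may move: the partial derivatives that the
    heat equation needs and the derivative of the free energy of a fixed sample,
    whose observation depends on the features, are special cases. *)
Lemma moment_is_derive phi phi' (z z' : R -> I -> R) al a r L (B : R) :
  feature_path phi phi' a r L -> obs al ->
  (forall s, `|s - a| < r -> forall i, is_derive s 1 (fun t => z t i) (z' s i)) ->
  (forall s, `|s - a| < r -> forall i, `|z s i| <= B /\ `|z' s i| <= B) ->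
  is_derive a 1 (fun s => moment prior (phi s) al (z s))
    (moment prior (phi a) (fun x => al x *
      (dot (phi' a x) (z a) + dot (phi a x) (z' a) - dot (phi' a x) (phi a x))) (z a)).
Proof.
move=> P oa dz zB; have [r0 L0 o o' l l' d] := P.
have [mal [La aLa]] := oa.
pose drift s x := dot (phi' s x) (z s) + dot (phi s x) (z' s) - dot (phi' s x) (phi s x).
pose N := 1 + (`|B| + L) * #|I|%:R.
have N0 : 0 <= N by rewrite addr_ge0// mulr_ge0// addr_ge0.
apply: der_eq (@Rintegral_is_derive _ _ _ prior
  (fun s x => al x * dens (phi s) (z s) x)
  (fun s x => al x * (drift s x * dens (phi s) (z s) x))
  (fun x => `|La| * ((L * N + L * N + L * N) * expR (L * N))) a r r0 _ _ _ _) _.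
- by move=> s sr; apply: moment_integrable => //; exact: o.
- move=> s x sr; apply: derZ; rewrite /dens /drift.
  apply: der_eq (der_expR (derB (der_sum _ (fun i => derM (d s sr x i) (dz s sr i)))
    (derZ 2^-1 (der_sum _ (fun i => derM (d s sr x i) (d s sr x i)))))) _.
  rewrite [LHS]mulrC; congr (_ * _); rewrite !big_split/= /dot.
  have -> : \sum_(i : I) phi s x i * phi' s x i = \sum_i phi' s x i * phi s x i.
    by apply: eq_bigr => i _; rewrite mulrC.
  by field.
- by apply: obs_integrable; exact: obs_cst.
- move=> s x sr; rewrite normrM ler_pM//.
    exact: le_trans (aLa x) (ler_norm _).
  rewrite normrM ler_pM//; last first.
    rewrite ger0_norm ?expR_ge0//; apply: le_trans (dens_le L0 (l s sr) x _) _.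
    rewrite ler_expR ler_wpM2l//; apply: size1_le => i.
    have [zsB _] := zB s sr i; apply: le_trans zsB _.
    by apply: le_trans (ler_norm _) _; rewrite lerDl.
  have dl (u v : I -> R) : (forall i, `|u i| <= L) -> (forall i, `|v i| <= `|B| + L) ->
      `|dot u v| <= L * N.
    move=> uL vB; apply: le_trans (dot_le v L0 uL) _.
    by rewrite ler_wpM2l//; exact: size1_le.
  rewrite /drift; apply: le_trans (ler_normB _ _) _.
  apply: lerD; first (apply: le_trans (ler_normD _ _) _; apply: lerD).
  + apply: dl; [exact: l'|move=> i]; have [zsB _] := zB s sr i.
    by apply: le_trans zsB _; apply: le_trans (ler_norm _) _; rewrite lerDl.
  + apply: dl; [exact: l|move=> i]; have [_ zsB] := zB s sr i.
    by apply: le_trans zsB _; apply: le_trans (ler_norm _) _; rewrite lerDl.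
  + apply: dl; [exact: l'|move=> i]; apply: le_trans (l s sr x i) _.
    by rewrite lerDr.
- by apply: eq_Rintegral => x _; rewrite mulrA.
Qed.

Lemma moment_der_features phi phi' al a r L y :
  feature_path phi phi' a r L -> obs al ->
  is_derive a 1 (fun s => moment prior (phi s) al y)
    (\sum_i y i * moment prior (phi a) (fun x => al x * phi' a x i) y
     - \sum_i moment prior (phi a) (fun x => al x * phi' a x i * phi a x i) y).
Proof.
move=> P oa; have ar := path_center P.
have op := path_obs P ar; have op' := path_obs' P ar.
apply: der_eq (@moment_is_derive phi phi' (fun=> y) (fun _ _ => 0) al a r L
  (size1 y) P oa _ _) _.
- by move=> s sr i; exact: der_cst.
- by move=> s sr i; rewrite normr0 size1_ge0 normr_le_size1.
rewrite -sumrB.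
have momentE i : y i * moment prior (phi a) (fun x => al x * phi' a x i) y
    - moment prior (phi a) (fun x => al x * phi' a x i * phi a x i) y
  = moment prior (phi a) (fun x => y i * (al x * phi' a x i)
     + (-1) * (al x * phi' a x i * phi a x i)) y.
  rewrite momentD// ?momentZ//.
  - by rewrite mulN1r.
  - by apply: obsM => //; exact: obsM.
  - exact: obsM.
  - by apply: obsZ; exact: obsM.
  - by apply: obsZ; apply: obsM => //; exact: obsM.
under [RHS]eq_bigr do rewrite momentE.
have -> : forall (r : seq I) , \sum_(i <- r) moment prior (phi a) (fun x => y i * (al x * phi' a x i)
     + (-1) * (al x * phi' a x i * phi a x i)) y =
   moment prior (phi a) (fun x => \sum_(i <- r) (y i * (al x * phi' a x i)
     + (-1) * (al x * phi' a x i * phi a x i))) y.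
  have ob i : obs (fun x => y i * (al x * phi' a x i)
     + (-1) * (al x * phi' a x i * phi a x i)).
    apply: obsD; first by apply: obsZ; exact: obsM.
    by apply: obsZ; apply: obsM => //; exact: obsM.
  elim=> [|i s ih].
    rewrite big_nil -[LHS](mul0r (moment prior (phi a) (fun=> 1) y)).
    rewrite -(momentZ prior op 0 y (obs_cst (1 : R))).
    by congr (moment _ _ _ _); apply/funext => x; rewrite big_nil mul0r.
  rewrite big_cons ih -momentD//; last exact: obs_sum.
  by congr (moment _ _ _ _); apply/funext => x; rewrite big_cons.
congr (moment _ _ _ _); apply/funext => x; rewrite /dot.
rewrite [X in _ + X - _]big1 ?addr0; last by move=> i _; rewrite mulr0.
rewrite -sumrB mulr_sumr; apply: eq_bigr => i _; ring.
Qed.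

Lemma moment_der_perturb (phi : X -> I -> R) al y i : obs_features phi -> obs al ->
  is_derive (0 : R) 1 (fun c => moment prior phi al (perturb y i c))
    (moment prior phi (fun x => al x * phi x i) y).
Proof.
move=> op oa; have [L L0 pL] := features_bound op.
have P : feature_path (fun=> phi) (fun _ _ _ => 0) 0 1 L.
  split=> //.
  - by move=> s _ j; exact: obs_cst.
  - by move=> s _ x j; rewrite normr0.
  - by move=> s _ x j; exact: der_cst.
apply: der_eq (@moment_is_derive (fun=> phi) (fun _ _ _ => 0) (fun c => perturb y i c)
  (fun _ j => (j == i)%:R) al 0 1 L (size1 y + 1) P oa _ _) _.
- move=> s sr j; apply: der_eq (derD (der_cst (y j) s)
    (derM (der_id s) (der_cst ((j == i)%:R : R) s))) _.
  by rewrite mul1r mulr0 addr0 add0r.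
- move=> s; rewrite subr0 => sr j; split.
    apply: le_trans (ler_normD _ _) _; apply: lerD; first exact: normr_le_size1.
    case: (j == i); rewrite ?mulr1 ?(ltW sr)// mulr0 normr0.
    exact: ler01.
  by case: (j == i); rewrite ?normr1 ?normr0 ?lerDr ?size1_ge0// addr_ge0 ?size1_ge0.
rewrite perturb0; congr (moment _ _ _ _); apply/funext => x; congr (_ * _).
rewrite /dot big1 ?add0r; last by move=> j _; rewrite mul0r.
rewrite [X in _ - X]big1 ?subr0; last by move=> j _; rewrite mul0r.
rewrite (bigD1 i)//= eqxx mulr1 big1 ?addr0// => j /negbTE ->.
by rewrite mulr0.
Qed.

End FeaturePath.

Section Heat.
Context {R : realType} {I : finType} {dX} {X : measurableType dX}
  (prior : probability X R) {dG} {G : measurableType dG}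
  (gam : probability G R) (g : G -> I -> R).
Hypothesis gv : gaussian_vector gam g.
Implicit Types (al be : X -> R) (y : I -> R).

Local Notation E := (expect gam g).
Local Notation Z := (partition_function prior).
Local Notation mom := (moment prior).
Local Notation avg := (gibbs prior).

Definition gibbs_cov (phi : X -> I -> R) al be y : R :=
  avg phi (fun x => al x * be x) y - avg phi al y * avg phi be y.

Lemma gaussian_ibp_sum (f f' h : I -> (I -> R) -> R) :
  (forall i, tame (f i)) -> (forall i, tame (f' i)) -> (forall i, tame (h i)) ->
  (forall i y, is_derive (0 : R) 1 (fun c => f i (perturb y i c)) (f' i y)) ->
  E (fun y => \sum_i y i * f i y - \sum_i h i y) =
  E (fun y => \sum_i (f' i y - h i y)).
Proof.
move=> tf tf' th df.
have tyf i : tame (fun y => y i * f i y) by apply: tameM => //; exact: tame_coord.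
rewrite expectB//; [|exact: tame_sum..].
rewrite !expect_sum//; last by move=> i; exact: tameB.
rewrite -sumrB; apply: eq_bigr => i _; rewrite expectB//; congr (_ - _).
exact: gaussian_ibp.
Qed.

Lemma tame_div (phi : X -> I -> R) f : obs_features phi -> tame f ->
  tame (fun y => f y / Z phi y).
Proof. by move=> op tf; apply: tameM => //; exact: tame_partition_inv. Qed.

Section Path.
Context (phi phi' : R -> X -> I -> R) (a r L : R).
Hypothesis P : feature_path phi phi' a r L.

Let ball := [set s | `|s - a| < r].
Let op := path_obs P (path_center P).
Let op' := path_obs' P (path_center P).

Lemma path_growth_moment (al : R -> X -> R) (L' : R) : 0 <= L' ->
  (forall s, ball s -> obs (al s)) ->
  (forall s, ball s -> forall x, `|al s x| <= L') ->
  growth ball (fun s => mom (phi s) (al s)).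
Proof.
move=> L'0 oa aL; apply: (@growth_moment _ _ _ _ prior _ ball phi L _ _ _ al L') => //.
- exact: (path_obs P).
- exact: (path_bound_ge0 P).
- exact: (path_bound P).
Qed.

Lemma path_growth_drift al : obs al ->
  growth ball (fun s y => \sum_i y i * mom (phi s) (fun x => al x * phi' s x i) y
     - \sum_i mom (phi s) (fun x => al x * phi' s x i * phi s x i) y).
Proof.
move=> oa; have [_ [La aL]] := oa.
have aL' x : `|al x| <= `|La| by exact: le_trans (aL x) (ler_norm _).
have L0 := path_bound_ge0 P.
apply: growthB; apply: growth_sum => i.
  apply: growthM; first exact: growth_coord.
  apply: (@path_growth_moment _ (`|La| * L)); first exact: mulr_ge0.
    by move=> s bs; apply: obsM => //; exact: (path_obs' P bs).
  by move=> s bs x; rewrite normrM ler_pM//; exact: (path_bound' P bs).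
apply: (@path_growth_moment _ (`|La| * L * L)); first by rewrite !mulr_ge0.
  move=> s bs; apply: obsM; last exact: (path_obs P bs).
  by apply: obsM => //; exact: (path_obs' P bs).
move=> s bs x; rewrite !normrM ler_pM//; last exact: (path_bound P bs).
by rewrite ler_pM//; exact: (path_bound' P bs).
Qed.

Lemma path_growth_obs al : obs al -> growth ball (fun s => mom (phi s) al).
Proof.
move=> oa; have [_ [La aL]] := oa.
apply: (@path_growth_moment (fun=> al) `|La|) => // s bs x.
exact: le_trans (aL x) (ler_norm _).
Qed.

Lemma path_growth_partition_inv : growth ball (fun s y => (Z (phi s) y)^-1).
Proof.
apply: (@growth_partition_inv _ _ _ _ prior _ ball phi L).
- exact: (path_obs P).
- exact: (path_bound_ge0 P).
- exact: (path_bound P).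
Qed.

Lemma path_growth_ln_partition : growth ball (fun s y => ln (Z (phi s) y)).
Proof.
apply: (@growth_ln_partition _ _ _ _ prior _ ball phi L).
- exact: (path_obs P).
- exact: (path_bound_ge0 P).
- exact: (path_bound P).
Qed.

Lemma path_moment_derive s al y : ball s -> obs al ->
  is_derive s 1 (fun t => mom (phi t) al y)
    (\sum_i y i * mom (phi s) (fun x => al x * phi' s x i) y
     - \sum_i mom (phi s) (fun x => al x * phi' s x i * phi s x i) y).
Proof. by move=> bs oa; exact: (moment_der_features prior y (path_recenter P bs) oa). Qed.

(** The entropy obeys the heat equation: of the derivative of [Z ln Z] only the
    second-order term survives the integration by parts. *)
Lemma entropy_derive :
  is_derive a 1 (fun s => E (fun y => Z (phi s) y * ln (Z (phi s) y)))
    (E (fun y => Z (phi a) y * \sum_i avg (phi a) (fun x => phi a x i) y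
                                   * avg (phi a) (fun x => phi' a x i) y)).
Proof.
have o1 : obs (fun _ : X => 1 : R) by exact: obs_cst.
pose drift s y := \sum_i y i * mom (phi s) (fun x => 1 * phi' s x i) y
     - \sum_i mom (phi s) (fun x => 1 * phi' s x i * phi s x i) y.
have gd : growth ball drift by exact: path_growth_drift.
apply: der_eq.
  apply: (expect_is_derive gv (F' := fun s y => (ln (Z (phi s) y) + 1) * drift s y)
    (path_radius P)).
  - move=> s bs; have os := path_obs P bs.
    by have [] := tameM (tame_partition prior os) (tame_ln_partition prior os).
  - apply: growthM; first exact: path_growth_obs.
    exact: path_growth_ln_partition.
  - apply: growthM => //; apply: growthD; last exact: growth_cst.
    exact: path_growth_ln_partition.
  - move=> s y bs; have os := path_obs P bs.
    have D := path_moment_derive y bs o1.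
    apply: der_eq (derM D (der_ln (partition_function_gt0 prior os y) D)) _.
    rewrite -/(drift s y) -/(Z (phi s) y).
    by have := partition_function_neq0 prior os y => Z0; field.
pose f i y := (ln (Z (phi a) y) + 1) * mom (phi a) (fun x => 1 * phi' a x i) y.
pose f' i y := mom (phi a) (fun x => 1 * phi a x i) y / Z (phi a) y
    * mom (phi a) (fun x => 1 * phi' a x i) y
  + (ln (Z (phi a) y) + 1) * mom (phi a) (fun x => 1 * phi' a x i * phi a x i) y.
pose h i y := (ln (Z (phi a) y) + 1)
  * mom (phi a) (fun x => 1 * phi' a x i * phi a x i) y.
have tl : tame (fun y => ln (Z (phi a) y) + 1).
  by apply: tameD; [exact: tame_ln_partition|exact: tame_cst].
have oq i : obs (fun x => 1 * phi' a x i) by exact: obsM.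
have oqp i : obs (fun x => 1 * phi' a x i * phi a x i) by exact: obsM.
have opp i : obs (fun x => 1 * phi a x i) by exact: obsM.
have tf i : tame (f i) by apply: tameM => //; exact: tame_moment.
have th i : tame (h i) by apply: tameM => //; exact: tame_moment.
have tf' i : tame (f' i).
  apply: tameD; last exact: th.
  by apply: tameM; [apply: tame_div => //; exact: tame_moment|exact: tame_moment].
have df i y : is_derive (0 : R) 1 (fun c => f i (perturb y i c)) (f' i y).
  have Dz := moment_der_perturb prior y i op o1.
  have Dq := moment_der_perturb prior y i op (oq i).
  have Zp : 0 < Z (phi a) (perturb y i 0) by exact: partition_function_gt0.
  apply: der_eq (derM (derD (der_ln Zp Dz) (der_cst 1 0)) Dq) _.
  by rewrite perturb0 addr0.
transitivity (E (fun y => \sum_i y i * f i y - \sum_i h i y)).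
  apply: eq_expect => y; rewrite /drift mulrBr !mulr_sumr; congr (_ - _).
  by apply: eq_bigr => i _; rewrite /f mulrCA.
rewrite (gaussian_ibp_sum tf tf' th df); apply: eq_expect => y.
rewrite mulr_sumr; apply: eq_bigr => i _; rewrite /f' /h addrK /gibbs.
have := partition_function_neq0 prior op y => Z0.
have -> : (fun x => 1 * phi a x i) = (fun x => phi a x i).
  by apply/funext => x; rewrite mul1r.
have -> : (fun x => 1 * phi' a x i) = (fun x => phi' a x i).
  by apply/funext => x; rewrite mul1r.
by field.
Qed.

(** Integration by parts again cancels every term but the products of two
    covariances, one for each factor. *)
Lemma overlap_derive al be : obs al -> obs be ->
  is_derive a 1 (fun s => E (fun y => Z (phi s) y * (avg (phi s) al y * avg (phi s) be y)))
    (E (fun y => Z (phi a) y * \sum_i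
      (gibbs_cov (phi a) al (fun x => phi' a x i) y
         * gibbs_cov (phi a) be (fun x => phi a x i) y
       + gibbs_cov (phi a) al (fun x => phi a x i) y
         * gibbs_cov (phi a) be (fun x => phi' a x i) y))).
Proof.
move=> oa ob.
have o1 : obs (fun _ : X => 1 : R) by exact: obs_cst.
pose drift al s y := \sum_i y i * mom (phi s) (fun x => al x * phi' s x i) y
     - \sum_i mom (phi s) (fun x => al x * phi' s x i * phi s x i) y.
have gd al' : obs al' -> growth ball (drift al') by exact: path_growth_drift.
pose F' s y := drift al s y * (mom (phi s) be y * (Z (phi s) y)^-1)
  + mom (phi s) al y * (drift be s y * (Z (phi s) y)^-1)
  - mom (phi s) al y * (mom (phi s) be y * (drift (fun=> 1) s y
      * ((Z (phi s) y)^-1 * (Z (phi s) y)^-1))).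
have gZ := path_growth_partition_inv.
have ga := path_growth_obs oa.
have gb := path_growth_obs ob.
apply: der_eq.
  apply: (expect_is_derive gv (F' := F') (path_radius P)).
  - move=> s bs; have os := path_obs P bs.
    by have [] := tameM (tame_partition prior os)
      (tameM (tame_gibbs prior os oa) (tame_gibbs prior os ob)).
  - apply: growthM; first exact: path_growth_obs.
    by apply: growthM; exact: growthM.
  - apply: growthB.
      apply: growthD; first by apply: growthM; [exact: gd|exact: growthM].
      by apply: growthM => //; apply: growthM => //; exact: gd.
    apply: growthM => //; apply: growthM => //; apply: growthM; first exact: gd.
    exact: growthM.
  - move=> s y bs; have os := path_obs P bs.
    have Z0 := partition_function_neq0 prior os y.
    have D1 : is_derive s 1 (fun t => Z (phi t) y) (drift (fun=> 1) s y) :=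
      path_moment_derive y bs o1.
    have Da : is_derive s 1 (fun t => mom (phi t) al y) (drift al s y) :=
      path_moment_derive y bs oa.
    have Db : is_derive s 1 (fun t => mom (phi t) be y) (drift be s y) :=
      path_moment_derive y bs ob.
    have DZ := @derV _ (fun t => Z (phi t) y) s _ Z0 D1.
    apply: (der_eq (derM D1 (derM (derM Da DZ) (derM Db DZ)))).
    by rewrite /F'; move: Z0; move: (drift _ s y) (drift _ s y) (drift _ s y)
      (Z _ y) (mom _ al y) (mom _ be y) => d1 d2 d3 z A B z0; field.
pose q i x := phi' a x i; pose p i x := phi a x i.
have oq i : obs (q i) by exact: op'.
have oP i : obs (p i) by exact: op.
pose z y := (Z (phi a) y)^-1; pose A := mom (phi a) al; pose B := mom (phi a) be.
pose Q i := mom (phi a) (fun x => 1 * q i x).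
pose AQ i := mom (phi a) (fun x => al x * q i x).
pose BQ i := mom (phi a) (fun x => be x * q i x).
pose dA i := mom (phi a) (fun x => al x * p i x).
pose dB i := mom (phi a) (fun x => be x * p i x).
pose dZ i := mom (phi a) (fun x => 1 * p i x).
pose dQ i := mom (phi a) (fun x => 1 * q i x * p i x).
pose dAQ i := mom (phi a) (fun x => al x * q i x * p i x).
pose dBQ i := mom (phi a) (fun x => be x * q i x * p i x).
have tz : tame z by exact: tame_partition_inv.
have tA : tame A by exact: tame_moment.
have tB : tame B by exact: tame_moment.
have oaq i : obs (fun x => al x * q i x) by exact: obsM.
have obq i : obs (fun x => be x * q i x) by exact: obsM.
have o1q i : obs (fun x => 1 * q i x) by exact: obsM.
have tQ i : tame (Q i) by exact: tame_moment.
have tAQ i : tame (AQ i) by exact: tame_moment.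
have tBQ i : tame (BQ i) by exact: tame_moment.
have tdA i : tame (dA i) by apply: tame_moment => //; exact: obsM.
have tdB i : tame (dB i) by apply: tame_moment => //; exact: obsM.
have tdZ i : tame (dZ i) by apply: tame_moment => //; exact: obsM.
have tdQ i : tame (dQ i) by apply: tame_moment => //; exact: obsM.
have tdAQ i : tame (dAQ i) by apply: tame_moment => //; exact: obsM.
have tdBQ i : tame (dBQ i) by apply: tame_moment => //; exact: obsM.
pose f i y := AQ i y * (B y * z y) + A y * (BQ i y * z y)
  - A y * (B y * (Q i y * (z y * z y))).
pose h i y := dAQ i y * (B y * z y) + A y * (dBQ i y * z y)
  - A y * (B y * (dQ i y * (z y * z y))).
pose f' i y := h i y + (AQ i y * dB i y + dA i y * BQ i y) * z y
  - (AQ i y * B y + A y * BQ i y) * (dZ i y * (z y * z y))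
  - (dA i y * B y + A y * dB i y) * (Q i y * (z y * z y))
  + 2 * (A y * B y * (Q i y * (dZ i y * (z y * (z y * z y))))).
have tzz := tameM tz tz.
have tf i : tame (f i) := tameB (tameD (tameM (tAQ i) (tameM tB tz))
  (tameM tA (tameM (tBQ i) tz))) (tameM tA (tameM tB (tameM (tQ i) tzz))).
have th i : tame (h i) := tameB (tameD (tameM (tdAQ i) (tameM tB tz))
  (tameM tA (tameM (tdBQ i) tz))) (tameM tA (tameM tB (tameM (tdQ i) tzz))).
have tf' i : tame (f' i) := tameD (tameB (tameB
  (tameD (th i) (tameM (tameD (tameM (tAQ i) (tdB i)) (tameM (tdA i) (tBQ i))) tz))
  (tameM (tameD (tameM (tAQ i) tB) (tameM tA (tBQ i))) (tameM (tdZ i) tzz)))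
  (tameM (tameD (tameM (tdA i) tB) (tameM tA (tdB i))) (tameM (tQ i) tzz)))
  (tameM (tame_cst 2) (tameM (tameM tA tB)
    (tameM (tQ i) (tameM (tdZ i) (tameM tz tzz))))).
have df i y : is_derive (0 : R) 1 (fun c => f i (perturb y i c)) (f' i y).
  have Dm al' : obs al' -> is_derive (0 : R) 1
      (fun c => mom (phi a) al' (perturb y i c)) (mom (phi a) (fun x => al' x * p i x) y).
    by move=> o; exact: moment_der_perturb.
  have Z0 := partition_function_neq0 prior op y.
  have Dz : is_derive (0 : R) 1 (fun c => z (perturb y i c))
      (- (dZ i y / Z (phi a) y ^+ 2)).
    have := @derV _ (fun c => Z (phi a) (perturb y i c)) 0 _ _ (Dm _ o1).
    by rewrite perturb0; apply.
  have H := derB (derD (derM (Dm _ (oaq i)) (derM (Dm _ ob) Dz))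
     (derM (Dm _ oa) (derM (Dm _ (obq i)) Dz)))
    (derM (Dm _ oa) (derM (Dm _ ob) (derM (Dm _ (o1q i)) (derM Dz Dz)))).
  apply: (der_eq H); rewrite perturb0 -[mom _ _ _]/(dAQ i y).
  rewrite -/(AQ i y) -/(BQ i y) -/(Q i y) -/(A y) -/(B y) -/(dA i y) -/(dB i y).
  rewrite -/(dQ i y) -/(dBQ i y) /f' /h /z.
  move: Z0; move: (Z _ y) (AQ i y) (BQ i y) (Q i y) (A y) (B y) (dA i y) (dB i y)
    (dQ i y) (dAQ i y) (dBQ i y) (dZ i y) => *; field => //.
transitivity (E (fun y => \sum_i y i * f i y - \sum_i h i y)).
  apply: eq_expect => y; rewrite /F' /drift.
  rewrite -!/(Z (phi a) y) -/(z y) -/(A y) -/(B y).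
  rewrite -!sumrB !(mulr_suml, mulr_sumr) -big_split/= -sumrB.
  apply: eq_bigr => i _; rewrite /f /h.
  rewrite -/(AQ i y) -/(BQ i y) -/(Q i y) -/(dAQ i y) -/(dBQ i y) -/(dQ i y).
  ring.
rewrite (gaussian_ibp_sum tf tf' th df); apply: eq_expect => y.
rewrite mulr_sumr; apply: eq_bigr => i _; rewrite /f' /gibbs_cov /gibbs.
have := partition_function_neq0 prior op y => Z0.
rewrite -/(A y) -/(B y) -/(AQ i y) -/(BQ i y) -/(dA i y) -/(dB i y).
have -> : mom (phi a) (fun x => phi a x i) y = dZ i y.
  by congr (moment _ _ _ _); apply/funext => x; rewrite mul1r.
have -> : mom (phi a) (fun x => phi' a x i) y = Q i y.
  by congr (moment _ _ _ _); apply/funext => x; rewrite mul1r.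
rewrite /z; move: Z0; move: (Z _ y) (AQ i y) (BQ i y) (Q i y) (A y) (B y) (dA i y)
  (dB i y) (h i y) (dZ i y) => *; by field.
Qed.

End Path.
End Heat.

(** * The joint law of the signal and the observation *)

Section Planted.
Context {R : realType} {I : finType} {dX} {X : measurableType dX}
  (prior : probability X R) {dG} {G : measurableType dG}
  (gam : probability G R) (g : G -> I -> R).
Hypothesis gv : gaussian_vector gam g.
Variable phi : X -> I -> R.
Hypothesis op : obs_features phi.
Implicit Types (al be : X -> R) (y : I -> R).

Local Notation E := (expect gam g).
Local Notation law := (prior \x gam)%E.

(** The vector at which the Gibbs measure is the law of the signal given the
    observation. *)
Definition observation (w : X * G) : I -> R := fun i => g w.2 i + phi w.1 i.

Let mg i : measurable_fun setT (g^~ i). Proof. by case: gv. Qed.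

Lemma measurable_observation i : measurable_fun setT (observation^~ i).
Proof.
apply: measurable_funD; first exact: (measurableT_comp (mg i) measurable_snd).
by case: (op i) => m _; exact: (measurableT_comp m measurable_fst).
Qed.

Lemma prod_integrable (F : X * G -> R) (C c : R) :
  measurable_fun setT F ->
  (forall w, `|F w| <= C * expR (c * size1 (g w.2))) ->
  law.-integrable setT (EFin \o F).
Proof.
move=> mF FC.
pose H (w : X * G) := `|C| * expR (c * size1 (g w.2)).
have msz : measurable_fun setT (fun w => expR (c * size1 (g w))).
  apply: measurableT_comp => //; apply: measurable_funM => //.
  apply: measurable_funD => //; apply: measurable_sum => i.
  exact: measurableT_comp.
have mH : measurable_fun setT H.
  by apply: measurable_funM => //; exact: (measurableT_comp msz measurable_snd).
apply: (@le_integrable _ _ _ law setT _ _ (EFin \o H)) => //.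
- exact/measurable_EFinP.
- move=> w _ /=; rewrite lee_fin; apply: le_trans (FC w) _.
  rewrite /H normrM normr_id (ger0_norm (expR_ge0 _)).
  by rewrite ler_wpM2r ?expR_ge0 ?ler_norm.
- apply/integrable12ltyP; first exact/measurable_EFinP.
  have iE := integrableZl measurableT `|C| (size1_exp_integrable gv c).
  have /integrableP[_ Efin] := iE.
  under eq_integral do rewrite /=.
  rewrite (eq_integral (cst (\int[gam]_w `|(`|C|%:E * (expR (c * size1 (g w)))%:E)|)%E)); last first.
    by move=> x _; apply: eq_integral => w _.
  by rewrite integral_cst// [X in (_ * X)%E]probability_setT mule1.
Qed.

Lemma size1D (u v : I -> R) (B : R) : (forall i, `|v i| <= B) ->
  size1 (fun i => u i + v i) <= size1 u + B * #|I|%:R.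
Proof.
move=> vB; rewrite /size1 -addrA lerD2l.
apply: (@le_trans _ _ (\sum_i (`|u i| + B))).
  by apply: ler_sum => i _; apply: le_trans (ler_normD _ _) _; rewrite lerD2l.
by rewrite big_split/= sumr_const mulr_natr.
Qed.

Lemma planted_integrable al f : obs al -> tame f ->
  law.-integrable setT (EFin \o (fun w => al w.1 * f (observation w))).
Proof.
move=> [mal [La aL]] [mf [c c0 fc]].
have [L L0 pL] := features_bound op.
apply: (@prod_integrable _ (`|La| * expR (c * (L * #|I|%:R))) c).
  apply: measurable_funM; first exact: (measurableT_comp mal measurable_fst).
  by apply: mf => i; exact: measurable_observation.
move=> w; rewrite normrM -mulrA ler_pM//.
  exact: le_trans (aL _) (ler_norm _).
apply: le_trans (fc tt Logic.I _) _; rewrite -expRD ler_expR -mulrDr ler_wpM2l//.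
by rewrite addrC; apply: size1D => i; exact: pL.
Qed.

(** The Nishimori identity: the change of density of the observation is the
    likelihood of the signal, so that integrating the signal out leaves the
    unnormalized Gibbs average. *)
Lemma planted_mean al f : obs al -> tame f ->
  \int[law]_w (al w.1 * f (observation w)) = E (fun y => moment prior phi al y * f y).
Proof.
move=> oa tf; have [mf [c c0 fc]] := tf; have [mal [La aL]] := oa.
have [L L0 pL] := features_bound op.
have iF := planted_integrable oa tf.
rewrite /expect /Rintegral; congr fine.
rewrite -(integral12_prod_meas1 iF) /fubini_F/=.
pose K (w : X * G) := al w.1 * (f (g w.2) * dens phi (g w.2) w.1).
have mK : measurable_fun setT K.
  apply: measurable_funM; first exact: (measurableT_comp mal measurable_fst).
  apply: measurable_funM.
    by apply: (mf _ _ (fun w => g w.2)) => i; exact: (measurableT_comp (mg i) measurable_snd).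
  have mphi i : measurable_fun [set: X * G] (fun p => phi p.1 i).
    by case: (op i) => m _; exact: (measurableT_comp m measurable_fst).
  have mg2 i : measurable_fun [set: X * G] (fun p => g p.2 i).
    exact: (measurableT_comp (mg i) measurable_snd).
  apply: measurableT_comp => //; apply: measurable_funB.
    by apply: measurable_sum => i; exact: measurable_funM.
  apply: measurable_funM => //.
  by apply: measurable_sum => i; exact: measurable_funM.
have iK : law.-integrable setT (EFin \o K).
  apply: (@prod_integrable _ `|La| (c + L)) => // w.
  rewrite normrM ler_pM//; first exact: le_trans (aL _) (ler_norm _).
  rewrite normrM mulrDl expRD ler_pM//; first exact: (fc tt).
  by rewrite ger0_norm ?expR_ge0//; exact: dens_le.
transitivity (\int[prior]_x \int[gam]_w (EFin \o K) (x, w))%E.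
  apply: eq_integral => x _.
  have obd : obs (fun _ : X => al x) by exact: obs_cst.
  have := gaussian_shift gv (phi x) (tameM (tame_cst (al x)) tf).
  rewrite /expect /Rintegral => H.
  have tfs : tame (fun y => al x * f (fun i => y i + phi x i)).
    split.
      move=> d T y my; apply: measurable_funM => //.
      by apply: (mf _ _ (fun t i => y t i + phi x i)) => i; exact: measurable_funD.
    apply: growthM; first exact: growth_cst.
    have [L' L'0 pL'] := features_bound op.
    exists (c * (1 + L' * #|I|%:R)); first by rewrite mulr_ge0// addr_ge0// mulr_ge0.
    move=> _ _ y; apply: le_trans (fc tt Logic.I _) _.
    rewrite ler_expR -mulrA ler_wpM2l//.
    apply: le_trans (size1D _ (fun i => pL' x i)) _.
    by rewrite mulrDl mul1r lerD2l ler_peMr ?size1_ge1// mulr_ge0.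
  have tfd : tame (fun y => al x * f y * expR (dot (phi x) y - 2^-1 * dot (phi x) (phi x))).
    apply: tameM; first exact: tameM (tame_cst _) tf.
    split.
      move=> d T y my; apply: measurableT_comp => //; apply: measurable_funB => //.
      by apply: measurable_sum => i; exact: measurable_funM.
    exists L => // _ _ y; rewrite ger0_norm ?expR_ge0//.
    exact: (dens_le L0 pL x y).
  have i1 := integrable_fin_num measurableT (tame_integrable gv tfs).
  have i2 := integrable_fin_num measurableT (tame_integrable gv tfd).
  transitivity (\int[gam]_w (al x * f (g w) *
      expR (dot (phi x) (g w) - 2^-1 * dot (phi x) (phi x)))%:E)%E.
    by rewrite -[LHS](fineK i1) -[RHS](fineK i2); congr (_%:E).
  by apply: eq_integral => w _; rewrite /K/= mulrA.
rewrite (Fubini iK); apply: eq_integral => w _ /=.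
rewrite /K/= /moment EFinM fineK; last first.
  apply: (integrable_fin_num measurableT); exact: moment_integrable.
rewrite muleC -integralZl//; last exact: moment_integrable.
by apply: eq_integral => x _; rewrite /= -EFinM; congr (_%:E); ring.
Qed.

Lemma gibbs_der_perturb al y i : obs al ->
  is_derive (0 : R) 1 (fun c => gibbs prior phi al (perturb y i c))
    (gibbs_cov prior phi al (fun x => phi x i) y).
Proof.
move=> oa; have o1 : obs (fun _ : X => 1 : R) by exact: obs_cst.
have Z0 : partition_function prior phi (perturb y i 0) != 0.
  exact: partition_function_neq0.
have D := der_div Z0 (moment_der_perturb prior y i op oa)
  (moment_der_perturb prior y i op o1).
apply: (der_eq D); rewrite perturb0 /gibbs_cov /gibbs.
have -> : (fun x => 1 * phi x i) = (fun x => phi x i).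
  by apply/funext => x; rewrite mul1r.
by rewrite mulrBl !mulrA.
Qed.

Variable phi' : X -> I -> R.
Hypothesis op' : obs_features phi'.
Local Notation avg := (gibbs prior phi).

(** The derivative of [ln Z] at the observation, when the features move in the
    direction [phi'] and the observation moves with them. *)
Definition score (xi : I -> R) y : R :=
  \sum_i y i * avg (fun x => phi' x i) y + \sum_i xi i * avg (fun x => phi x i) y
  - \sum_i avg (fun x => phi' x i * phi x i) y.

(** The score is linear in the observation and in the signal; the terms with the
    signal are covered by the Nishimori identity and those with the observation by
    integration by parts. *)
Lemma planted_score al be : obs al -> obs be ->
  \int[law]_w (al w.1 * avg be (observation w) * score (phi' w.1) (observation w)) =
  E (fun y => partition_function prior phi y * \sum_i
    (avg be y * (avg (fun x => al x * phi x i) y * avg (fun x => phi' x i) y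
               + avg (fun x => al x * phi' x i) y * avg (fun x => phi x i) y)
     + avg al y * avg (fun x => be x * phi x i) y * avg (fun x => phi' x i) y
     - 2 * avg al y * avg be y * avg (fun x => phi x i) y * avg (fun x => phi' x i) y)).
Proof.
move=> oa ob.
pose q i x := phi' x i; pose p i x := phi x i.
have oq i : obs (q i) by exact: op'.
have oP i : obs (p i) by exact: op.
have oqp i : obs (fun x => q i x * p i x) by exact: obsM.
have oap i : obs (fun x => al x * p i x) by exact: obsM.
have oaq i : obs (fun x => al x * q i x) by exact: obsM.
have obp i : obs (fun x => be x * p i x) by exact: obsM.
have tq i : tame (avg (q i)) by exact: tame_gibbs.
have tp i : tame (avg (p i)) by exact: tame_gibbs.
have tqp i : tame (avg (fun x => q i x * p i x)) by exact: tame_gibbs.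
have tbp i : tame (avg (fun x => be x * p i x)) by exact: tame_gibbs.
have tb : tame (avg be) by exact: tame_gibbs.
have tma : tame (moment prior phi al) by exact: tame_moment.
have tmap i : tame (moment prior phi (fun x => al x * p i x)) by exact: tame_moment.
have tmaq i : tame (moment prior phi (fun x => al x * q i x)) by exact: tame_moment.
pose f1 y := \sum_i y i * (avg be y * avg (q i) y)
  - \sum_i avg be y * avg (fun x => q i x * p i x) y.
pose f2 i y := avg be y * avg (p i) y.
have tf1 : tame f1.
  apply: tameB; apply: tame_sum => i; last exact: tameM.
  by apply: tameM; [exact: tame_coord|exact: tameM].
have tf2 i : tame (f2 i) by exact: tameM.
transitivity (\int[law]_w (al w.1 * f1 (observation w)
    + \sum_i (al w.1 * q i w.1) * f2 i (observation w))).
  apply: eq_Rintegral => w _; rewrite /score /f1 /f2.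
  have -> : \sum_i al w.1 * q i w.1 * (avg be (observation w) * avg (p i) (observation w))
    = al w.1 * (avg be (observation w) * \sum_i phi' w.1 i * avg (p i) (observation w)).
    by rewrite !mulr_sumr; apply: eq_bigr => i _; rewrite /q; ring.
  have -> : \sum_i observation w i * (avg be (observation w) * avg (q i) (observation w))
    = avg be (observation w) * \sum_i observation w i * avg (q i) (observation w).
    by rewrite mulr_sumr; apply: eq_bigr => i _; ring.
  by rewrite -mulr_sumr /q /p; ring.
have isum (r : seq I) : law.-integrable setT (EFin \o (fun w =>
    \sum_(i <- r) (al w.1 * q i w.1) * f2 i (observation w))).
  rewrite (_ : _ \o _ = (fun w =>
      \sum_(i <- r) ((al w.1 * q i w.1) * f2 i (observation w))%:E)%E).
    apply: integrable_sum => // i _.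
    exact: (@planted_integrable (fun x => al x * q i x) (f2 i)).
  by apply/funext => w /=; rewrite sumEFin.
rewrite RintegralD//; last exact: planted_integrable.
rewrite (planted_mean oa tf1).
have -> : \int[law]_w (\sum_i (al w.1 * q i w.1) * f2 i (observation w)) =
    \sum_i E (fun y => moment prior phi (fun x => al x * q i x) y * f2 i y).
  transitivity (\sum_i \int[law]_w ((al w.1 * q i w.1) * f2 i (observation w))).
    elim: (index_enum I) => [|j s ih].
      rewrite big_nil; under eq_Rintegral do rewrite big_nil.
      by rewrite Rintegral_cst// mul0r.
    rewrite big_cons -ih -RintegralD//.
    - by apply: eq_Rintegral => w _; rewrite big_cons.
    - exact: (@planted_integrable (fun x => al x * q j x) (f2 j)).
  by apply: eq_bigr => i _; rewrite -(planted_mean (oaq i) (tf2 i)).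
pose f i y := moment prior phi al y * (avg be y * avg (q i) y).
pose h i y := moment prior phi al y * (avg be y * avg (fun x => q i x * p i x) y).
pose cv al' i y := gibbs_cov prior phi al' (p i) y.
pose f' i y := moment prior phi (fun x => al x * p i x) y * (avg be y * avg (q i) y)
  + moment prior phi al y * (cv be i y * avg (q i) y + avg be y * cv (q i) i y).
have tcvb i : tame (cv be i) := tameB (tbp i) (tameM tb (tp i)).
have tcvq i : tame (cv (q i) i) := tameB (tqp i) (tameM (tq i) (tp i)).
have tf i : tame (f i) := tameM tma (tameM tb (tq i)).
have th i : tame (h i) := tameM tma (tameM tb (tqp i)).
have tf' i : tame (f' i) := tameD (tameM (tmap i) (tameM tb (tq i)))
  (tameM tma (tameD (tameM (tcvb i) (tq i)) (tameM tb (tcvq i)))).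
have df i y : is_derive (0 : R) 1 (fun c => f i (perturb y i c)) (f' i y).
  apply: (der_eq (derM (moment_der_perturb prior y i op oa)
    (derM (gibbs_der_perturb y i ob) (gibbs_der_perturb y i (oq i))))).
  by rewrite perturb0.
have -> : E (fun y => moment prior phi al y * f1 y) =
    E (fun y => \sum_i (f' i y - h i y)).
  rewrite -(gaussian_ibp_sum gv tf tf' th df); apply: eq_expect => y.
  rewrite /f1 mulrBr !mulr_sumr; congr (_ - _).
  by apply: eq_bigr => i _; rewrite /f; ring.
have tm2 i : tame (fun y => moment prior phi (fun x => al x * q i x) y * f2 i y).
  exact: tameM.
rewrite -(expect_sum gv _ tm2) -(expectD gv); last 2 first.
- by apply: tame_sum => i; exact: tameB.
- exact: tame_sum.
apply: eq_expect => y; rewrite mulr_sumr -big_split/=; apply: eq_bigr => i _.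
rewrite /f' /h /f2 /cv /gibbs_cov.
have momE a : moment prior phi a y = partition_function prior phi y * avg a y.
  by rewrite /gibbs mulrCA divff ?mulr1//; exact: partition_function_neq0.
rewrite !momE -/(p i) -/(q i).
ring.
Qed.

End Planted.

(** * The channel with quadratic and linear features *)

Section Model.
Context {R : realType} {N K : nat}.
Local Notation I := (('I_N * 'I_N) + ('I_N * 'I_K))%type.
Implicit Types (s m : 'M[R]_K) (x : 'M[R]_(N, K)).

(** The features of the Gaussian channel: with the coefficients [sg] equal to the
    square root of t/N and [s] equal to the square root of h, the Hamiltonian is
    the logarithm of their likelihood. *)
Definition feat (sg : R) s x : I -> R := fun k =>
  match k with
  | inl ij => sg * (x *m x^T) ij.1 ij.2
  | inr ik => (x *m s) ik.1 ik.2
  end.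

Lemma sum_index (f : I -> R) :
  \sum_k f k = \sum_i \sum_j f (inl (i, j)) + \sum_i \sum_j f (inr (i, j)).
Proof. by rewrite big_sumType !pair_bigA; congr (_ + _); apply: eq_bigr => -[]. Qed.

Lemma dot_feat sg s x sg' s' x' : dot (feat sg s x) (feat sg' s' x') =
  sg * sg' * mxdot (x *m x^T) (x' *m x'^T) + mxdot (x *m s) (x' *m s').
Proof.
rewrite /dot sum_index !mxdotE; congr (_ + _).
rewrite mulr_sumr; apply: eq_bigr => i _; rewrite mulr_sumr; apply: eq_bigr => j _.
by rewrite /feat/=; ring.
Qed.

Lemma feat_bound (B Bx sg : R) s x : 0 <= B -> `|sg| <= B -> fnorm s <= B ->
  fnorm x <= Bx -> forall k, `|feat sg s x k| <= B * (Bx ^+ 2 + Bx).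
Proof.
move=> B0 sgB sB xB; have Bx0 : 0 <= Bx by exact: le_trans (fnorm_ge0 _) xB.
have xx : fnorm (x *m x^T) <= Bx ^+ 2.
  apply: le_trans (fnormM _ _) _; rewrite fnorm_tr expr2.
  by apply: ler_pM => //; exact: fnorm_ge0.
move=> [ij|ik] /=; rewrite mulrDr.
  apply: (@le_trans _ _ (B * Bx ^+ 2)); last by rewrite lerDl mulr_ge0.
  rewrite normrM; apply: ler_pM => //.
  exact: le_trans (entry_le_fnorm _ _ _) xx.
apply: (@le_trans _ _ (B * Bx)); last by rewrite lerDr mulr_ge0// sqr_ge0.
apply: le_trans (entry_le_fnorm _ _ _) _; apply: le_trans (fnormM _ _) _.
by rewrite mulrC; apply: ler_pM => //; exact: fnorm_ge0.
Qed.

Lemma feat_derive (sg : R -> R) (s : R -> 'M[R]_K) (dsg : R) (ds : 'M[R]_K) x (a : R) k :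
  is_derive a 1 sg dsg -> (forall i j, is_derive a 1 (fun e => s e i j) (ds i j)) ->
  is_derive a 1 (fun e => feat (sg e) (s e) x k) (feat dsg ds x k).
Proof.
move=> dsgP dsP; case: k => [ij|ik] /=.
  by apply: (der_eq (derM dsgP (der_cst ((x *m x^T) ij.1 ij.2) a))); rewrite mulr0 addr0.
have E M : (x *m M) ik.1 ik.2 = \sum_j x ik.1 j * M j ik.2 by rewrite mxE.
under eq_fun do rewrite E; rewrite E.
by apply: der_sum => j; exact: derZ.
Qed.

Context {dX} {X : measurableType dX} (prior : probability X R)
  (xi : X -> 'M[R]_(N, K)) (Bx : R).
Hypothesis Bx0 : 0 <= Bx.
Hypothesis xi_obs : forall i j, obs (fun w => xi w i j).
Hypothesis xi_bound : forall w, fnorm (xi w) <= Bx.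

Lemma obs_mulmx p q r (A : X -> 'M[R]_(p, q)) (B : X -> 'M[R]_(q, r)) :
  (forall i j, obs (fun w => A w i j)) -> (forall i j, obs (fun w => B w i j)) ->
  forall i j, obs (fun w => (A w *m B w) i j).
Proof.
move=> oA oB i j; under eq_fun do rewrite mxE.
by apply: obs_sum => k; exact: obsM.
Qed.

Lemma obs_gram i j : obs (fun w => (xi w *m (xi w)^T) i j).
Proof.
apply: obs_mulmx => // k l; under eq_fun do rewrite mxE; exact: xi_obs.
Qed.

Lemma obs_mulmxr s i j : obs (fun w => (xi w *m s) i j).
Proof. by apply: obs_mulmx => // k l; exact: obs_cst. Qed.

Lemma obs_mxdot p q (A : X -> 'M[R]_(p, q)) (B : X -> 'M[R]_(p, q)) :
  (forall i j, obs (fun w => A w i j)) -> (forall i j, obs (fun w => B w i j)) ->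
  obs (fun w => mxdot (A w) (B w)).
Proof.
move=> oA oB; under eq_fun do rewrite mxdotE.
by apply: obs_sum => k; apply: obs_sum => l; exact: obsM.
Qed.

Definition phi sg s : X -> I -> R := fun w => feat sg s (xi w).

Lemma phi_obs sg s : obs_features (phi sg s).
Proof.
by move=> [ij|ik]; [apply: obsZ; exact: obs_gram|exact: obs_mulmxr].
Qed.

(** The derivatives are required on a whole neighbourhood, with uniform bounds, so
    that the features form a [feature_path]. *)
Record coef_path (sg dsg : R -> R) (s ds : R -> 'M[R]_K) (a r B : R) : Prop :=
  CoefPath {
  coef_radius : 0 < r;
  coef_bound_ge0 : 0 <= B;
  coef_sg : forall e, `|e - a| < r -> `|sg e| <= B /\ `|dsg e| <= B;
  coef_s : forall e, `|e - a| < r -> fnorm (s e) <= B /\ fnorm (ds e) <= B;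
  coef_sg_derive : forall e, `|e - a| < r -> is_derive e 1 sg (dsg e);
  coef_s_derive : forall e, `|e - a| < r -> forall i j,
    is_derive e 1 (fun e => s e i j) (ds e i j);
  coef_sym : forall e, `|e - a| < r -> (s e)^T = s e /\ (ds e)^T = ds e }.

(** The features are linear in the coefficients, hence their derivative consists of
    the features for the derivatives of the coefficients. *)
Lemma coef_feature_path (sg dsg : R -> R) (s ds : R -> 'M[R]_K) (a r B : R) : coef_path sg dsg s ds a r B ->
  feature_path (fun e => phi (sg e) (s e)) (fun e => phi (dsg e) (ds e)) a r
    (B * (Bx ^+ 2 + Bx)).
Proof.
move=> P; have [r0 B0 sgB sB sgd sd _] := P.
split=> //.
- by rewrite mulr_ge0// addr_ge0// sqr_ge0.
- by move=> e er; exact: phi_obs.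
- by move=> e er; exact: phi_obs.
- move=> e er w k; have [? _] := sgB e er; have [? _] := sB e er.
  exact: feat_bound.
- move=> e er w k; have [_ ?] := sgB e er; have [_ ?] := sB e er.
  exact: feat_bound.
- move=> e er w k; apply: feat_derive; first exact: sgd.
  exact: sd.
Qed.

Section Averages.
Variables (sg0 : R) (s0 : 'M[R]_K) (y : I -> R).
Local Notation avg := (gibbs prior (phi sg0 s0)).
Local Notation cov := (gibbs_cov prior (phi sg0 s0)).

Definition mean_mx : 'M[R]_(N, K) := \matrix_(i, j) avg (fun w => xi w i j) y.

Definition mean_gram : 'M[R]_N :=
  \matrix_(i, j) avg (fun w => (xi w *m (xi w)^T) i j) y.

Definition cov_mx (al : X -> R) : 'M[R]_(N, K) :=
  \matrix_(i, j) cov al (fun w => xi w i j) y.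

Definition cov_gram (al : X -> R) : 'M[R]_N :=
  \matrix_(i, j) cov al (fun w => (xi w *m (xi w)^T) i j) y.

Lemma gibbs_phi sg s k : avg (fun w => phi sg s w k) y =
  match k with
  | inl ij => sg * mean_gram ij.1 ij.2
  | inr ik => (mean_mx *m s) ik.1 ik.2
  end.
Proof.
case: k => [ij|ik]; rewrite /phi/=.
  by rewrite gibbsZ; [rewrite mxE|exact: phi_obs|exact: obs_gram].
have E (M : 'M[R]_(N, K)) : (M *m s) ik.1 ik.2 = \sum_j s j ik.2 * M ik.1 j.
  by rewrite mxE; apply: eq_bigr => j _; rewrite mulrC.
rewrite E (_ : (fun w => _) = (fun w => \sum_j s j ik.2 * xi w ik.1 j)); last first.
  by apply/funext => w; exact: E.
rewrite gibbs_sum; last 2 first.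
- exact: phi_obs.
- by move=> j; apply: obsZ; exact: xi_obs.
apply: eq_bigr => j _; rewrite gibbsZ ?mxE//; exact: phi_obs.
Qed.

Lemma gibbs_covE al be : obs al -> obs be ->
  cov al be y = avg (fun w => (al w - avg al y) * be w) y.
Proof.
move=> oa ob; have op := phi_obs sg0 s0.
have -> : (fun w => (al w - avg al y) * be w) = (fun w => al w * be w - avg al y * be w).
  by apply/funext => w; rewrite mulrBl.
by rewrite gibbsB// ?gibbsZ//; [exact: obsM|exact: obsZ].
Qed.

Lemma cov_phi al sg s k : obs al -> cov al (fun w => phi sg s w k) y =
  match k with
  | inl ij => sg * cov_gram al ij.1 ij.2
  | inr ik => (cov_mx al *m s) ik.1 ik.2
  end.
Proof.
move=> oa; have op := phi_obs sg0 s0.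
set ca := fun w => al w - avg al y.
have oc : obs ca by apply: obsB => //; exact: obs_cst.
case: k => [ij|ik]; rewrite /phi/=.
  have og := obs_gram ij.1 ij.2; have osg := obsZ sg og.
  rewrite mxE !gibbs_covE// -gibbsZ//; last exact: obsM.
  by congr (gibbs _ _ _ _); apply/funext => w; rewrite mulrCA.
rewrite mxE gibbs_covE//; last exact: obs_mulmxr.
have -> : (fun w => (al w - avg al y) * (xi w *m s) ik.1 ik.2) =
    (fun w => \sum_j s j ik.2 * (ca w * xi w ik.1 j)).
  apply/funext => w; rewrite mxE mulr_sumr; apply: eq_bigr => j _.
  by rewrite /ca; ring.
rewrite gibbs_sum//; last by move=> j; apply: obsZ; exact: obsM.
apply: eq_bigr => j _; rewrite gibbsZ//; last exact: obsM.
by rewrite mxE gibbs_covE// mulrC.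
Qed.

Lemma sum_gibbs_phi sg s sg' s' :
  \sum_k avg (fun w => phi sg s w k) y * avg (fun w => phi sg' s' w k) y =
  sg * sg' * mxdot mean_gram mean_gram + mxdot (mean_mx *m s) (mean_mx *m s').
Proof.
rewrite sum_index !mxdotE mulr_sumr; congr (_ + _); apply: eq_bigr => i _.
  by rewrite mulr_sumr; apply: eq_bigr => j _; rewrite !gibbs_phi/=; ring.
by apply: eq_bigr => j _; rewrite !gibbs_phi.
Qed.

Lemma sum_cov_phi al be sg s sg' s' : obs al -> obs be ->
  \sum_k cov al (fun w => phi sg s w k) y * cov be (fun w => phi sg' s' w k) y =
  sg * sg' * mxdot (cov_gram al) (cov_gram be)
    + mxdot (cov_mx al *m s) (cov_mx be *m s').
Proof.
move=> oa ob; rewrite sum_index !mxdotE mulr_sumr; congr (_ + _); apply: eq_bigr => i _.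
  by rewrite mulr_sumr; apply: eq_bigr => j _; rewrite !cov_phi//=; ring.
by apply: eq_bigr => j _; rewrite !cov_phi.
Qed.

End Averages.
End Model.

(** * Functionals of the coefficients of the channel *)

Section Calculus.
Context {R : realType}.

Lemma mean_value_bound (f f' : R -> R) (c : R) :
  (forall e : R, 0 <= e <= 1 -> is_derive e 1 f (f' e)) ->
  (forall e, 0 <= e <= 1 -> `|f' e| <= c) -> `|f 1 - f 0| <= c.
Proof.
move=> df fc; have [||e e01 ->] := @MVT_segment R f f' 0 1 ler01.
- by move=> e; rewrite in_itv/= => /andP[e0 e1]; apply: df; rewrite !ltW.
- apply: derivable_within_continuous => e; rewrite in_itv/= => e01.
  by have D := df e e01; exact: ex_derive.
by rewrite subr0 mulr1; apply: fc; move: e01; rewrite in_itv.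
Qed.

(** A quadratic Taylor estimate on a set gives the derivative within this set. *)
Lemma cvg_quadratic (f : R -> R) (D : set R) (d C r : R) : 0 < r -> 0 <= C ->
  (forall t, D t -> `|t| < r -> `|f t - f 0 - t * d| <= C * t ^+ 2) ->
  (fun t => t^-1 * (f t - f 0)) @ within D 0^' --> d.
Proof.
move=> r0 C0 H; apply/cvgrPdist_le => e e0.
have C1 : 0 < C + 1 by rewrite ltr_wpDl.
have ec : 0 < Num.min r (e / (C + 1)) by rewrite lt_min r0 divr_gt0.
have n1 := @nbhs_dnbhs_neq R (0 : R).
have n2 := @dnbhs0_lt R R _ ec.
rewrite near_withinE; apply: filterS2 n1 n2 => t t0 tr Dt.
move: tr; rewrite lt_min => /andP[tr te].
have tp : 0 < `|t| by rewrite normr_gt0.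
rewrite -(ler_pM2l tp) -normrM mulrBr mulrA divff// mul1r -normrN opprB.
apply: le_trans (H t Dt tr) _.
rewrite -[t ^+ 2]real_normK ?num_real// expr2 mulrCA ler_wpM2l//.
have := ltW te; rewrite ler_pdivlMr// => tC.
by apply: le_trans tC; rewrite mulrC ler_wpM2l// lerDl.
Qed.

Lemma der_quadratic (f : R -> R) (d C r : R) : 0 < r -> 0 <= C ->
  (forall t, `|t| < r -> `|f t - f 0 - t * d| <= C * t ^+ 2) ->
  is_derive (0 : R) 1 f d.
Proof.
move=> r0 C0 H.
have : (fun t => t^-1 * (f t - f 0)) @ within setT 0^' --> d.
  by apply: (@cvg_quadratic f setT d C r) => // t _; exact: H.
have -> : within setT (0 : R)^' = 0^'.
  apply/seteqP; split => A; rewrite /within/= => nA.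
    by apply: filterS nA => t; apply.
  by apply: filterS nA => t At _.
move=> Hc.
have {}Hc : (fun t => t^-1 *: (f (t *: (1 : R) + 0) - f 0)) @ 0^' --> d.
  by apply: cvg_trans Hc; apply: near_eq_cvg; apply: nearW => t; rewrite addr0 [_ *: 1]mulr1.
apply: DeriveDef; first by apply/cvg_ex; exists d.
exact/cvg_lim.
Qed.

(** The errors of the regularization [h + (e ^+ 2)%:M] are of order [e]. *)
Lemma le_limit_sqrt (x y c : R) :
  (forall e, 0 < e <= 1 -> x <= y + c * e) -> x <= y.
Proof.
move=> H; apply/ler_addgt0Pr => e e0.
have [c0|c0] := lerP c 0.
  have := H 1; rewrite ltr01 lexx => /(_ isT) /le_trans; apply.
  by rewrite lerD2l mulr1 (le_trans c0)// ltW.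
pose d := Num.min 1 (e / c).
have d0 : 0 < d by rewrite lt_min ltr01 divr_gt0.
have d1 : d <= 1 by rewrite ge_min lexx.
have d01 : 0 < d <= 1 by rewrite d0 d1.
apply: le_trans (H d d01) _.
rewrite lerD2l -[leRHS](divfK (lt0r_neq0 c0)) mulrC ler_wpM2r ?(ltW c0)//.
by rewrite ge_min lexx orbT.
Qed.

End Calculus.

Section CoefLipschitz.
Context {R : realType} {K : nat}.
Implicit Types (J : R -> 'M[R]_K -> R) (h k a s : 'M[R]_K).

(** The derivative is controlled by those of [sg ^+ 2 / 2] and [s *m s], that is by
    the increments of [t] and [h], even where [sg] and [s] themselves are not
    differentiable functions of [t] and [h]. *)
Definition coef_lipschitz (c : R) J : Prop :=
  forall (sg dsg : R -> R) (s ds : R -> 'M[R]_K) (a r B : R),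
  coef_path sg dsg s ds a r B ->
  exists2 d, is_derive a 1 (fun e => J (sg e) (s e)) d &
    `|d| <= c * (`|sg a * dsg a| + fnorm (s a *m ds a + ds a *m s a)).

Lemma sqrt_path h a (sg : R) : posdef h -> sym_mx a -> exists r B,
  coef_path (fun=> sg) (fun=> 0) (fun e => psd_sqrt (h + e *: a))
    (fun e => lyapunov (psd_sqrt (h + e *: a)) a) 0 r B.
Proof.
move=> hp sa; have [r [r0 H]] := lyapunov_bounded_near hp sa.
pose B := `|sg| + coercivity h * fnorm a + (fnorm (psd_sqrt h) + 1).
have c0 := coercivity_ge0 h; have a0 := fnorm_ge0 a.
have s0 := fnorm_ge0 (psd_sqrt h).
have ca : 0 <= coercivity h * fnorm a by exact: mulr_ge0.
have sg0 : 0 <= `|sg| by [].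
exists r, B; split=> //.
- by rewrite /B; lra.
- by move=> e _; rewrite normr0 /B; split; lra.
- by move=> e; rewrite subr0 => /H[_ [h1 h2]]; rewrite /B; split; lra.
- by move=> e _; exact: der_cst.
- move=> e; rewrite subr0 => er i j; have [kp _] := H e er.
  set k := h + e *: a in kp *.
  apply: (@der_shift _ _ e) => //.
  have E t : h + (e + t) *: a = k + t *: a by rewrite scalerDl addrA.
  under eq_fun do rewrite E.
  have [r1 [r10 H1]] := lyapunov_bounded_near kp sa.
  pose C := coercivity k ^+ 3 * fnorm a ^+ 2.
  have C0 : 0 <= C by rewrite mulr_ge0 ?sqr_ge0// exprn_ge0// coercivity_ge0.
  have T t : `|t| < r1 -> `|psd_sqrt (k + t *: a) i j - psd_sqrt k i j
      - t * lyapunov (psd_sqrt k) a i j| <= C * t ^+ 2.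
    move=> /H1[/posdef_psd kt _]; apply: le_trans _ (psd_sqrt_taylor kp kt).
    apply: le_trans _ (entry_le_fnorm _ i j).
    by rewrite !mxE.
  apply: (@der_quadratic _ (fun t => psd_sqrt (k + t *: a) i j) _ C r1) => // t.
  by rewrite scale0r addr0; exact: T.
- move=> e; rewrite subr0 => er; have [kp _] := H e er; split.
    exact: (psd_sym (psd_sqrt_psd (posdef_psd kp))).
  exact: lyapunov_sym.
Qed.

Section Functional.
Variables (c : R) (J : R -> 'M[R]_K -> R).
Hypothesis c0 : 0 <= c.
Hypothesis cJ : coef_lipschitz c J.

Lemma straight_path (B sg0 sg1 : R) s0 s1 (e : R) : 0 <= e <= 1 ->
  `|sg0| <= B -> `|sg1| <= B -> fnorm s0 <= B -> fnorm s1 <= B ->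
  s0^T = s0 -> s1^T = s1 ->
  coef_path (fun t => sg0 + t * (sg1 - sg0)) (fun=> sg1 - sg0)
    (fun t => s0 + t *: (s1 - s0)) (fun=> s1 - s0) e 1 (5 * B).
Proof.
move=> /andP[e0 e1] b0 b1 B0 B1 y0 y1.
have Bp : 0 <= B by exact: le_trans (normr_ge0 sg0) b0.
have d1 : `|sg1 - sg0| <= 2 * B by have := ler_normB sg1 sg0; lra.
have d2 : fnorm (s1 - s0) <= 2 * B by have := fnormB s1 s0; lra.
have t2 t : `|t - e| < 1 -> `|t| <= 2.
  by rewrite ltr_norml ler_norml => /andP[? ?]; apply/andP; split; lra.
split=> //.
- by rewrite mulr_ge0.
- move=> t /t2 tt; split; last by lra.
  apply: le_trans (ler_normD _ _) _; rewrite normrM.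
  by have := ler_pM (normr_ge0 _) (normr_ge0 _) tt d1; lra.
- move=> t /t2 tt; split; last by lra.
  apply: le_trans (fnormD _ _) _; rewrite fnormZ.
  by have := ler_pM (normr_ge0 _) (fnorm_ge0 _) tt d2; lra.
- move=> t _; apply: (der_eq (derD (der_cst sg0 t) (derM (der_id t) (der_cst (sg1 - sg0) t)))).
  by rewrite mulr0 addr0 mul1r add0r.
- move=> t _ i j; under eq_fun do rewrite !mxE; rewrite !mxE.
  apply: (der_eq (derD (der_cst (s0 i j) t) (derM (der_id t) (der_cst (s1 i j - s0 i j) t)))).
  by rewrite mulr0 addr0 mul1r add0r.
- have y10 : (s1 - s0)^T = s1 - s0 by rewrite linearB/= y0 y1.
  by move=> t _; rewrite linearD/= linearZ/= y10 y0.
Qed.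

(** Along straight lines the functional is Lipschitz in the coefficients
    themselves, even where these are degenerate. *)
Lemma coef_lipschitz_straight (B sg0 sg1 : R) s0 s1 :
  `|sg0| <= B -> `|sg1| <= B -> fnorm s0 <= B -> fnorm s1 <= B ->
  s0^T = s0 -> s1^T = s1 ->
  `|J sg1 s1 - J sg0 s0| <= c * (3 * B * `|sg1 - sg0| + 6 * B * fnorm (s1 - s0)).
Proof.
move=> b0 b1 B0 B1 y0 y1; set sgp := fun t => sg0 + t * (sg1 - sg0).
set sp := fun t => s0 + t *: (s1 - s0).
have Bp : 0 <= B by exact: le_trans (normr_ge0 sg0) b0.
have /choice[f' f'P] : forall e : R, exists d : R, 0 <= e <= 1 ->
    is_derive e 1 (fun t => J (sgp t) (sp t)) d /\
    `|d| <= c * (3 * B * `|sg1 - sg0| + 6 * B * fnorm (s1 - s0)).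
  move=> e; have [e01|] := boolP (0 <= e <= 1); last by exists 0.
  have [d dd dc] := cJ (straight_path e01 b0 b1 B0 B1 y0 y1).
  exists d => _; split=> //; apply: le_trans dc _; rewrite ler_wpM2l//.
  have /andP[e0 e1] := e01.
  have d1 : `|sg1 - sg0| <= 2 * B by have := ler_normB sg1 sg0; lra.
  have d2 : fnorm (s1 - s0) <= 2 * B by have := fnormB s1 s0; lra.
  have E1 : `|sgp e| <= 3 * B.
    apply: le_trans (ler_normD _ _) _; rewrite normrM (ger0_norm e0).
    by have := ler_pM e0 (normr_ge0 _) e1 d1; lra.
  have E2 : fnorm (sp e) <= 3 * B.
    apply: le_trans (fnormD _ _) _; rewrite fnormZ (ger0_norm e0).
    by have := ler_pM e0 (fnorm_ge0 _) e1 d2; lra.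
  apply: lerD; first by rewrite normrM ler_wpM2r.
  apply: le_trans (fnormD _ _) _.
  have M1 := fnormM (sp e) (s1 - s0); have M2 := fnormM (s1 - s0) (sp e).
  have := ler_wpM2r (fnorm_ge0 (s1 - s0)) E2.
  by rewrite -/(sp e); lra.
have := @mean_value_bound _ (fun t => J (sgp t) (sp t)) f'
  (c * (3 * B * `|sg1 - sg0| + 6 * B * fnorm (s1 - s0))).
have -> : sgp 1 = sg1 by rewrite /sgp mul1r addrC subrK.
have -> : sp 1 = s1 by rewrite /sp scale1r addrC subrK.
have -> : sgp 0 = sg0 by rewrite /sgp mul0r addr0.
have -> : sp 0 = s0 by rewrite /sp scale0r addr0.
by apply=> e e01; have [] := f'P e e01.
Qed.

Lemma sqrt_addscalar_close (sg : R) h : psd h -> exists2 C, 0 <= C &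
  forall e, 0 < e <= 1 ->
  `|J sg (psd_sqrt (h + (e ^+ 2)%:M)) - J sg (psd_sqrt h)| <= C * e.
Proof.
move=> hp; pose q : R := K%:R ^+ 3 + 1.
have q1 : 1 <= q by rewrite lerDr exprn_ge0.
pose B := `|sg| + fnorm (psd_sqrt h) + q.
have s0 := fnorm_ge0 (psd_sqrt h); have g0 : 0 <= `|sg| by [].
have B0 : 0 <= B by rewrite /B; lra.
exists (c * (6 * B * q)).
  by rewrite !mulr_ge0//; lra.
move=> e /andP[e0 e1].
have kp : psd (h + (e ^+ 2)%:M) by apply: psd_addscalar => //; exact: sqr_ge0.
have de : fnorm (psd_sqrt (h + (e ^+ 2)%:M) - psd_sqrt h) <= q * e.
  apply: le_sqr; first by rewrite mulr_ge0 ?(ltW e0)//; lra.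
  apply: le_trans (psd_sqrt_addscalar hp _) _; first by rewrite exprn_gt0.
  rewrite exprMn ler_wpM2r ?sqr_ge0//.
  have : 0 <= K%:R ^+ 3 :> R by rewrite exprn_ge0.
  by rewrite /q; nra.
have := @coef_lipschitz_straight B sg sg (psd_sqrt h) (psd_sqrt (h + (e ^+ 2)%:M)).
rewrite subrr normr0 mulr0 add0r => H; apply: le_trans (H _ _ _ _ _ _) _.
- by rewrite /B; lra.
- by rewrite /B; lra.
- by rewrite /B; lra.
- rewrite -[psd_sqrt (h + _)](subrK (psd_sqrt h)); apply: le_trans (fnormD _ _) _.
  have : q * e <= q by rewrite ler_piMr//; lra.
  by rewrite /B; lra.
- exact: (psd_sym (psd_sqrt_psd hp)).
- exact: (psd_sym (psd_sqrt_psd kp)).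
by rewrite -!mulrA ler_wpM2l// ler_wpM2l// ler_wpM2l.
Qed.

Lemma posdef_convex h k (e : R) : posdef h -> posdef k -> 0 <= e <= 1 ->
  posdef (h + e *: (k - h)).
Proof.
move=> [hs hp] [ks kp] /andP[e0 e1]; split.
  have skh : (k - h)^T = k - h by rewrite linearB/= hs ks.
  by rewrite /sym_mx/= linearD/= linearZ/= skh hs.
move=> v v0; rewrite quadE mulmxDl -scalemxAl mulmxBl mxdotDr mxdotZr mxdotBr.
rewrite -!quadE; have a1 := hp v v0; have a2 := kp v v0.
have [->|en] := eqVneq e 0; first by rewrite mul0r addr0.
have ep : 0 < e by rewrite lt_def en e0.
have e1' : 0 <= 1 - e by lra.
by have := mulr_ge0 e1' (ltW a1); have := mulr_gt0 ep a2; lra.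
Qed.

Lemma posdef_is_derive (sg : R) h a (e : R) : posdef (h + e *: a) -> sym_mx a ->
  exists2 d, is_derive e 1 (fun t => J sg (psd_sqrt (h + t *: a))) d &
    `|d| <= c * fnorm a.
Proof.
move=> kp sa; have [r [B P]] := sqrt_path sg kp sa.
have [d dd dc] := cJ P; exists d.
  apply: (@der_shift _ _ e) => //.
  have E t : h + (e + t) *: a = (h + e *: a) + t *: a by rewrite scalerDl addrA.
  by under eq_fun do rewrite E.
by move: dc; rewrite mulr0 normr0 add0r scale0r addr0 addrC lyapunovE.
Qed.

Lemma posdef_lipschitz (sg : R) h k : posdef h -> posdef k ->
  `|J sg (psd_sqrt k) - J sg (psd_sqrt h)| <= c * fnorm (k - h).
Proof.
move=> hp kp; have skh : sym_mx (k - h).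
  by case: hp kp => hs _ [ks _]; rewrite /sym_mx/= linearB/= hs ks.
have /choice[f' f'P] : forall e : R, exists d : R, 0 <= e <= 1 ->
    is_derive e 1 (fun t => J sg (psd_sqrt (h + t *: (k - h)))) d /\
    `|d| <= c * fnorm (k - h).
  move=> e; have [e01|] := boolP (0 <= e <= 1); last by exists 0.
  have [d dd dc] := posdef_is_derive sg (posdef_convex hp kp e01) skh.
  by exists d.
have := @mean_value_bound _ (fun t => J sg (psd_sqrt (h + t *: (k - h)))) f'
  (c * fnorm (k - h)).
rewrite scale1r scale0r addr0 [h + _]addrC subrK.
by apply=> e e01; have [] := f'P e e01.
Qed.

(** The bound extends to the boundary of the cone by adding a multiple of the
    identity. *)
Lemma psd_lipschitz (sg : R) h k : psd h -> psd k ->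
  `|J sg (psd_sqrt k) - J sg (psd_sqrt h)| <= c * fnorm (k - h).
Proof.
move=> hp kp; have [C1 _ H1] := sqrt_addscalar_close sg hp.
have [C2 _ H2] := sqrt_addscalar_close sg kp.
apply: (@le_limit_sqrt _ _ _ (C1 + C2)) => e e01; have /andP[e0 _] := e01.
have ep : 0 < e ^+ 2 by rewrite exprn_gt0.
have := posdef_lipschitz sg (posdef_addscalar hp ep) (posdef_addscalar kp ep).
rewrite [in X in _ <= X]opprD addrACA subrr addr0.
have := H1 e e01; have := H2 e e01.
move: (J sg (psd_sqrt (h + _))) (J sg (psd_sqrt (k + _))) => p q.
rewrite !ler_norml => /andP[? ?] /andP[? ?] /andP[? ?]; apply/andP; split; lra.
Qed.

End Functional.
End CoefLipschitz.

(** * The entropy and its first derivatives *)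

Lemma fnorm_le_entries {R : realType} p q (A : 'M[R]_(p, q)) (c : R) : 0 <= c ->
  (forall i j, `|A i j| <= c) -> fnorm A <= c * (p * q)%:R.
Proof.
move=> c0 Ac; apply: le_sqr; first by rewrite mulr_ge0.
rewrite fnorm_sqrE; apply: (@le_trans _ _ (\sum_(i < p) \sum_(j < q) c ^+ 2)).
  apply: ler_sum => i _; apply: ler_sum => j _.
  by rewrite -[leLHS]real_normK ?num_real// lerXn2r ?nnegrE.
have -> : \sum_(i < p) \sum_(j < q) c ^+ 2 = c ^+ 2 * (p * q)%:R :> R.
  by rewrite !sumr_const !card_ord -mulrnA mulr_natr mulnC.
rewrite exprMn ler_wpM2l ?sqr_ge0// -natrX ler_nat -mulnn.
by case: (p * q)%N => // m; rewrite leq_pmulr.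
Qed.

Section Energy.
Context {R : realType} {N K : nat}.
Local Notation I := (('I_N * 'I_N) + ('I_N * 'I_K))%type.
Context {dX} {X : measurableType dX} (prior : probability X R)
  (xi : X -> 'M[R]_(N, K)) (Bx : R).
Hypothesis Bx0 : 0 <= Bx.
Hypothesis xi_obs : forall i j, obs (fun w => xi w i j).
Hypothesis xi_bound : forall w, fnorm (xi w) <= Bx.
Context {dG} {G : measurableType dG} (gam : probability G R) (g : G -> I -> R).
Hypothesis gv : gaussian_vector gam g.
Implicit Types (sg : R) (s h a : 'M[R]_K) (y : I -> R) (al be : X -> R).

Local Notation E := (expect gam g).
Local Notation Z := (partition_function prior).

(** The mean of a function of the observation: the factor [Z] is the density of
    the observation with respect to pure noise. *)
Definition EE sg s (f : (I -> R) -> R) : R := E (fun y => Z (phi xi sg s) y * f y).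

Definition entropy sg s : R := EE sg s (fun y => ln (Z (phi xi sg s) y)).

Definition mean_prod al be sg s : R :=
  EE sg s (fun y => gibbs prior (phi xi sg s) al y * gibbs prior (phi xi sg s) be y).

Local Notation mm sg s y := (mean_mx prior xi sg s y).
Local Notation mg sg s y := (mean_gram prior xi sg s y).

Let op sg s : obs_features (phi xi sg s). Proof. exact: phi_obs. Qed.

Section FixedCoefficients.
Variables (sg : R) (s : 'M[R]_K).
Local Notation avg := (gibbs prior (phi xi sg s)).

Let tz : tame (Z (phi xi sg s)). Proof. exact: tame_partition. Qed.

Lemma EE_D f f' : tame f -> tame f' ->
  EE sg s (fun y => f y + f' y) = EE sg s f + EE sg s f'.
Proof.
move=> tf tf'; rewrite -(expectD gv); [|exact: tameM..].
by apply: eq_expect => y; rewrite mulrDr.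
Qed.

Lemma EE_Z k f : tame f -> EE sg s (fun y => k * f y) = k * EE sg s f.
Proof.
move=> tf; rewrite -(expectZ gv); last exact: tameM.
by apply: eq_expect => y; rewrite mulrCA.
Qed.

Lemma EE_B f f' : tame f -> tame f' ->
  EE sg s (fun y => f y - f' y) = EE sg s f - EE sg s f'.
Proof.
move=> tf tf'; rewrite -(expectB gv); [|exact: tameM..].
by apply: eq_expect => y; rewrite mulrBr.
Qed.

Lemma EE_sum (J : Type) (r : seq J) f : (forall j, tame (f j)) ->
  EE sg s (fun y => \sum_(j <- r) f j y) = \sum_(j <- r) EE sg s (f j).
Proof.
move=> tf; rewrite -(expect_sum gv); last by move=> j; exact: tameM.
by apply: eq_expect => y; rewrite mulr_sumr.
Qed.

Lemma EE_le f f' : tame f -> tame f' -> (forall y, f y <= f' y) ->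
  EE sg s f <= EE sg s f'.
Proof.
move=> tf tf' ff'; apply: (expect_le gv); [exact: tameM..|move=> y].
by rewrite ler_wpM2l// ltW// partition_function_gt0.
Qed.

Lemma eq_EE f f' : f =1 f' -> EE sg s f = EE sg s f'.
Proof. by move=> ff'; apply: eq_expect => y; rewrite ff'. Qed.

Lemma EE_cst k : EE sg s (fun=> k) = k.
Proof.
have H := planted_mean prior gv (op sg s) (obs_cst (1 : R)) (tame_cst k).
rewrite /EE -[LHS]H; under eq_Rintegral do rewrite mul1r.
by rewrite Rintegral_cst//= [X in _ * fine X]probability_setT mulr1.
Qed.

Lemma EE_abs_le f c : tame f -> (forall y, `|f y| <= c) -> `|EE sg s f| <= c.
Proof.
move=> tf fc; rewrite ler_norml; apply/andP; split.
  rewrite -[leLHS]EE_cst; apply: EE_le => //; first exact: tame_cst.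
  by move=> y; have := fc y; rewrite ler_norml => /andP[].
rewrite -[leRHS]EE_cst; apply: EE_le => //; first exact: tame_cst.
by move=> y; have := fc y; rewrite ler_norml => /andP[].
Qed.

Lemma tame_avg al : obs al -> tame (avg al).
Proof. exact: tame_gibbs. Qed.

Lemma tame_cov al be : obs al -> obs be -> tame (gibbs_cov prior (phi xi sg s) al be).
Proof.
by move=> oa ob; apply: tameB; [apply: tame_avg; exact: obsM|apply: tameM; exact: tame_avg].
Qed.

Lemma tame_mxdot p q (A B : (I -> R) -> 'M[R]_(p, q)) :
  (forall i j, tame (fun y => A y i j)) -> (forall i j, tame (fun y => B y i j)) ->
  tame (fun y => mxdot (A y) (B y)).
Proof.
move=> tA tB; under eq_fun do rewrite mxdotE.
by apply: tame_sum => i; apply: tame_sum => j; exact: tameM.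
Qed.

Lemma tame_mulmx p q r (A : (I -> R) -> 'M[R]_(p, q)) (B : (I -> R) -> 'M[R]_(q, r)) i j :
  (forall i j, tame (fun y => A y i j)) -> (forall i j, tame (fun y => B y i j)) ->
  tame (fun y => (A y *m B y) i j).
Proof.
move=> tA tB; under eq_fun do rewrite mxE.
by apply: tame_sum => k; exact: tameM.
Qed.

Lemma tame_mean_mx i j : tame (fun y => mm sg s y i j).
Proof. by under eq_fun do rewrite mxE; exact: tame_avg. Qed.

Lemma tame_mean_gram i j : tame (fun y => mg sg s y i j).
Proof. by under eq_fun do rewrite mxE; apply: tame_avg; exact: obs_gram. Qed.

Lemma tame_cov_mx al i j : obs al -> tame (fun y => cov_mx prior xi sg s y al i j).
Proof. by move=> oa; under eq_fun do rewrite mxE; exact: tame_cov. Qed.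

Lemma tame_cov_gram al i j : obs al -> tame (fun y => cov_gram prior xi sg s y al i j).
Proof.
by move=> oa; under eq_fun do rewrite mxE; apply: tame_cov => //; exact: obs_gram.
Qed.

Lemma cov_abs_le al be y (La Lb : R) : obs al -> obs be ->
  (forall w, `|al w| <= La) -> (forall w, `|be w| <= Lb) ->
  `|gibbs_cov prior (phi xi sg s) al be y| <= 2 * (La * Lb).
Proof.
move=> oa ob aL bL; apply: le_trans (ler_normB _ _) _.
have h1 : `|avg (fun w => al w * be w) y| <= La * Lb.
  by apply: gibbs_abs_le => //; [exact: obsM|move=> w; rewrite normrM ler_pM].
have h2 : `|avg al y * avg be y| <= La * Lb.
  by rewrite normrM ler_pM//; exact: gibbs_abs_le.
lra.
Qed.

Lemma xi_entry w i j : `|xi w i j| <= Bx.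
Proof. exact: le_trans (entry_le_fnorm _ _ _) (xi_bound w). Qed.

Lemma gram_entry w i j : `|(xi w *m (xi w)^T) i j| <= Bx ^+ 2.
Proof.
apply: le_trans (entry_le_fnorm _ _ _) _; apply: le_trans (fnormM _ _) _.
by rewrite fnorm_tr expr2 ler_pM ?fnorm_ge0.
Qed.

End FixedCoefficients.

Section AlongPath.
Context (sg dsg : R -> R) (s ds : R -> 'M[R]_K) (a r B : R).
Hypothesis P : coef_path sg dsg s ds a r B.

Let a_in : `|a - a| < r. Proof. by case: P => r0 *; rewrite subrr normr0. Qed.

(** The heat equation, where symmetry of the coefficients turns the contraction of
    the features into the derivatives of [sg ^+ 2] and [s *m s]. *)
Lemma entropy_path_derive :
  is_derive a 1 (fun e => entropy (sg e) (s e))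
    (EE (sg a) (s a) (fun y => sg a * dsg a * mxdot (mg (sg a) (s a) y) (mg (sg a) (s a) y)
      + 2^-1 * mxdot ((mm (sg a) (s a) y)^T *m mm (sg a) (s a) y)
          (s a *m ds a + ds a *m s a))).
Proof.
apply: (der_eq (entropy_derive prior gv (coef_feature_path Bx0 xi_obs xi_bound P))).
apply: eq_expect => y; congr (_ * _).
rewrite sum_gibbs_phi//; congr (_ + _).
have [sT dT] := coef_sym P a_in.
set b := mm _ _ y.
rewrite mxdotDr.
have -> : mxdot (b^T *m b) (s a *m ds a) = mxdot (b *m s a) (b *m ds a).
  by rewrite mxdot_mull trmxK mulmxA (mxdotC (b *m s a)) mxdot_mulr dT.
have -> : mxdot (b^T *m b) (ds a *m s a) = mxdot (b *m s a) (b *m ds a).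
  by rewrite mxdot_mull trmxK mulmxA mxdot_mulr sT.
by field.
Qed.

Lemma mean_prod_path_derive al be : obs al -> obs be ->
  is_derive a 1 (fun e => mean_prod al be (sg e) (s e))
    (EE (sg a) (s a) (fun y => 2 * (sg a * dsg a) *
        mxdot (cov_gram prior xi (sg a) (s a) y al) (cov_gram prior xi (sg a) (s a) y be)
      + mxdot (cov_mx prior xi (sg a) (s a) y al)
          (cov_mx prior xi (sg a) (s a) y be *m (s a *m ds a + ds a *m s a)))).
Proof.
move=> oa ob.
apply: (der_eq (overlap_derive prior gv (coef_feature_path Bx0 xi_obs xi_bound P) oa ob)).
apply: eq_expect => y; congr (_ * _).
have [sT dT] := coef_sym P a_in.
rewrite big_split/= !sum_cov_phi//.
set ca := cov_mx _ _ _ _ _ al; set cb := cov_mx _ _ _ _ _ be.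
rewrite mulmxDr mxdotDr !mulmxA.
have -> : mxdot (ca *m ds a) (cb *m s a) = mxdot ca (cb *m s a *m ds a).
  by rewrite mxdot_mulr dT.
have -> : mxdot (ca *m s a) (cb *m ds a) = mxdot ca (cb *m ds a *m s a).
  by rewrite mxdot_mulr sT.
ring.
Qed.

End AlongPath.

Section Lipschitz.

Let mxdot_bound p q (A B : 'M[R]_(p, q)) (a b : R) : fnorm A <= a -> fnorm B <= b ->
  `|mxdot A B| <= a * b.
Proof.
by move=> Aa Bb; apply: le_trans (mxdot_le _ _) _; rewrite ler_pM ?fnorm_ge0.
Qed.

Lemma mean_prod_lipschitz al be : obs al -> obs be ->
  exists2 c, 0 <= c & coef_lipschitz c (mean_prod al be).
Proof.
move=> oa ob; have [[_ [La aL]] [_ [Lb bL]]] := (oa, ob).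
have aL' w : `|al w| <= `|La| by exact: le_trans (aL w) (ler_norm _).
have bL' w : `|be w| <= `|Lb| by exact: le_trans (bL w) (ler_norm _).
pose ga (L : R) := 2 * (`|L| * Bx ^+ 2) * (N * N)%:R : R.
pose ma (L : R) := 2 * (`|L| * Bx) * (N * K)%:R : R.
have ga0 L : 0 <= ga L by rewrite !mulr_ge0// sqr_ge0.
have ma0 L : 0 <= ma L by rewrite !mulr_ge0.
exists (2 * (ga La * ga Lb) + ma La * ma Lb).
  by rewrite addr_ge0// !mulr_ge0.
move=> sg dsg s ds a r B P; eexists; first exact: (mean_prod_path_derive P oa ob).
set m := s a *m ds a + ds a *m s a; set sd := sg a * dsg a.
have H (al' : X -> R) (L : R) y : obs al' -> (forall w, `|al' w| <= `|L|) ->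
    fnorm (cov_gram prior xi (sg a) (s a) y al') <= ga L /\
    fnorm (cov_mx prior xi (sg a) (s a) y al') <= ma L.
  move=> oa' aL1; split; apply: fnorm_le_entries.
  - by rewrite !mulr_ge0// sqr_ge0.
  - move=> i j; rewrite mxE; apply: cov_abs_le => //; first exact: obs_gram.
    by move=> w; exact: gram_entry.
  - by rewrite !mulr_ge0.
  - by move=> i j; rewrite mxE; apply: cov_abs_le => // w; exact: xi_entry.
apply: EE_abs_le.
  apply: tameD.
    apply: tameM; first exact: tame_cst.
    by apply: tame_mxdot => i j; exact: tame_cov_gram.
  apply: tame_mxdot => i j; first exact: tame_cov_mx.
  by apply: tame_mulmx => k l; [exact: tame_cov_mx|exact: tame_cst].
move=> y; have [ga1 ma1] := H _ _ y oa aL'; have [gb1 mb1] := H _ _ y ob bL'.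
have h1 := mxdot_bound ga1 gb1.
have h2 : fnorm (cov_mx prior xi (sg a) (s a) y be *m m) <= ma Lb * fnorm m.
  by apply: le_trans (fnormM _ _) _; rewrite ler_wpM2r ?fnorm_ge0.
have h3 := mxdot_bound ma1 h2.
apply: le_trans (ler_normD _ _) _.
have h4 : `|2 * sd * mxdot (cov_gram prior xi (sg a) (s a) y al) (cov_gram prior xi (sg a) (s a) y be)| <= 2 * (ga La * ga Lb) * `|sd|.
  rewrite normrM normrM (ger0_norm (_ : 0 <= 2))// mulrAC ler_wpM2r//.
  by rewrite ler_wpM2l.
have p1 : 0 <= 2 * (ga La * ga Lb) * fnorm m by rewrite !mulr_ge0 ?fnorm_ge0.
have p2 : 0 <= ma La * ma Lb * `|sd| by rewrite !mulr_ge0.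
by move: h3 h4 p1 p2; lra.
Qed.

Lemma entropy_lipschitz : exists2 c, 0 <= c & coef_lipschitz c entropy.
Proof.
pose ga := Bx ^+ 2 * (N * N)%:R : R; pose ma := Bx * (N * K)%:R : R.
have ga0 : 0 <= ga by rewrite mulr_ge0// sqr_ge0.
have ma0 : 0 <= ma by rewrite mulr_ge0.
exists (ga * ga + ma * ma); first by rewrite addr_ge0// mulr_ge0.
move=> sg dsg s ds a r B P; eexists; first exact: (entropy_path_derive P).
set m := s a *m ds a + ds a *m s a; set sd := sg a * dsg a.
apply: EE_abs_le.
  apply: tameD.
    apply: tameM; first exact: tame_cst.
    by apply: tame_mxdot => i j; exact: tame_mean_gram.
  apply: tameM; first exact: tame_cst.
  apply: tame_mxdot => i j; last exact: tame_cst.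
  apply: tame_mulmx => k l; last exact: tame_mean_mx.
  by under eq_fun do rewrite mxE; exact: tame_mean_mx.
move=> y.
have g1 : fnorm (mg (sg a) (s a) y) <= ga.
  apply: fnorm_le_entries; first exact: sqr_ge0.
  move=> i j; rewrite mxE; apply: gibbs_abs_le => //; first exact: obs_gram.
  by move=> w; exact: gram_entry.
have m1 : fnorm (mm (sg a) (s a) y) <= ma.
  apply: fnorm_le_entries => // i j; rewrite mxE; apply: gibbs_abs_le => // w.
  exact: xi_entry.
have m2 : fnorm ((mm (sg a) (s a) y)^T *m mm (sg a) (s a) y) <= ma * ma.
  by apply: le_trans (fnormM _ _) _; rewrite fnorm_tr ler_pM ?fnorm_ge0.
have h1 := mxdot_bound g1 g1.
have h2 := mxdot_bound m2 (lexx (fnorm m)).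
apply: le_trans (ler_normD _ _) _.
rewrite !normrM (ger0_norm (_ : 0 <= 2^-1))// -normrM -/sd.
have h3 : `|sd| * `|mxdot (mg (sg a) (s a) y) (mg (sg a) (s a) y)| <= ga * ga * `|sd|.
  by rewrite mulrC ler_wpM2r.
have p1 : 0 <= ga * ga * fnorm m by rewrite !mulr_ge0 ?fnorm_ge0.
have p2 : 0 <= ma * ma * `|sd| by rewrite !mulr_ge0.
have p3 : 0 <= ma * ma * fnorm m by rewrite !mulr_ge0 ?fnorm_ge0.
by move: h2 h3 p1 p2 p3; lra.
Qed.

Lemma coef_lipschitz_sum (J : finType) (F : J -> R -> 'M[R]_K -> R) :
  (forall j, exists2 c, 0 <= c & coef_lipschitz c (F j)) ->
  exists2 c, 0 <= c & coef_lipschitz c (fun sg s => \sum_j F j sg s).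
Proof.
move=> FL; have /choice[c cP] : forall j, exists c, 0 <= c /\ coef_lipschitz c (F j).
  by move=> j; have [c] := FL j; exists c.
exists (\sum_j c j); first by apply: sumr_ge0 => j _; case: (cP j).
move=> sg dsg s ds a r B P.
have /choice[d dP] : forall j, exists d : R,
    is_derive a 1 (fun e => F j (sg e) (s e)) d /\
    `|d| <= c j * (`|sg a * dsg a| + fnorm (s a *m ds a + ds a *m s a)).
  by move=> j; have [_ cL] := cP j; have [d] := cL _ _ _ _ _ _ _ P; exists d.
exists (\sum_j d j); first by apply: der_sum => j; case: (dP j).
apply: le_trans (ler_norm_sum _ _ _) _; rewrite mulr_suml.
by apply: ler_sum => j _; case: (dP j).
Qed.

End Lipschitz.

Definition overlap_mean sg s : 'M[R]_K :=
  \matrix_(k, l) \sum_i mean_prod (fun w => xi w i k) (fun w => xi w i l) sg s.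

Definition square_mean sg s : R := \sum_(ij : 'I_N * 'I_N)
  mean_prod (fun w => (xi w *m (xi w)^T) ij.1 ij.2)
    (fun w => (xi w *m (xi w)^T) ij.1 ij.2) sg s.

Lemma overlap_mean_sym sg s : (overlap_mean sg s)^T = overlap_mean sg s.
Proof.
apply/matrixP => k l; rewrite !mxE; apply: eq_bigr => i _.
by apply: eq_EE => y; rewrite mulrC.
Qed.

Lemma overlap_meanE sg s (c : 'M[R]_K) : mxdot c (overlap_mean sg s) =
  EE sg s (fun y => mxdot c ((mm sg s y)^T *m mm sg s y)).
Proof.
have tmm := tame_mean_mx sg s.
have tpq i k l : tame (fun y => mm sg s y i k * mm sg s y i l) by exact: tameM.
rewrite mxdotE.
transitivity (EE sg s (fun y => \sum_k \sum_l \sum_i c k l * (mm sg s y i k * mm sg s y i l))).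
  rewrite EE_sum; last first.
    move=> k; apply: tame_sum => l; apply: tame_sum => i.
    by apply: tameM => //; exact: tame_cst.
  apply: eq_bigr => k _; rewrite EE_sum; last first.
    by move=> l; apply: tame_sum => i; apply: tameM => //; exact: tame_cst.
  apply: eq_bigr => l _; rewrite EE_sum; last first.
    by move=> i; apply: tameM => //; exact: tame_cst.
  rewrite mxE mulr_sumr; apply: eq_bigr => i _; rewrite EE_Z//.
  by congr (_ * _); apply: eq_EE => y; rewrite !mxE.
apply: eq_EE => y; rewrite mxdotE; apply: eq_bigr => k _; apply: eq_bigr => l _.
by rewrite mxE mulr_sumr; apply: eq_bigr => i _; rewrite !mxE.
Qed.

Lemma square_meanE sg s :
  square_mean sg s = EE sg s (fun y => mxdot (mg sg s y) (mg sg s y)).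
Proof.
have tmg := tame_mean_gram sg s.
transitivity (EE sg s (fun y => \sum_(ij : 'I_N * 'I_N) mg sg s y ij.1 ij.2 * mg sg s y ij.1 ij.2)).
  rewrite EE_sum; last by move=> ij; exact: tameM.
  by apply: eq_bigr => ij _; apply: eq_EE => y; rewrite !mxE.
by apply: eq_EE => y; rewrite mxdotE pair_bigA.
Qed.

Lemma square_mean_lipschitz : exists2 c, 0 <= c & coef_lipschitz c square_mean.
Proof. by apply: coef_lipschitz_sum => ij; apply: mean_prod_lipschitz; exact: obs_gram. Qed.

(** In the variable [h] the overlap is Lipschitz up to the boundary of the cone,
    although the square root is not. *)
Lemma overlap_mean_psd_lipschitz : exists2 c, 0 <= c & forall sg h k, psd h -> psd k ->
  fnorm (overlap_mean sg (psd_sqrt k) - overlap_mean sg (psd_sqrt h)) <= c * fnorm (k - h).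
Proof.
have /choice[c cP] : forall kl : 'I_K * 'I_K, exists c, 0 <= c /\
    coef_lipschitz c (fun sg s => overlap_mean sg s kl.1 kl.2).
  move=> kl; have [|c c0 cL] := @coef_lipschitz_sum 'I_N (fun i =>
      mean_prod (fun w => xi w i kl.1) (fun w => xi w i kl.2)).
    by move=> i; exact: mean_prod_lipschitz.
  exists c; split=> // sg dsg s ds a r B P; have [d dd dc] := cL _ _ _ _ _ _ _ P.
  by exists d => //; under eq_fun do rewrite mxE.
exists ((\sum_kl c kl) * (K * K)%:R).
  by rewrite mulr_ge0// sumr_ge0// => kl _; case: (cP kl).
move=> sg h k hp kp; rewrite mulrAC; apply: fnorm_le_entries.
  by rewrite mulr_ge0 ?fnorm_ge0// sumr_ge0// => kl _; case: (cP kl).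
move=> i j; have [c0 cL] := cP (i, j).
have -> : (overlap_mean sg (psd_sqrt k) - overlap_mean sg (psd_sqrt h)) i j
    = overlap_mean sg (psd_sqrt k) i j - overlap_mean sg (psd_sqrt h) i j.
  by rewrite [LHS]mxE; congr (_ + _); rewrite [LHS]mxE.
apply: le_trans (psd_lipschitz c0 cL sg hp kp) _.
rewrite ler_wpM2r ?fnorm_ge0// (bigD1 (i, j))//= lerDl sumr_ge0// => kl _.
by case: (cP kl).
Qed.

(** The Lyapunov equation for the derivative of the root replaces [s] by [h]. *)
Lemma entropy_posdef_derive sg h a (e : R) : posdef (h + e *: a) -> sym_mx a ->
  is_derive e 1 (fun t => entropy sg (psd_sqrt (h + t *: a)))
    (2^-1 * mxdot a (overlap_mean sg (psd_sqrt (h + e *: a)))).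
Proof.
move=> kp sa; have [r [B P]] := sqrt_path sg kp sa.
apply: (@der_shift _ _ e) => //.
have Et t : h + (e + t) *: a = (h + e *: a) + t *: a by rewrite scalerDl addrA.
under eq_fun do rewrite Et.
apply: (der_eq (entropy_path_derive P)).
rewrite overlap_meanE -EE_Z; last first.
  apply: tame_mxdot => i j; first exact: tame_cst.
  apply: tame_mulmx => k l; last exact: tame_mean_mx.
  by under eq_fun do rewrite mxE; exact: tame_mean_mx.
rewrite scale0r addr0; apply: eq_EE => y.
by rewrite mulr0 mul0r add0r [X in mxdot _ X]addrC lyapunovE// mxdotC.
Qed.

(** Adding a multiple of the identity makes the expansion, which holds between
    positive definite matrices, valid on the whole cone. *)
Lemma entropy_psd_taylor : exists2 C, 0 <= C & forall sg h a, psd h -> psd (h + a) ->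
  `|entropy sg (psd_sqrt (h + a)) - entropy sg (psd_sqrt h)
     - 2^-1 * mxdot a (overlap_mean sg (psd_sqrt h))| <= C * fnorm a ^+ 2.
Proof.
have [c c0 cL] := overlap_mean_psd_lipschitz.
have [c1 c10 c1L] := entropy_lipschitz.
exists c => // sg h a hp kp.
have sa : sym_mx a.
  have ks := psd_sym kp; have hs := psd_sym hp.
  have -> : a = (h + a) - h by rewrite addrC addKr.
  by rewrite /sym_mx/= linearB/= ks hs.
have [C1 _ H1] := sqrt_addscalar_close c10 c1L sg hp.
have [C2 _ H2] := sqrt_addscalar_close c10 c1L sg kp.
apply: (@le_limit_sqrt _ _ _ (C1 + C2 + fnorm a * (c * Num.sqrt K%:R))) => e e01.
have /andP[e0 e1] := e01.
have ep : 0 < e ^+ 2 by rewrite exprn_gt0.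
(* The root of [h] moves by at most a multiple of [e]. *)
set h' := h + (e ^+ 2)%:M.
have hp' : posdef h' by exact: posdef_addscalar.
have kp' : posdef (h' + a).
  by rewrite /h' addrAC; exact: posdef_addscalar.
have seg t : 0 <= t <= 1 -> posdef (h' + t *: a).
  move=> t01; have := posdef_convex hp' kp' t01.
  by rewrite [h' + a - h']addrAC subrr add0r.
have M : `|entropy sg (psd_sqrt (h' + a)) - entropy sg (psd_sqrt h')
     - 2^-1 * mxdot a (overlap_mean sg (psd_sqrt h'))| <= c * fnorm a ^+ 2.
  set X0 := 2^-1 * mxdot a (overlap_mean sg (psd_sqrt h')).
  pose f (t : R) := entropy sg (psd_sqrt (h' + t *: a)) - t * X0.
  have -> : entropy sg (psd_sqrt (h' + a)) - entropy sg (psd_sqrt h') - X0 = f 1 - f 0.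
    rewrite /f scale1r scale0r addr0.
    have aux (u v w : R) : u - v - w = (u - 1 * w) - (v - 0 * w) by ring.
    exact: aux.
  apply: (@mean_value_bound _ f
     (fun t => 2^-1 * mxdot a (overlap_mean sg (psd_sqrt (h' + t *: a))) - X0)).
    move=> t t01; apply: (der_eq (derB (entropy_posdef_derive sg (seg t t01) sa)
      (derM (der_id t) (der_cst X0 t)))).
    by rewrite mulr0 addr0 mul1r.
  move=> t t01; have /andP[t0 t1] := t01.
  have H : fnorm (overlap_mean sg (psd_sqrt (h' + t *: a)) - overlap_mean sg (psd_sqrt h'))
      <= c * (t * fnorm a).
    apply: le_trans (cL sg h' (h' + t *: a) (posdef_psd hp') (posdef_psd (seg t t01))) _.
    have -> : h' + t *: a - h' = t *: a by rewrite addrAC subrr add0r.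
    by rewrite fnormZ (ger0_norm t0).
  rewrite /X0 -mulrBr -mxdotBr normrM (ger0_norm (_ : 0 <= 2^-1))//.
  have := mxdot_le a (overlap_mean sg (psd_sqrt (h' + t *: a)) - overlap_mean sg (psd_sqrt h')).
  have := ler_wpM2l (fnorm_ge0 a) H.
  have : c * (t * fnorm a) <= c * fnorm a.
    by rewrite ler_wpM2l// ler_piMl// fnorm_ge0.
  move=> /(ler_wpM2l (fnorm_ge0 a)).
  have : 0 <= c * fnorm a ^+ 2 by rewrite mulr_ge0// sqr_ge0.
  move: (overlap_mean _ _ - _) (fnorm a) => D u; rewrite expr2.
  move: (fnorm D) (`|mxdot a D|) => v w; lra.
have MG : `|mxdot a (overlap_mean sg (psd_sqrt h')) - mxdot a (overlap_mean sg (psd_sqrt h))|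
    <= fnorm a * (c * Num.sqrt K%:R) * e.
  rewrite -mxdotBr; apply: le_trans (mxdot_le _ _) _; rewrite -mulrA ler_wpM2l ?fnorm_ge0//.
  apply: le_trans (cL sg h h' hp (posdef_psd hp')) _.
  rewrite /h' [h + _ - h]addrAC subrr add0r fnorm_scalar (ger0_norm (ltW ep)).
  have e2 : e ^+ 2 <= e by rewrite expr2 ler_piMl// ltW.
  have q0 : 0 <= c * Num.sqrt K%:R by rewrite mulr_ge0// sqrtr_ge0.
  by have := ler_wpM2l q0 e2; move: (Num.sqrt _) => q; lra.
have := H1 e e01; have := H2 e e01; rewrite -/h'.
have -> : h + a + (e ^+ 2)%:M = h' + a by rewrite /h' addrAC.
have aux (u1 u2 u3 u4 m1 m0 q C3 : R) :
    `|u1 - u2 - 2^-1 * m1| <= q -> `|m1 - m0| <= C3 * e ->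
    `|u1 - u3| <= C2 * e -> `|u2 - u4| <= C1 * e ->
    `|u3 - u4 - 2^-1 * m0| <= q + (C1 + C2 + C3) * e.
  rewrite !ler_norml.
  by move=> /andP[? ?] /andP[? ?] /andP[? ?] /andP[? ?]; apply/andP; split; nra.
move=> E2 E1; exact: aux M MG E2 E1.
Qed.

Lemma entropy_gradient sg h : psd h ->
  is_gradient (fun k => entropy sg (psd_sqrt k)) h
    (2^-1 *: overlap_mean sg (psd_sqrt h)).
Proof.
move=> hp; split.
  by rewrite /sym_mx/= linearZ/= overlap_mean_sym.
move=> a sa; have [C C0 H] := entropy_psd_taylor.
pose f (t : R) := entropy sg (psd_sqrt (h + t *: a)).
rewrite /is_derive_within -/f.
have -> : (fun e : R => e^-1 * (f (0 + e) - f 0)) = (fun e => e^-1 * (f e - f 0)).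
  by apply/funext => e; rewrite add0r.
apply: (@cvg_quadratic _ f _ _ (C * fnorm a ^+ 2) 1) => //.
  by rewrite mulr_ge0// sqr_ge0.
move=> t /=; rewrite add0r => kp _.
have := H sg h (t *: a) hp kp.
have -> : f 0 = entropy sg (psd_sqrt h) by rewrite /f scale0r addr0.
have -> : fnorm (t *: a) ^+ 2 = t ^+ 2 * fnorm a ^+ 2.
  by rewrite fnormZ exprMn real_normK ?num_real.
have -> : 2^-1 * mxdot (t *: a) (overlap_mean sg (psd_sqrt h)) =
    t * mxdot (2^-1 *: overlap_mean sg (psd_sqrt h)) a.
  rewrite [in LHS]mxdotZl [in RHS]mxdotZl mxdotC; move: (mxdot _ _) => u; ring.
have -> : C * (t ^+ 2 * fnorm a ^+ 2) = C * fnorm a ^+ 2 * t ^+ 2 by ring.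
exact.
Qed.

End Energy.

(** * Overlaps at a fixed observation *)

Section Covariances.
Context {R : realType} {I : finType} {dX} {X : measurableType dX}
  (prior : probability X R) (phi : X -> I -> R).
Hypothesis op : obs_features phi.
Implicit Types (al be : X -> R) (y : I -> R).
Local Notation avg := (gibbs prior phi).
Local Notation cov := (gibbs_cov prior phi).

Lemma eq_gibbs al be y : al =1 be -> avg al y = avg be y.
Proof. by move=> /funext ->. Qed.

Lemma gibbsZr k al y : obs al -> avg (fun x => al x * k) y = avg al y * k.
Proof. by move=> oa; rewrite mulrC -(gibbsZ prior op)//; apply: eq_gibbs => x; rewrite mulrC. Qed.

Lemma gibbs_centered al y : obs al -> avg (fun x => al x - avg al y) y = 0.
Proof. by move=> oa; rewrite (gibbsB prior op)// ?gibbs_cst ?subrr//; exact: obs_cst. Qed.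

Lemma gibbs_cov_centered al be y : obs al -> obs be ->
  avg (fun x => (al x - avg al y) * (be x - avg be y)) y = cov al be y.
Proof.
move=> oa ob; have ca : obs (fun x => al x - avg al y) by apply: obsB => //; exact: obs_cst.
rewrite (@eq_gibbs _ (fun x => (al x * be x - avg al y * be x)
    - (al x - avg al y) * avg be y)); last by move=> x; ring.
rewrite (gibbsB prior op); last 2 first.
- by apply: obsB; [exact: obsM|exact: obsZ].
- by under eq_fun do rewrite mulrC; exact: obsZ.
rewrite (gibbsB prior op); [|exact: obsM|exact: obsZ].
by rewrite gibbsZr// gibbs_centered// mul0r subr0 (gibbsZ prior op).
Qed.

(** The right-hand side is the mean, over two independent replicas, of the square
    of the pairing of [u] at the first one with [v] at the second one. Jensen's
    inequality applies to each replica in turn. *)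
Lemma gibbs_quadratic_ge (J : finType) (u v : J -> X -> R) y :
  (forall p, obs (u p)) -> (forall p, obs (v p)) ->
  (\sum_p avg (u p) y * avg (v p) y) ^+ 2 <=
  \sum_p \sum_q avg (fun x => u p x * u q x) y * avg (fun x => v p x * v q x) y.
Proof.
move=> ou ov.
pose F x := \sum_p \sum_q u p x * u q x * avg (fun x => v p x * v q x) y.
pose L x := \sum_p u p x * avg (v p) y.
have oF : obs F.
  apply: obs_sum => p; apply: obs_sum => q; under eq_fun do rewrite mulrC.
  by apply: obsZ; exact: obsM.
have oL : obs L.
  by apply: obs_sum => p; under eq_fun do rewrite mulrC; exact: obsZ.
have oL2 : obs (fun x => L x ^+ 2) by under eq_fun do rewrite expr2; exact: obsM.
have sqE (f : J -> R) : (\sum_p f p) ^+ 2 = \sum_p \sum_q f p * f q.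
  by rewrite expr2 mulr_suml; apply: eq_bigr => p _; rewrite mulr_sumr.
have LF x : L x ^+ 2 <= F x.
  have ow : obs (fun x' => \sum_p u p x * v p x') by apply: obs_sum => p; exact: obsZ.
  have := gibbs_sqr_le prior op y ow.
  rewrite (gibbs_sum prior op); last by move=> p; exact: obsZ.
  have -> : \sum_p avg (fun x' => u p x * v p x') y = L x.
    by apply: eq_bigr => p _; rewrite (gibbsZ prior op).
  move=> /le_trans; apply; rewrite le_eqVlt; apply/orP; left; apply/eqP.
  transitivity (avg (fun x' => \sum_p \sum_q u p x * u q x * (v p x' * v q x')) y).
    apply: eq_gibbs => x'; rewrite sqE; apply: eq_bigr => p _; apply: eq_bigr => q _.
    ring.
  rewrite (gibbs_sum prior op); last first.
    by move=> p; apply: obs_sum => q; apply: obsZ; exact: obsM.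
  apply: eq_bigr => p _; rewrite (gibbs_sum prior op); last first.
    by move=> q; apply: obsZ; exact: obsM.
  by apply: eq_bigr => q _; rewrite (gibbsZ prior op)//; exact: obsM.
have EF : avg F y = \sum_p \sum_q avg (fun x => u p x * u q x) y * avg (fun x => v p x * v q x) y.
  rewrite (gibbs_sum prior op); last first.
    move=> p; apply: obs_sum => q; under eq_fun do rewrite mulrC.
    by apply: obsZ; exact: obsM.
  apply: eq_bigr => p _; rewrite (gibbs_sum prior op); last first.
    by move=> q; under eq_fun do rewrite mulrC; apply: obsZ; exact: obsM.
  by apply: eq_bigr => q _; rewrite gibbsZr//; exact: obsM.
rewrite -EF; apply: le_trans (le_gibbs prior op y oL2 oF LF).
apply: le_trans (gibbs_sqr_le prior op y oL).
rewrite (gibbs_sum prior op); last by move=> p; under eq_fun do rewrite mulrC; exact: obsZ.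
by under [in leRHS]eq_bigr => p _ do rewrite gibbsZr//.
Qed.

End Covariances.

Section Replicas.
Context {R : realType} {N K : nat}.
Local Notation I := (('I_N * 'I_N) + ('I_N * 'I_K))%type.
Context {dX} {X : measurableType dX} (prior : probability X R)
  (xi : X -> 'M[R]_(N, K)) (Bx : R).
Hypothesis Bx0 : 0 <= Bx.
Hypothesis xi_obs : forall i j, obs (fun w => xi w i j).
Hypothesis xi_bound : forall w, fnorm (xi w) <= Bx.
Variables (sg : R) (s : 'M[R]_K) (y : I -> R).
Local Notation avg := (gibbs prior (phi xi sg s)).
Local Notation cov := (gibbs_cov prior (phi xi sg s)).
Local Notation b := (mean_mx prior xi sg s y).

Let op : obs_features (phi xi sg s). Proof. exact: phi_obs. Qed.

Local Notation entry i k := (fun w => xi w i k).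

Let dev i k : X -> R := fun w => xi w i k - avg (entry i k) y.

Let dev_obs i k : obs (dev i k).
Proof. by apply: obsB => //; exact: obs_cst. Qed.

Definition cov_coord k : 'M[R]_N := \matrix_(i, j) cov (entry i k) (entry j k) y.

(** The covariances split the mean Gram matrix into fluctuation and mean part. *)
Lemma mean_gramE : mean_gram prior xi sg s y = \sum_k cov_coord k + b *m b^T.
Proof.
apply/matrixP => i j; rewrite !mxE summxE -big_split/=.
transitivity (\sum_k avg (fun w => xi w i k * xi w j k) y).
  rewrite -(gibbs_sum prior op); last by move=> k; exact: obsM.
  by apply: eq_gibbs => w; rewrite mxE; apply: eq_bigr => k _; rewrite mxE.
by apply: eq_bigr => k _; rewrite !mxE /gibbs_cov subrK.
Qed.

Lemma fnorm_mean_mx : fnorm b <= Bx.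
Proof.
apply: le_sqr => //; rewrite fnorm_sqrE.
apply: (@le_trans _ _ (avg (fun w => \sum_i \sum_k xi w i k ^+ 2) y)).
  have o2 i k : obs (fun w => xi w i k ^+ 2) by under eq_fun do rewrite expr2; exact: obsM.
  rewrite (gibbs_sum prior op); last by move=> i; apply: obs_sum.
  apply: ler_sum => i _; rewrite (gibbs_sum prior op)//.
  by apply: ler_sum => k _; rewrite mxE; exact: gibbs_sqr_le.
rewrite -[leRHS](gibbs_cst prior op _ y); apply: le_gibbs => //.
- apply: obs_sum => i; apply: obs_sum => k; under eq_fun do rewrite expr2; exact: obsM.
- exact: obs_cst.
by move=> w; rewrite -fnorm_sqrE lerXn2r ?nnegrE ?fnorm_ge0.
Qed.

(** The variance of the overlap of a replica with the mean replica, see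
    [overlap_varE]; this expression in terms of the covariances exhibits it as a
    cross term of [mean_gram]. *)
Definition overlap_var : R := mxdot (\sum_k cov_coord k) (b *m b^T).

Let oB (c : R) : obs (fun _ : X => c). Proof. exact: obs_cst. Qed.

Let ov w : 'M[R]_K := (xi w - b)^T *m b.

Let ov_obs k l : obs (fun w => ov w k l).
Proof.
apply: obs_mulmx => // i j.
have E : (fun w => (xi w - b)^T i j) = dev j i.
  by apply/funext => w; rewrite !mxE.
by rewrite E.
Qed.

Lemma overlap_varE : overlap_var = avg (fun w => fnorm (ov w) ^+ 2) y.
Proof.
have ovE w k l : ov w k l = \sum_i dev i k w * b i l.
  by rewrite mxE; apply: eq_bigr => i _; rewrite !mxE.
transitivity (\sum_k \sum_l \sum_i \sum_j cov (entry i k) (entry j k) y * (b i l * b j l)).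
  rewrite /overlap_var mxdotE.
  transitivity (\sum_i \sum_j \sum_k \sum_l cov (entry i k) (entry j k) y * (b i l * b j l)).
    apply: eq_bigr => i _; apply: eq_bigr => j _; rewrite summxE mulr_suml.
    apply: eq_bigr => k _; rewrite !mxE mulr_sumr; apply: eq_bigr => l _.
    by rewrite !mxE.
  under eq_bigr => i _ do rewrite exchange_big/=.
  rewrite exchange_big/=; apply: eq_bigr => k _.
  under eq_bigr => i _ do rewrite exchange_big/=.
  by rewrite exchange_big.
have oij k l i j : obs (fun w => dev i k w * dev j k w * (b i l * b j l)).
  by under eq_fun do rewrite mulrC; apply: obsZ; exact: obsM.
symmetry.
transitivity (avg (fun w => \sum_k \sum_l \sum_i \sum_j
    dev i k w * dev j k w * (b i l * b j l)) y).
  apply: eq_gibbs => w; rewrite fnorm_sqrE; apply: eq_bigr => k _; apply: eq_bigr => l _.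
  rewrite ovE expr2 mulr_suml; apply: eq_bigr => i _; rewrite mulr_sumr.
  by apply: eq_bigr => j _; ring.
rewrite (gibbs_sum prior op); last first.
  by move=> k; apply: obs_sum => l; apply: obs_sum => i; apply: obs_sum => j.
apply: eq_bigr => k _; rewrite (gibbs_sum prior op); last first.
  by move=> l; apply: obs_sum => i; apply: obs_sum => j.
apply: eq_bigr => l _; rewrite (gibbs_sum prior op); last first.
  by move=> i; apply: obs_sum => j.
apply: eq_bigr => i _; rewrite (gibbs_sum prior op)//.
apply: eq_bigr => j _; rewrite gibbsZr//; last exact: obsM.
by congr (_ * _); rewrite /dev gibbs_cov_centered.
Qed.

Lemma overlap_var_ge0 : 0 <= overlap_var.
Proof.
rewrite overlap_varE; apply: gibbs_ge0 => //; last by move=> w; exact: sqr_ge0.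
by under eq_fun do rewrite fnorm_sqr; exact: obs_mxdot.
Qed.

Definition coord_var : R := \sum_k mxdot (cov_coord k) (cov_coord k).

Lemma coord_var_ge0 : 0 <= coord_var.
Proof. by apply: sumr_ge0 => k _; exact: mxdot_ge0. Qed.

Lemma sqr_sum_le (J : finType) (f : J -> R) : (\sum_j f j) ^+ 2 <= #|J|%:R * \sum_j f j ^+ 2.
Proof.
have H : 0 <= \sum_i \sum_j (f i - f j) ^+ 2.
  by apply: sumr_ge0 => i _; apply: sumr_ge0 => j _; exact: sqr_ge0.
have E : \sum_i \sum_j (f i - f j) ^+ 2 = 2 * (#|J|%:R * \sum_j f j ^+ 2 - (\sum_j f j) ^+ 2).
  transitivity (\sum_i (#|J|%:R * f i ^+ 2 + \sum_j f j ^+ 2 - 2 * f i * \sum_j f j)).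
    apply: eq_bigr => i _; have -> : #|J|%:R * f i ^+ 2 = \sum_(j : J) f i ^+ 2.
      by rewrite sumr_const mulr_natl.
    rewrite mulr_sumr -big_split -sumrB/=; apply: eq_bigr => j _; ring.
  rewrite sumrB big_split/= -mulr_sumr -mulr_suml -mulr_sumr sumr_const.
  rewrite -(mulr_natl _ #|J|); ring.
move: H; rewrite E; move: (\sum_j f j) (\sum_j f j ^+ 2) => u v; lra.
Qed.

Lemma fnorm_sum_cov_coord : fnorm (\sum_k cov_coord k) ^+ 2 <= K%:R * coord_var.
Proof.
rewrite fnorm_sqrE /coord_var.
have -> : \sum_k mxdot (cov_coord k) (cov_coord k) = \sum_i \sum_j \sum_k cov_coord k i j ^+ 2.
  under eq_bigr => k _ do rewrite mxdotE.
  rewrite exchange_big/=; apply: eq_bigr => i _; rewrite exchange_big/=.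
  by apply: eq_bigr => j _; apply: eq_bigr => k _; rewrite expr2.
rewrite mulr_sumr; apply: ler_sum => i _; rewrite mulr_sumr; apply: ler_sum => j _.
by rewrite summxE; have := sqr_sum_le (fun k => cov_coord k i j); rewrite card_ord.
Qed.

(** Expanding the square of [mean_gramE] leaves the square of the fluctuation part
    and the cross term. *)
Lemma square_overlap_gap :
  mxdot (mean_gram prior xi sg s y) (mean_gram prior xi sg s y) - fnorm (b^T *m b) ^+ 2
  <= K%:R * coord_var + 2 * overlap_var.
Proof.
have -> : fnorm (b^T *m b) ^+ 2 = mxdot (b *m b^T) (b *m b^T).
  by rewrite fnorm_sqr mxdot_mull trmxK mulmxA mxdot_mulr trmxK.
rewrite mean_gramE mxdotDl !mxdotDr /overlap_var (mxdotC (b *m b^T)).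
have := fnorm_sum_cov_coord; rewrite fnorm_sqr.
move: (mxdot _ _) (mxdot _ _) (mxdot _ _) => u v w; lra.
Qed.

(** The Cauchy-Schwarz inequality for the cross term, where the mean replica is
    bounded. *)
Lemma overlap_var_le : overlap_var ^+ 2 <= K%:R * coord_var * (Bx ^+ 2) ^+ 2.
Proof.
apply: le_trans (mxdot_le_sqr _ _) _; rewrite -!fnorm_sqr.
apply: ler_pM; [exact: sqr_ge0|exact: sqr_ge0|exact: fnorm_sum_cov_coord|].
rewrite lerXn2r ?nnegrE ?fnorm_ge0 ?sqr_ge0//.
apply: le_trans (fnormM _ _) _; rewrite fnorm_tr expr2.
by apply: ler_pM; rewrite ?fnorm_ge0//; exact: fnorm_mean_mx.
Qed.

(** The heat equation for the overlaps produces this expression as the second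
    derivative of twice the entropy in the direction [a]. *)
Definition curvature (a : 'M[R]_K) : R := \sum_k \sum_l a k l * \sum_i
  mxdot (cov_mx prior xi sg s y (entry i k)) (cov_mx prior xi sg s y (entry i l) *m a).

(** It is the right-hand side of [gibbs_quadratic_ge], for the deviations of the
    coordinates of a replica and of its product with [a]. *)
Lemma curvature_ge0 a : sym_mx a -> 0 <= curvature a.
Proof.
move=> sa.
pose u (p : 'I_N * 'I_K) := dev p.1 p.2.
pose v (p : 'I_N * 'I_K) w := \sum_l a p.2 l * dev p.1 l w.
have ov' p : obs (v p) by apply: obs_sum => l; apply: obsZ.
have := gibbs_quadratic_ge prior op y (fun p => dev_obs p.1 p.2 : obs (u p)) ov'.
move=> /(le_trans (sqr_ge0 _)).
set S := (X in 0 <= X); suff -> : S = curvature a by [].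
have cov2 i k j m : avg (fun w => u (i, k) w * u (j, m) w) y = cov (entry i k) (entry j m) y.
  exact: gibbs_cov_centered.
have cov4 i k j m : avg (fun w => v (i, k) w * v (j, m) w) y =
    \sum_l a k l * \sum_m' cov (entry i l) (entry j m') y * a m' m.
  transitivity (avg (fun w => \sum_l \sum_m' (a k l * a m m') * (dev i l w * dev j m' w)) y).
    apply: eq_gibbs => w; rewrite /v/= mulr_suml; apply: eq_bigr => l _.
    by rewrite mulr_sumr; apply: eq_bigr => m' _; ring.
  rewrite (gibbs_sum prior op); last first.
    by move=> l; apply: obs_sum => m'; apply: obsZ; exact: obsM.
  apply: eq_bigr => l _; rewrite (gibbs_sum prior op); last first.
    by move=> m'; apply: obsZ; exact: obsM.
  rewrite mulr_sumr; apply: eq_bigr => m' _; rewrite (gibbsZ prior op); last exact: obsM.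
  rewrite gibbs_cov_centered//.
  have -> : a m m' = a m' m by rewrite -[in LHS]sa mxE.
  by ring.
rewrite /S; have pb (F : 'I_N * 'I_K -> R) : \sum_p F p = \sum_i \sum_k F (i, k).
  by rewrite pair_bigA; apply: eq_bigr => -[].
rewrite pb exchange_big/=; apply: eq_bigr => k _.
transitivity (\sum_i \sum_l a k l *
  mxdot (cov_mx prior xi sg s y (entry i k)) (cov_mx prior xi sg s y (entry i l) *m a)).
  apply: eq_bigr => i _; rewrite pb.
  under eq_bigr => j _ do under eq_bigr => m _ do rewrite cov2 cov4 mulr_sumr.
  under eq_bigr => j _ do rewrite exchange_big/=.
  rewrite exchange_big/=; apply: eq_bigr => l _; rewrite mxdotE mulr_sumr.
  apply: eq_bigr => j _; rewrite mulr_sumr; apply: eq_bigr => m _.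
  rewrite mulrCA; congr (_ * (_ * _)); first by rewrite mxE.
  by rewrite mxE; apply: eq_bigr => m' _; rewrite mxE.
by rewrite exchange_big/=; apply: eq_bigr => l _; rewrite mulr_sumr.
Qed.

Lemma curvature_delta k : curvature (delta_mx k k) = mxdot (cov_coord k) (cov_coord k).
Proof.
rewrite /curvature (bigD1 k)//= [X in _ + X]big1 ?addr0; last first.
  by move=> l lk; rewrite big1// => m _; rewrite mxE (negbTE lk) mul0r.
rewrite (bigD1 k)//= [X in _ + X]big1 ?addr0; last first.
  by move=> m mk; rewrite mxE (negbTE mk) andbF mul0r.
rewrite mxE eqxx mul1r mxdotE; apply: eq_bigr => i _.
rewrite mxdotE; apply: eq_bigr => j _; rewrite (bigD1 k)//= [X in _ + X]big1 ?addr0; last first.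
  move=> m mk; rewrite [X in _ * X]mxE big1 ?mulr0// => l _.
  by rewrite [delta_mx _ _ _ _]mxE (negbTE mk) andbF mulr0.
rewrite !mxE; congr (_ * _); rewrite (bigD1 k)//= big1 ?addr0; last first.
  by move=> m mk; rewrite [delta_mx _ _ _ _]mxE (negbTE mk) mulr0.
by rewrite !mxE !eqxx mulr1.
Qed.

Section Direction.
Variable a : 'M[R]_K.

Definition overlap (c : 'M[R]_K) (x : 'M[R]_(N, K)) : R := mxdot c (x^T *m b).

Lemma overlap_obs c : obs (fun w => overlap c (xi w)).
Proof.
by apply: obs_mxdot => // k l; apply: obs_mulmx => // i j; under eq_fun do rewrite mxE.
Qed.

Lemma gibbs_overlap c : avg (fun w => overlap c (xi w)) y = mxdot c (b^T *m b).
Proof.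
have E (M : 'M[R]_(N, K)) : mxdot c (M^T *m b) = \sum_k \sum_l \sum_i (c k l * b i l) * M i k.
  rewrite mxdotE; apply: eq_bigr => k _; apply: eq_bigr => l _; rewrite mxE mulr_sumr.
  by apply: eq_bigr => i _; rewrite !mxE; ring.
rewrite (eq_gibbs prior _ y (fun w => E (xi w) : overlap c (xi w) = _)) E.
rewrite (gibbs_sum prior op); last first.
  by move=> k; apply: obs_sum => l; apply: obs_sum => i; exact: obsZ.
apply: eq_bigr => k _; rewrite (gibbs_sum prior op); last first.
  by move=> l; apply: obs_sum => i; exact: obsZ.
apply: eq_bigr => l _; rewrite (gibbs_sum prior op); last by move=> i; exact: obsZ.
by apply: eq_bigr => i _; rewrite (gibbsZ prior op)// !mxE.
Qed.

Lemma overlap_sqr_le c :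
  mxdot c (b^T *m b) ^+ 2 <= avg (fun w => overlap c (xi w) ^+ 2) y.
Proof. by rewrite -gibbs_overlap; apply: gibbs_sqr_le => //; exact: overlap_obs. Qed.

Lemma antisym_dot (c m : 'M[R]_K) : c^T = - c -> m^T = m -> mxdot c m = 0.
Proof.
move=> ca ms; have := mxdot_tr c m; rewrite ca ms mxdotNl => H.
by move: H; move: (mxdot _ _) => u; lra.
Qed.

(** An antisymmetric weight does not see the mean overlap, hence only the
    deviations of the overlap contribute. *)
Lemma overlap_antisym_le c : c^T = - c ->
  `|avg (fun w => overlap a (xi w) * overlap c (xi w)) y| <= fnorm a * fnorm c * overlap_var.
Proof.
move=> ca; have oa := overlap_obs a; have oc := overlap_obs c.
have c0 : mxdot c (b^T *m b) = 0.
  by apply: antisym_dot => //; rewrite trmx_mul trmxK.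
have splitc d w : overlap d (xi w) = mxdot d (ov w) + mxdot d (b^T *m b).
  by rewrite -mxdotDr -mulmxDl -linearD/= subrK.
have od d : obs (fun w => mxdot d (ov w)) by exact: obs_mxdot.
have -> : avg (fun w => overlap a (xi w) * overlap c (xi w)) y =
    avg (fun w => mxdot a (ov w) * mxdot c (ov w)) y.
  transitivity (avg (fun w => mxdot a (ov w) * mxdot c (ov w)
      + mxdot a (b^T *m b) * overlap c (xi w)) y).
    by apply: eq_gibbs => w; rewrite !splitc c0; ring.
  rewrite (gibbsD prior op); [|exact: obsM|exact: obsZ].
  by rewrite (gibbsZ prior op)// gibbs_overlap c0 mulr0 addr0.
have o2 : obs (fun w => fnorm (ov w) ^+ 2).
  by under eq_fun do rewrite fnorm_sqr; exact: obs_mxdot.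
have H w : `|mxdot a (ov w) * mxdot c (ov w)| <= fnorm a * fnorm c * fnorm (ov w) ^+ 2.
  rewrite normrM; have -> : fnorm a * fnorm c * fnorm (ov w) ^+ 2 =
    (fnorm a * fnorm (ov w)) * (fnorm c * fnorm (ov w)) by ring.
  by rewrite ler_pM ?mxdot_le.
rewrite overlap_varE -(gibbsZ prior op)// ler_norml -(gibbsN prior op); last exact: obsZ.
apply/andP; split; apply: le_gibbs => //.
- by apply: obsN; exact: obsZ.
- exact: obsM.
- by move=> w; have := H w; rewrite ler_norml => /andP[].
- exact: obsM.
- exact: obsZ.
- by move=> w; apply: le_trans (ler_norm _) (H w).
Qed.

End Direction.
End Replicas.

(** * One-sided derivatives *)

Section Limits.
Context {R : realType}.

Lemma near_ball (x r : R) (Q : R -> Prop) : 0 < r ->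
  (forall e, `|e - x| < r -> Q e) -> \forall e \near x, Q e.
Proof.
move=> r0 H; apply/nbhs_ballP; exists r => //= e; rewrite /ball/= distrC => er.
exact: H.
Qed.

Lemma second_derivative (f f' : R -> R) (r d : R) : 0 < r ->
  (forall e : R, `|e| < r -> is_derive e 1 f (f' e)) -> is_derive (0 : R) 1 f' d ->
  derivable (derive1 f) 0 1 /\ derive1n 2 f 0 = d.
Proof.
move=> r0 df dd; have nf : \forall e \near (0 : R), f' e = derive1 f e.
  apply: (near_ball r0) => e; rewrite subr0 => er; rewrite derive1E.
  by have D := df e er; apply/esym; exact: derive_val.
have D := near_eq_is_derive nf dd; split; first exact: ex_derive.
by rewrite /derive1n/= derive1E; exact: derive_val.
Qed.

Lemma is_derive_within_two_sided (D : set R) (f : R -> R) (x d : R) :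
  is_derive x 1 f d -> is_derive_within D f x d.
Proof.
move=> [fx fd]; rewrite /is_derive_within.
have H : (fun e : R => e^-1 *: (f (e *: 1 + x) - f x)) @ 0^' --> d by rewrite -fd.
suff -> : (fun e => e^-1 * (f (x + e) - f x)) = (fun e : R => e^-1 *: (f (e *: 1 + x) - f x)).
  by apply: cvg_trans H; apply: cvg_app; exact: cvg_within.
by apply/funext => e; rewrite /GRing.scale/= mulr1 (addrC e).
Qed.

Lemma is_derive_within_unique (D : set R) (f : R -> R) (x d d' : R) :
  (forall e, 0 < e -> D (x + e)) ->
  is_derive_within D f x d -> is_derive_within D f x d' -> d = d'.
Proof.
move=> De; have H l : is_derive_within D f x l ->
    (fun e => e^-1 * (f (x + e) - f x)) @ 0^'+ --> l.
  move=> Hl; apply: (cvg_trans _ Hl); apply: cvg_app => A; rewrite /within/= => nA.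
  have n1 : \forall e \near 0^'+, D (x + e).
    by near=> e; apply: De.
  have n2 : \forall e \near 0^'+, D (x + e) -> A e.
    have nA' : nbhs (0 : R) (fun e => e != 0 -> D (x + e) -> A e) by exact: nA.
    suff : nbhs (0 : R) (fun e => 0 < e -> D (x + e) -> A e) by [].
    by apply: filterS nA' => e Ae e0; apply: Ae; rewrite gt_eqF.
  by apply: filterS2 n1 n2 => e a /(_ a).
by move=> /H h1 /H h2; exact: (cvg_unique _ h1 h2).
Unshelve. all: by end_near. Qed.

(** The mean value theorem on [[e ^+ 2 * t, t]], with [e] tending to 0, avoids the
    end point 0 at which [f] need not be differentiable in the two-sided sense. *)
Lemma right_derivative (f g : R -> R) (C : R) : 0 <= C ->
  (forall t : R, 0 < t -> is_derive t 1 f (g t)) ->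
  (forall t, 0 <= t <= 1 -> `|f t - f 0| <= C * Num.sqrt t) ->
  (forall t, 0 <= t <= 1 -> `|g t - g 0| <= C * Num.sqrt t) ->
  is_time_derivative f 0 (g 0).
Proof.
move=> C0 df f0 g0.
have H t : 0 < t -> t <= 1 -> `|f t - f 0 - t * g 0| <= C * Num.sqrt t * t.
  move=> t0 t1; set q := Num.sqrt t.
  have q0 : 0 <= q by exact: sqrtr_ge0.
  apply: (@le_limit_sqrt _ _ _ (C * q + t * `|g 0|)) => e /andP[e0 e1].
  have ee : e ^+ 2 <= 1 by rewrite expr2 mulr_ile1// ltW.
  have ep : 0 < e ^+ 2 by rewrite exprn_gt0.
  have et : e ^+ 2 * t <= t by rewrite ler_piMl// ltW.
  have et0 : 0 < e ^+ 2 * t by rewrite mulr_gt0.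
  have [||c + Ec] := @MVT_segment R f g _ _ et.
  - move=> x; rewrite in_itv/= => /andP[x0 _]; apply: df.
    exact: lt_trans et0 x0.
  - apply: derivable_within_continuous => x; rewrite in_itv/= => /andP[x0 _].
    by have D := df x (lt_le_trans et0 x0); exact: ex_derive.
  rewrite in_itv/= => /andP[c0 c1].
  have cp : 0 <= c by rewrite ltW// (lt_le_trans et0).
  have h1 : `|g c - g 0| <= C * q.
    have cI : 0 <= c <= 1 by rewrite cp (le_trans c1).
    by apply: le_trans (g0 c cI) _; rewrite ler_wpM2l// ler_sqrt// (le_trans _ c1).
  have h2 : `|f (e ^+ 2 * t) - f 0| <= C * q * e.
    have cI : 0 <= e ^+ 2 * t <= 1 by rewrite (ltW et0) (le_trans et).
    apply: le_trans (f0 _ cI) _.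
    by rewrite sqrtrM ?sqr_ge0// sqrtr_sqr gtr0_norm// mulrCA mulrC.
  have -> : f t - f 0 - t * g 0 = (g c - g 0) * (t - e ^+ 2 * t)
      + (f (e ^+ 2 * t) - f 0) - (e ^+ 2 * t) * g 0.
    have -> : f t = g c * (t - e ^+ 2 * t) + f (e ^+ 2 * t) by rewrite -Ec subrK.
    ring.
  have -> : C * q * t + (C * q + t * `|g 0|) * e = C * q * t + C * q * e + t * `|g 0| * e.
    ring.
  apply: le_trans (ler_normB _ _) _; apply: lerD.
    apply: le_trans (ler_normD _ _) _; apply: lerD => //.
    have te : 0 <= t - e ^+ 2 * t by rewrite subr_ge0.
    by rewrite normrM (ger0_norm te) ler_pM// gerBl ltW.
  rewrite normrM (gtr0_norm et0).
  have e2 : e ^+ 2 <= e by rewrite expr2 ler_piMl// ltW.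
  have tg : 0 <= t * `|g 0| by rewrite mulr_ge0// ltW.
  by have := ler_wpM2r tg e2; move: (e ^+ 2) `|g 0| => p q'; lra.
rewrite /is_time_derivative /is_derive_within.
apply/cvgrPdist_le => eps eps0.
have C1 : 0 < C + 1 by rewrite ltr_wpDl.
have dp : 0 < (eps / (C + 1)) ^+ 2 by rewrite exprn_gt0// divr_gt0.
have n1 := @nbhs_dnbhs_neq R (0 : R).
have n2 := @dnbhs0_lt R R _ dp.
have n3 := @dnbhs0_lt R R _ ltr01.
rewrite near_withinE; apply: filterS3 n1 n2 n3 => t tn tr t1 /=; rewrite add0r => tge.
have t0 : 0 < t by rewrite lt_def tn.
rewrite (gtr0_norm t0) in tr; rewrite (gtr0_norm t0) in t1.
have := H t t0 (ltW t1).
have st : Num.sqrt t <= eps / (C + 1).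
  rewrite -[leRHS]ger0_norm; last by rewrite divr_ge0// ltW.
  by rewrite -sqrtr_sqr ler_sqrt ?sqr_ge0// ltW.
move=> Ht; rewrite -normrN opprB.
have -> : t^-1 * (f t - f 0) - g 0 = t^-1 * (f t - f 0 - t * g 0).
  by field; rewrite gt_eqF.
rewrite normrM normfV (gtr0_norm t0) mulrC ler_pdivrMr//.
apply: le_trans Ht _; rewrite ler_wpM2r ?(ltW t0)//.
apply: (@le_trans _ _ (C * (eps / (C + 1)))); first by rewrite ler_wpM2l.
by rewrite mulrCA ler_piMr ?(ltW eps0)// ler_pdivrMr// mul1r lerDl.
Qed.

End Limits.

Section Uniqueness.
Context {R : realType} {K : nat}.

(** The directions [v *m v^T] point into the cone from every [h] and determine a
    symmetric matrix by polarization. *)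
Lemma gradient_unique (f : 'M[R]_K -> R) h G G' : psd h ->
  is_gradient f h G -> is_gradient f h G' -> G = G'.
Proof.
move=> hp [sG dG] [sG' dG'].
have quad (v : 'cV[R]_K) : mxdot (G - G') (v *m v^T) = 0.
  have sv : sym_mx (v *m v^T) by rewrite /sym_mx/= trmx_mul trmxK.
  rewrite mxdotBl; apply/eqP; rewrite subr_eq0; apply/eqP.
  apply: is_derive_within_unique (dG _ sv) (dG' _ sv) => e e0 /=; rewrite add0r.
  split; first by apply: sym_mxD; [exact: psd_sym|exact: sym_mxZ].
  move=> u; rewrite quadE mulmxDl mxdotDr -quadE addr_ge0//; first by case: hp.
  rewrite -scalemxAl mxdotZr mulr_ge0 ?(ltW e0)// -mulmxA.
  by have := mxdot_ge0 (v^T *m u); rewrite mxdot_mull trmxK.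
set D := G - G'; have sD : D^T = D by rewrite /D linearB/= sG sG'.
have bil (u v : 'cV[R]_K) : mxdot D (u *m v^T + v *m u^T) = 0.
  have := quad (u + v); rewrite -/D linearD/= mulmxDl !mulmxDr !mxdotDr !quad.
  by rewrite add0r addr0.
have dE (i j : 'I_K) : mxdot D (delta_mx i (0 : 'I_1) *m (delta_mx j (0 : 'I_1))^T) = D i j.
  rewrite trmx_delta mul_delta_mx mxdotE (bigD1 i)//= [X in _ + X]big1 ?addr0; last first.
    by move=> k ki; rewrite big1// => l _; rewrite [delta_mx _ _ _ _]mxE (negbTE ki) mulr0.
  rewrite (bigD1 j)//= [X in _ + X]big1 ?addr0; last first.
    by move=> l lj; rewrite [delta_mx _ _ _ _]mxE (negbTE lj) andbF mulr0.
  by rewrite [delta_mx _ _ _ _]mxE !eqxx mulr1.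
apply/eqP; rewrite -subr_eq0 -/D; apply/eqP/matrixP => i j; rewrite [RHS]mxE.
have := bil (delta_mx i 0) (delta_mx j 0); rewrite mxdotDr !dE.
have -> : D j i = D i j by rewrite -[in LHS]sD mxE.
by move: (D i j) => u; lra.
Qed.

Lemma gradientE (f : 'M[R]_K -> R) h G : psd h -> is_gradient f h G -> gradient f h = G.
Proof.
move=> hp fG; apply: (gradient_unique hp _ fG).
by apply: (@xgetPex _ 0 [set G | is_gradient f h G]); exists G.
Qed.

Lemma time_derivativeE (f : R -> R) t d : 0 <= t -> is_time_derivative f t d ->
  time_derivative f t = d.
Proof.
move=> t0 fd; have := @xgetPex _ 0 [set d | is_time_derivative f t d] (ex_intro _ d fd).
move=> H; apply: is_derive_within_unique H fd => e e0 /=.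
by rewrite addr_ge0// ltW.
Qed.

Lemma is_derive_within_eq (D : set R) (f f' : R -> R) (x d : R) :
  D x -> (forall y, D y -> f y = f' y) ->
  is_derive_within D f x d -> is_derive_within D f' x d.
Proof.
move=> Dx ff'; rewrite /is_derive_within; apply: cvg_trans.
apply: near_eq_cvg; rewrite near_withinE; near=> e => De /=.
by rewrite !ff'.
Unshelve. all: by end_near. Qed.

Lemma is_gradient_eq (f f' : 'M[R]_K -> R) h G : psd h ->
  (forall k, psd k -> f k = f' k) -> is_gradient f h G -> is_gradient f' h G.
Proof.
move=> hp ff' [sG dG]; split=> // a sa.
by apply: is_derive_within_eq (dG a sa) => [/=|e /= /ff'//]; rewrite scale0r addr0.
Qed.

End Uniqueness.

(** * Second derivatives and the derivative in time *)

Section SecondOrder.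
Context {R : realType} {N K : nat}.
Local Notation I := (('I_N * 'I_N) + ('I_N * 'I_K))%type.
Context {dX} {X : measurableType dX} (prior : probability X R)
  (xi : X -> 'M[R]_(N, K)) (Bx : R).
Hypothesis Bx0 : 0 <= Bx.
Hypothesis xi_obs : forall i j, obs (fun w => xi w i j).
Hypothesis xi_bound : forall w, fnorm (xi w) <= Bx.
Context {dG} {G : measurableType dG} (gam : probability G R) (g : G -> I -> R).
Hypothesis gv : gaussian_vector gam g.
Implicit Types (sg : R) (s h a : 'M[R]_K) (y : I -> R).

Local Notation EE := (EE prior xi gam g).
Local Notation entropy := (entropy prior xi gam g).
Local Notation overlap_mean := (overlap_mean prior xi gam g).
Local Notation square_mean := (square_mean prior xi gam g).
Local Notation curvature := (curvature prior xi).

Lemma tame_curvature sg s a : tame (fun y => curvature sg s y a).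
Proof.
apply: tame_sum => k; apply: tame_sum => l; apply: tameM; first exact: tame_cst.
apply: tame_sum => i; apply: tame_mxdot => p q; first exact: tame_cov_mx.
by apply: tame_mulmx => p' q'; [exact: tame_cov_mx|exact: tame_cst].
Qed.

Lemma overlap_posdef_derive sg h a : posdef h -> sym_mx a ->
  is_derive (0 : R) 1 (fun e => mxdot a (overlap_mean sg (psd_sqrt (h + e *: a))))
    (EE sg (psd_sqrt h) (fun y => curvature sg (psd_sqrt h) y a)).
Proof.
move=> hp sa; have [r [B P]] := sqrt_path sg hp sa.
set s := psd_sqrt h.
have H k l i := mean_prod_path_derive prior Bx0 xi_obs xi_bound gv P (xi_obs i k) (xi_obs i l).
have E (e : R) : mxdot a (overlap_mean sg (psd_sqrt (h + e *: a))) =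
    \sum_k \sum_l a k l * \sum_i mean_prod prior xi gam g (fun w => xi w i k)
      (fun w => xi w i l) sg (psd_sqrt (h + e *: a)).
  by rewrite mxdotE; apply: eq_bigr => k _; apply: eq_bigr => l _; rewrite mxE.
under eq_fun do rewrite E.
apply: (der_eq (der_sum _ (fun k => der_sum _ (fun l =>
  derZ (a k l) (der_sum _ (fun i => H k l i)))))).
have h0 : psd_sqrt (h + 0 *: a) = s by rewrite scale0r addr0.
rewrite h0.
have tc k l i : tame (fun y => mxdot (cov_mx prior xi sg s y (fun w => xi w i k))
    (cov_mx prior xi sg s y (fun w => xi w i l) *m a)).
  apply: tame_mxdot => p q; first exact: tame_cov_mx.
  by apply: tame_mulmx => p' q'; [exact: tame_cov_mx|exact: tame_cst].
rewrite (EE_sum prior xi_obs gv); last first.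
  move=> k; apply: tame_sum => l; apply: tameM; first exact: tame_cst.
  exact: tame_sum.
apply: eq_bigr => k _; rewrite (EE_sum prior xi_obs gv); last first.
  by move=> l; apply: tameM; [exact: tame_cst|exact: tame_sum].
apply: eq_bigr => l _; rewrite (EE_Z prior xi_obs gv); last exact: tame_sum.
congr (_ * _); rewrite (EE_sum prior xi_obs gv)//.
apply: eq_bigr => i _; apply: eq_EE => y.
by rewrite !mulr0 mul0r add0r [X in _ *m X]addrC lyapunovE.
Qed.

Lemma entropy_laplacian_direction sg h a (f : R -> R) (c : R) : posdef h -> sym_mx a ->
  (forall e : R, psd (h + e *: a) -> f e = c * entropy sg (psd_sqrt (h + e *: a))) ->
  derivable (derive1 f) 0 1 /\
  derive1n 2 f 0 = c * (2^-1 * EE sg (psd_sqrt h) (fun y => curvature sg (psd_sqrt h) y a)).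
Proof.
move=> hp sa fE; have [r [r0 H]] := lyapunov_bounded_near hp sa.
have nf e : `|e| < r -> \forall u \near e, c * entropy sg (psd_sqrt (h + u *: a)) = f u.
  move=> er; have r1 : 0 < r - `|e| by rewrite subr_gt0.
  apply: (near_ball r1) => u ur; rewrite fE//; apply: posdef_psd.
  have [] // := H u; have -> : u = (u - e) + e by rewrite subrK.
  by apply: le_lt_trans (ler_normD _ _) _; rewrite -ltrBrDr.
pose f' (e : R) := c * (2^-1 * mxdot a (overlap_mean sg (psd_sqrt (h + e *: a)))).
apply: (@second_derivative _ f f' r _ r0).
  move=> e er; have [ep _] := H e er.
  apply: (near_eq_is_derive (nf e er)).
  exact: derZ (entropy_posdef_derive prior Bx0 xi_obs xi_bound gv sg ep sa).
by apply: derZ; apply: derZ; exact: overlap_posdef_derive.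
Qed.

Lemma entropy_time_path (c : R) s (t : R) : 0 < c -> 0 < t -> s^T = s -> exists r B,
  coef_path (fun u => Num.sqrt (u * c)) (fun u => c * (2 * Num.sqrt (u * c))^-1)
    (fun=> s) (fun=> 0) t r B.
Proof.
move=> c0 t0 ss; have r0 : 0 < t / 2 by rewrite divr_gt0.
pose B := Num.sqrt (2 * t * c) + c * (2 * Num.sqrt (t / 2 * c))^-1 + fnorm s.
have q1 : 0 <= Num.sqrt (2 * t * c) by exact: sqrtr_ge0.
have q2 : 0 <= c * (2 * Num.sqrt (t / 2 * c))^-1.
  by rewrite mulr_ge0 ?(ltW c0)// invr_ge0 mulr_ge0// sqrtr_ge0.
have q3 := fnorm_ge0 s.
have near u : `|u - t| < t / 2 -> t / 2 <= u /\ u <= 2 * t.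
  by rewrite ltr_norml => /andP[? ?]; split; lra.
exists (t / 2), B; split=> //.
- by rewrite /B !addr_ge0.
- move=> u /near[u0 u1]; have up : 0 < u by exact: lt_le_trans u0.
  rewrite ger0_norm ?sqrtr_ge0// ger0_norm; last first.
    by rewrite mulr_ge0 ?(ltW c0)// invr_ge0 mulr_ge0// sqrtr_ge0.
  split.
    apply: (@le_trans _ _ (Num.sqrt (2 * t * c))); last by rewrite /B -addrA lerDl addr_ge0.
    apply: ler_wsqrtr; exact: ler_wpM2r (ltW c0) _ _ u1.
  apply: (@le_trans _ _ (c * (2 * Num.sqrt (t / 2 * c))^-1)); last first.
    by rewrite /B addrAC lerDr addr_ge0.
  have pos v : 0 < v -> 0 < 2 * Num.sqrt (v * c).
    by move=> v0; rewrite mulr_gt0// sqrtr_gt0 mulr_gt0.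
  rewrite ler_wpM2l ?(ltW c0)// lef_pV2 ?posrE ?pos//.
  apply: ler_wpM2l => //; apply: ler_wsqrtr; exact: ler_wpM2r (ltW c0) _ _ u0.
- move=> u _; rewrite fnorm0 /B; split; first by rewrite lerDr addr_ge0.
  by rewrite !addr_ge0.
- move=> u /near[u0 u1]; have up : 0 < u by exact: lt_le_trans u0.
  have uc : 0 < u * c by rewrite mulr_gt0.
  have dl : is_derive u 1 (fun v => v * c) c.
    by apply: (der_eq (derM (der_id u) (der_cst c u))); rewrite mulr0 addr0 mul1r.
  apply: (der_eq (@der_comp R Num.sqrt (fun v => v * c) u _ _ (is_derive1_sqrt uc) dl)).
  by rewrite mulrC.
- by move=> u _ i j; rewrite mxE; exact: der_cst.
- by move=> u _; rewrite ss trmx0.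
Qed.

(** At time zero the square root of the time is not differentiable, but the entropy
    and its derivative are Lipschitz functions of it. *)
Lemma entropy_time_derivative (c : R) s (t : R) : 0 < c -> 0 <= t -> s^T = s ->
  is_time_derivative (fun u => entropy (Num.sqrt (u * c)) s) t
    (c / 2 * square_mean (Num.sqrt (t * c)) s).
Proof.
move=> c0 t0 ss.
have D (u : R) : 0 < u -> is_derive u 1 (fun u => entropy (Num.sqrt (u * c)) s)
    (c / 2 * square_mean (Num.sqrt (u * c)) s).
  move=> u0; have [r [B P]] := entropy_time_path c0 u0 ss.
  apply: (der_eq (entropy_path_derive prior Bx0 xi_obs xi_bound gv P)).
  have q0 : Num.sqrt (u * c) != 0 by rewrite gt_eqF// sqrtr_gt0 mulr_gt0.
  rewrite (square_meanE prior xi_obs gv) -(EE_Z prior xi_obs gv); last first.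
    by apply: tame_mxdot => i j; exact: tame_mean_gram.
  apply: eq_EE => y; rewrite mulmx0 mul0mx addr0 mxdot0r mulr0 addr0; congr (_ * _).
  by move: q0; move: (Num.sqrt _) => q q0; field.
have [tp|tn] := boolP (0 < t); first exact/is_derive_within_two_sided/D.
have -> : t = 0 by apply/eqP; rewrite eq_le t0 leNgt tn.
have [c1 c10 L1] := entropy_lipschitz prior Bx0 xi_obs xi_bound gv.
have [c2 c20 L2] := square_mean_lipschitz prior Bx0 xi_obs xi_bound gv.
pose q := Num.sqrt c; pose B := q + fnorm s.
have q0 : 0 <= q by exact: sqrtr_ge0.
have n0 := fnorm_ge0 s.
have B0 : 0 <= B by rewrite addr_ge0.
have close J c' : 0 <= c' -> coef_lipschitz c' J -> forall u, 0 <= u <= 1 ->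
    `|J (Num.sqrt (u * c)) s - J (Num.sqrt (0 * c)) s| <= c' * (3 * B * q) * Num.sqrt u.
  move=> c'0 JL u /andP[u0 u1].
  have su : Num.sqrt (u * c) = Num.sqrt u * q by rewrite sqrtrM.
  have su1 : Num.sqrt u <= 1 by rewrite -[leRHS]sqrtr1; exact: ler_wsqrtr.
  rewrite mul0r sqrtr0 su.
  have b1 : `|Num.sqrt u * q| <= B.
    rewrite ger0_norm ?mulr_ge0 ?sqrtr_ge0//.
    by apply: (@le_trans _ _ q); [rewrite ler_piMl|rewrite /B lerDl].
  have b0 : `|0 : R| <= B by rewrite normr0.
  have b2 : fnorm s <= B by rewrite /B lerDr.
  apply: le_trans (coef_lipschitz_straight c'0 JL b0 b1 b2 b2 ss ss) _.
  rewrite !subrr fnorm0 mulr0 addr0 subr0 (ger0_norm (_ : 0 <= Num.sqrt u * q)).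
    by rewrite -!mulrA (mulrC q).
  by rewrite mulr_ge0// sqrtr_ge0.
have C1 : 0 <= c1 * (3 * B * q) by rewrite !mulr_ge0.
have C2 : 0 <= c / 2 * (c2 * (3 * B * q)) by rewrite !mulr_ge0// ltW.
apply: (@right_derivative _ (fun u => entropy (Num.sqrt (u * c)) s)
  (fun u => c / 2 * square_mean (Num.sqrt (u * c)) s)
  (c1 * (3 * B * q) + c / 2 * (c2 * (3 * B * q)))).
- by rewrite addr_ge0.
- move=> u u01; apply: le_trans (close _ _ c10 L1 u u01) _.
  by rewrite ler_wpM2r ?sqrtr_ge0// lerDl.
- move=> u u01; have c2' : 0 <= c / 2 by rewrite divr_ge0// ltW.
  rewrite -mulrBr normrM (ger0_norm c2').
  apply: (@le_trans _ _ (c / 2 * (c2 * (3 * B * q) * Num.sqrt u))).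
    by rewrite ler_wpM2l ?(close _ _ c20 L2 u u01)// divr_ge0// ltW.
  by rewrite mulrA ler_wpM2r ?sqrtr_ge0// lerDr.
Qed.

End SecondOrder.

(** * Fluctuations of the overlap and of the gradient *)

Section SampleTame.
Context {R : realType} {I : finType} {dX} {X : measurableType dX}
  (prior : probability X R) {dG} {G : measurableType dG}
  (gam : probability G R) (g : G -> I -> R).
Hypothesis gv : gaussian_vector gam g.
Implicit Types (F H : X * G -> R).
Local Notation law := (prior \x gam)%E.

(** The analogue of [tame] for functions of the signal and the noise, which need
    not be functions of the observation, such as the score. *)
Definition sample_tame F : Prop := measurable_fun setT F /\
  exists2 c : R * R, (0 <= c.1) /\ (0 <= c.2) & forall w, `|F w| <= c.1 * expR (c.2 * size1 (g w.2)).

Lemma sample_tame_integrable F : sample_tame F -> law.-integrable setT (EFin \o F).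
Proof. by move=> [mF [c _ Fc]]; exact: (prod_integrable prior gv mF Fc). Qed.

Let size1_pos (y : I -> R) : 0 <= size1 y.
Proof. by rewrite addr_ge0// sumr_ge0. Qed.

Lemma sample_tameD F H : sample_tame F -> sample_tame H -> sample_tame (fun w => F w + H w).
Proof.
move=> [mF [[C c] [/= C0 c0] Fc]] [mH [[C' c'] [/= C0' c0'] Hc]]; split.
  exact: measurable_funD.
exists (C + C', c + c') => /=; first by split; rewrite addr_ge0.
move=> w; apply: le_trans (ler_normD _ _) _; rewrite mulrDl lerD//.
  apply: le_trans (Fc w) _; rewrite ler_wpM2l// ler_expR ler_wpM2r ?lerDl//.
apply: le_trans (Hc w) _; rewrite ler_wpM2l// ler_expR ler_wpM2r ?lerDr//.
Qed.

Lemma sample_tameM F H : sample_tame F -> sample_tame H -> sample_tame (fun w => F w * H w).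
Proof.
move=> [mF [[C c] [/= C0 c0] Fc]] [mH [[C' c'] [/= C0' c0'] Hc]]; split.
  exact: measurable_funM.
exists (C * C', c + c') => /=; first by split; [exact: mulr_ge0|exact: addr_ge0].
move=> w; rewrite normrM mulrDl expRD mulrACA; exact: ler_pM.
Qed.

Lemma sample_tame_obs al : obs al -> sample_tame (fun w => al w.1).
Proof.
move=> [mal [L aL]]; split; first exact: (measurableT_comp mal measurable_fst).
exists (`|L|, 0) => //= w; rewrite mul0r expR0 mulr1.
by apply: le_trans (aL _) (ler_norm _).
Qed.

Lemma sample_tame_cst k : sample_tame (fun=> k).
Proof. exact: (sample_tame_obs (obs_cst k)). Qed.

Lemma sample_tame_observation phi f : obs_features phi -> tame f ->
  sample_tame (fun w => f (observation g phi w)).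
Proof.
move=> op [mf [c c0 fc]]; have [L L0 pL] := features_bound op; split.
  by apply: mf => i; exact: (measurable_observation gv op i).
exists (expR (c * (L * #|I|%:R)), c); first by split=> //=; exact: expR_ge0.
move=> w /=; apply: le_trans (fc tt Logic.I _) _; rewrite -expRD ler_expR -mulrDr ler_wpM2l//.
by rewrite addrC; apply: size1D => i; exact: pL.
Qed.

Lemma sample_tameB F H : sample_tame F -> sample_tame H -> sample_tame (fun w => F w - H w).
Proof.
move=> tF tH; under eq_fun do rewrite -mulN1r; apply: sample_tameD => //.
by apply: sample_tameM => //; exact: sample_tame_cst.
Qed.

Lemma sample_tame_sum (J : Type) (r : seq J) (F : J -> X * G -> R) :
  (forall j, sample_tame (F j)) -> sample_tame (fun w => \sum_(j <- r) F j w).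
Proof.
move=> tF; elim: r => [|j r ih].
  by under eq_fun do rewrite big_nil; exact: sample_tame_cst.
by under eq_fun do rewrite big_cons; exact: sample_tameD.
Qed.

Lemma sample_RintegralD F H : sample_tame F -> sample_tame H ->
  \int[law]_w (F w + H w) = \int[law]_w F w + \int[law]_w H w.
Proof. by move=> tF tH; rewrite RintegralD//; exact: sample_tame_integrable. Qed.

Lemma sample_RintegralZ k F : sample_tame F ->
  \int[law]_w (k * F w) = k * \int[law]_w F w.
Proof. by move=> tF; rewrite RintegralZl//; exact: sample_tame_integrable. Qed.

Lemma sample_Rintegral_cst k : \int[law]_w k = k.
Proof. by rewrite Rintegral_cst//= [X in _ * fine X]probability_setT mulr1. Qed.

Lemma sample_Rintegral_sum (J : Type) (r : seq J) (F : J -> X * G -> R) :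
  (forall j, sample_tame (F j)) ->
  \int[law]_w (\sum_(j <- r) F j w) = \sum_(j <- r) \int[law]_w F j w.
Proof.
move=> tF; elim: r => [|j r ih].
  by rewrite big_nil; under eq_Rintegral do rewrite big_nil; exact: sample_Rintegral_cst.
rewrite big_cons -ih -sample_RintegralD//; last exact: sample_tame_sum.
by apply: eq_Rintegral => w _; rewrite big_cons.
Qed.

Lemma sample_tame_score phi phi' : obs_features phi -> obs_features phi' ->
  sample_tame (fun w => score prior phi phi' (phi' w.1) (observation g phi w)).
Proof.
move=> op op'; apply: sample_tameB; last first.
  apply: (@sample_tame_observation phi
    (fun y => \sum_i gibbs prior phi (fun x => phi' x i * phi x i) y)) => //.
  by apply: tame_sum => i; apply: tame_gibbs => //; exact: obsM.
apply: sample_tameD; last first.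
  apply: sample_tame_sum => i; apply: sample_tameM.
    exact: (@sample_tame_obs (fun x => phi' x i)).
  apply: (@sample_tame_observation phi (gibbs prior phi (fun x => phi x i))) => //.
  exact: tame_gibbs.
apply: (@sample_tame_observation phi
  (fun y => \sum_i y i * gibbs prior phi (fun x => phi' x i) y)) => //; apply: tame_sum => i.
by apply: tameM; [exact: tame_coord|exact: tame_gibbs].
Qed.

End SampleTame.

Lemma momentE {R : realType} {I : finType} {dX} {X : measurableType dX}
    (prior : probability X R) (phi : X -> I -> R) al y : obs_features phi ->
  moment prior phi al y = partition_function prior phi y * gibbs prior phi al y.
Proof.
by move=> op; rewrite /gibbs mulrCA divff ?mulr1//; exact: partition_function_neq0.
Qed.

Section GradientFluctuation.
Context {R : realType} {N K : nat}.
Local Notation I := (('I_N * 'I_N) + ('I_N * 'I_K))%type.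
Context {dX} {X : measurableType dX} (prior : probability X R)
  (xi : X -> 'M[R]_(N, K)) (Bx : R).
Hypothesis Bx0 : 0 <= Bx.
Hypothesis xi_obs : forall i j, obs (fun w => xi w i j).
Hypothesis xi_bound : forall w, fnorm (xi w) <= Bx.
Context {dG} {G : measurableType dG} (gam : probability G R) (g : G -> I -> R).
Hypothesis gv : gaussian_vector gam g.
Variables (sg : R) (s : 'M[R]_K).
Local Notation law := (prior \x gam)%E.
Local Notation phi1 := (phi xi sg s).
Local Notation avg := (gibbs prior phi1).
Local Notation EE := (EE prior xi gam g sg s).
Local Notation b := (mean_mx prior xi sg s).
Local Notation ovl := (overlap prior xi sg s).
Implicit Types (y : I -> R).

Let op : obs_features phi1. Proof. exact: phi_obs. Qed.

Lemma sum_gibbs_weighted (f : X -> R) sg1 s1 sg2 s2 y : obs f -> sg1 * sg2 = 0 ->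
  \sum_p avg (fun x => f x * phi xi sg1 s1 x p) y * avg (fun x => phi xi sg2 s2 x p) y
  = avg (fun x => f x * ovl y (s1 *m s2^T) (xi x)) y.
Proof.
move=> of_ sg0; have o1 := phi_obs xi_obs sg1 s1; have o2 := phi_obs xi_obs sg2 s2.
transitivity (\sum_p avg (fun x => avg (fun x => phi xi sg2 s2 x p) y *
    (f x * phi xi sg1 s1 x p)) y).
  by apply: eq_bigr => p _; rewrite (gibbsZ prior op) 1?mulrC//; exact: obsM.
rewrite -(gibbs_sum prior op); last by move=> p; apply: obsZ; exact: obsM.
apply: eq_gibbs => x; transitivity (f x * \sum_p phi xi sg1 s1 x p
    * avg (fun x => phi xi sg2 s2 x p) y).
  by rewrite mulr_sumr; apply: eq_bigr => p _; ring.
congr (_ * _); rewrite sum_index [X in X + _]big1 ?add0r; last first.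
  move=> i _; rewrite big1// => j _; rewrite gibbs_phi//=.
  by rewrite /phi/= mulrACA sg0 mul0r.
transitivity (mxdot (xi x *m s1) (b y *m s2)).
  by rewrite mxdotE; apply: eq_bigr => i _; apply: eq_bigr => j _; rewrite gibbs_phi.
by rewrite /overlap mxdot_mull mulmxA mxdot_mulr trmxK.
Qed.

Variables (a D : 'M[R]_K).
Hypothesis sa : a^T = a.
Hypothesis ss : s^T = s.
Hypothesis sD : D^T = D.
Hypothesis aD : D *m s + s *m D = a.
Local Notation phi2 := (phi xi 0 D).
Local Notation obsn := (observation g phi1).

Let op' : obs_features phi2. Proof. exact: phi_obs. Qed.

(** The antisymmetric part of [s *m D], which vanishes only if [s] and [D]
    commute. *)
Definition twist : 'M[R]_K := 2^-1 *: (s *m D - D *m s).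

Lemma twist_antisym : twist^T = - twist.
Proof. by rewrite /twist linearZ/= linearB/= !trmx_mul ss sD -scalerN opprB. Qed.

Lemma twist_le : fnorm twist <= fnorm s * fnorm D.
Proof.
rewrite fnormZ ger0_norm//; have := fnormB (s *m D) (D *m s).
have := fnormM s D; have := fnormM D s; rewrite (mulrC (fnorm D)).
move: (fnorm (s *m D - _)) => u; lra.
Qed.

Lemma twistE : s *m D = 2^-1 *: a + twist.
Proof.
rewrite /twist -scalerDr -aD [in RHS]addrC -addrA addKr -mulr2n.
by rewrite -(scaler_nat 2 (s *m D)) scalerA mulVf ?scale1r// pnatr_eq0.
Qed.

Lemma ovlD y c c' x : ovl y (c + c') x = ovl y c x + ovl y c' x.
Proof. by rewrite /overlap mxdotDl. Qed.

Lemma ovlZ y k c x : ovl y (k *: c) x = k * ovl y c x.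
Proof. by rewrite /overlap mxdotZl. Qed.

Local Notation p y := (mxdot a ((b y)^T *m b y)).

(** The antisymmetric part is orthogonal to the symmetric matrix [b^T *m b]. *)
Lemma half_overlap y : \sum_i avg (fun x => phi1 x i) y * avg (fun x => phi2 x i) y = 2^-1 * p y.
Proof.
transitivity (\sum_i avg (fun x => 1 * phi1 x i) y * avg (fun x => phi2 x i) y).
  by apply: eq_bigr => i _; congr (_ * _); apply: eq_gibbs => x; rewrite mul1r.
rewrite sum_gibbs_weighted ?mulr0//; last exact: obs_cst.
rewrite sD (@eq_gibbs _ _ _ _ _ _ _ (fun x => ovl y (s *m D) (xi x))); last first.
  by move=> x; rewrite mul1r.
rewrite (gibbs_overlap prior xi_obs) twistE mxdotDl mxdotZl.
rewrite (antisym_dot twist_antisym) ?addr0//.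
by rewrite trmx_mul trmxK.
Qed.

Let J : finType := ('I_N * 'I_K)%type.
Let al (j : J) (w : X) : R := (xi w *m a) j.1 j.2.
Let be (j : J) (w : X) : R := xi w j.1 j.2.

Let oal j : obs (al j). Proof. exact: obs_mulmxr. Qed.
Let obe j : obs (be j). Proof. exact: xi_obs. Qed.

Lemma sum_overlap y (x : 'M[R]_(N, K)) : \sum_(j : J) (x *m a) j.1 j.2 * b y j.1 j.2 = ovl y a x.
Proof.
transitivity (mxdot (x *m a) (b y)); first by rewrite mxdotE pair_bigA.
by rewrite mxdot_mull.
Qed.

Lemma sum_overlap' y (x : 'M[R]_(N, K)) : \sum_(j : J) (b y *m a) j.1 j.2 * x j.1 j.2 = ovl y a x.
Proof.
transitivity (mxdot (b y *m a) x); first by rewrite mxdotE pair_bigA.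
by rewrite mxdot_mull -mxdot_tr trmx_mul trmxK sa.
Qed.

Definition signal_overlap (w : X * G) : R :=
  \sum_(j : J) al j w.1 * avg (be j) (obsn w).

Local Notation Y := (fun w : X * G => score prior phi1 phi2 (phi2 w.1) (obsn w)).

Let tame_b j : tame (avg (be j)). Proof. exact: tame_gibbs. Qed.

Let stb j : sample_tame g (fun w => al j w.1 * avg (be j) (obsn w)).
Proof.
apply: sample_tameM; first exact: (sample_tame_obs _ (oal j)).
by apply: (@sample_tame_observation _ _ _ _ _ _ _ _ gv _ (avg (be j))) => //.
Qed.

Lemma sample_tame_signal_overlap : sample_tame g signal_overlap.
Proof. exact: sample_tame_sum. Qed.

Let stY : sample_tame g Y. Proof. exact: (sample_tame_score prior gv op op'). Qed.

Lemma tame_p : tame (fun y => p y).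
Proof.
apply: tame_mxdot => i j; first exact: tame_cst.
apply: tame_mulmx => k l; last exact: tame_mean_mx.
by under eq_fun do rewrite mxE; exact: tame_mean_mx.
Qed.

Let obs_prod_ovl c c' y : obs (fun x => ovl y c (xi x) * ovl y c' (xi x)).
Proof. by apply: obsM; exact: overlap_obs. Qed.

Lemma tame_overlap_prod c c' :
  tame (fun y => avg (fun x => ovl y c (xi x) * ovl y c' (xi x)) y).
Proof.
have E y : avg (fun x => ovl y c (xi x) * ovl y c' (xi x)) y =
    \sum_(j : J) \sum_(l : J) b y j.1 j.2 * b y l.1 l.2 *
      avg (fun x => (xi x *m c) j.1 j.2 * (xi x *m c') l.1 l.2) y.
  transitivity (avg (fun x => \sum_(j : J) \sum_(l : J) b y j.1 j.2 * b y l.1 l.2 *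
      ((xi x *m c) j.1 j.2 * (xi x *m c') l.1 l.2)) y).
    apply: eq_gibbs => x.
    have F d : ovl y d (xi x) = \sum_(j : J) (xi x *m d) j.1 j.2 * b y j.1 j.2.
      by rewrite /overlap -mxdot_mull mxdotE pair_bigA.
    rewrite !F mulr_suml; apply: eq_bigr => j _; rewrite mulr_sumr; apply: eq_bigr => l _.
    ring.
  rewrite (gibbs_sum prior op); last first.
    move=> j; apply: obs_sum => l; apply: obsZ; apply: obsM; exact: obs_mulmxr.
  apply: eq_bigr => j _; rewrite (gibbs_sum prior op); last first.
    move=> l; apply: obsZ; apply: obsM; exact: obs_mulmxr.
  by apply: eq_bigr => l _; rewrite (gibbsZ prior op)//; apply: obsM; exact: obs_mulmxr.
under eq_fun do rewrite E.
apply: tame_sum => j; apply: tame_sum => l.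
apply: tameM; first by apply: tameM; exact: tame_mean_mx.
by apply: tame_gibbs => //; apply: obsM; exact: obs_mulmxr.
Qed.

Local Notation q := (EE (fun y => avg (fun x => ovl y a (xi x) * ovl y a (xi x)) y)).
Local Notation e := (EE (fun y => avg (fun x => ovl y a (xi x) * ovl y twist (xi x)) y)).

Lemma planted_score_mean : \int[law]_w Y w = 2^-1 * EE (fun y => p y).
Proof.
have := planted_score prior gv op op' (obs_cst 1) (obs_cst 1).
under eq_Rintegral do rewrite (gibbs_cst prior op) mul1r mul1r.
move=> ->; rewrite -(EE_Z prior xi_obs gv); last exact: tame_p.
apply: eq_expect => y; congr (_ * _); rewrite -half_overlap; apply: eq_bigr => i _.
have E f : avg (fun x => 1 * f x) y = avg f y by apply: eq_gibbs => x; rewrite mul1r.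
rewrite !E (gibbs_cst prior op); ring.
Qed.

Lemma planted_overlap_sqr : \int[law]_w (signal_overlap w * signal_overlap w) = q.
Proof.
transitivity (\int[law]_w \sum_(j : J) \sum_(l : J)
    ((al j w.1 * al l w.1) * (avg (be j) (obsn w) * avg (be l) (obsn w)))).
  apply: eq_Rintegral => w _; rewrite /signal_overlap mulr_suml; apply: eq_bigr => j _.
  by rewrite mulr_sumr; apply: eq_bigr => l _; ring.
have st j l : sample_tame g (fun w => (al j w.1 * al l w.1) *
    (avg (be j) (obsn w) * avg (be l) (obsn w))).
  apply: sample_tameM; first by apply: (sample_tame_obs _ (obsM (oal j) (oal l))).
  apply: (@sample_tame_observation _ _ _ _ _ _ _ _ gv _ (fun y => avg (be j) y * avg (be l) y)) => //.
  exact: tameM.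
rewrite (sample_Rintegral_sum prior gv); last by move=> j; exact: sample_tame_sum.
have H j l := planted_mean prior gv op (obsM (oal j) (oal l)) (tameM (tame_b j) (tame_b l)).
transitivity (\sum_j \sum_l EE (fun y => avg (fun x => al j x * al l x) y
    * (avg (be j) y * avg (be l) y))).
  apply: eq_bigr => j _; rewrite (sample_Rintegral_sum prior gv)//; apply: eq_bigr => l _.
  by rewrite H; apply: eq_expect => y; rewrite (momentE prior _ _ op) -mulrA.
have taa j l : tame (avg (fun x => al j x * al l x)) by apply: tame_gibbs => //; exact: obsM.
have tt j l : tame (fun y => avg (fun x => al j x * al l x) y
    * (avg (be j) y * avg (be l) y)) by apply: tameM => //; exact: tameM.
transitivity (EE (fun y => \sum_j \sum_l avg (fun x => al j x * al l x) y
    * (avg (be j) y * avg (be l) y))).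
  rewrite (EE_sum prior xi_obs gv); last by move=> j; exact: tame_sum.
  by apply: eq_bigr => j _; rewrite (EE_sum prior xi_obs gv).
apply: eq_EE => y.
transitivity (avg (fun x => \sum_j \sum_l b y j.1 j.2 * b y l.1 l.2 * (al j x * al l x)) y).
  rewrite (gibbs_sum prior op); last first.
    by move=> j; apply: obs_sum => l; apply: obsZ; exact: obsM.
  apply: eq_bigr => j _; rewrite (gibbs_sum prior op); last first.
    by move=> l; apply: obsZ; exact: obsM.
  apply: eq_bigr => l _; rewrite (gibbsZ prior op); last exact: obsM.
  by rewrite mulrC !mxE.
apply: eq_gibbs => x; rewrite -sum_overlap mulr_suml; apply: eq_bigr => j _.
by rewrite mulr_sumr; apply: eq_bigr => l _; rewrite /al; ring.
Qed.

(** Summing [planted_score] over the entries of the overlap. The first two terms of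
    that formula combine, by the Lyapunov equation, into the second moment of the
    overlap weighted by [a]; the third one brings in half of it and the twist. *)
Lemma planted_overlap_score :
  \int[law]_w (signal_overlap w * Y w) = 3 / 2 * q - EE (fun y => p y ^+ 2) + e.
Proof.
have tq := tame_overlap_prod a a; have te := tame_overlap_prod a twist.
have tp2 : tame (fun y => p y ^+ 2) by under eq_fun do rewrite expr2; apply: tameM; exact: tame_p.
have tqp : tame (fun y => 3 / 2 * avg (fun x => ovl y a (xi x) * ovl y a (xi x)) y - p y ^+ 2).
  by apply: tameB => //; apply: tameM => //; exact: tame_cst.
have -> : 3 / 2 * q - EE (fun y => p y ^+ 2) + e =
    EE (fun y => 3 / 2 * avg (fun x => ovl y a (xi x) * ovl y a (xi x)) y - p y ^+ 2
      + avg (fun x => ovl y a (xi x) * ovl y twist (xi x)) y).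
  rewrite (EE_D prior xi_obs gv)// (EE_B prior xi_obs gv)//; last first.
    by apply: tameM => //; exact: tame_cst.
  by rewrite (EE_Z prior xi_obs gv).
transitivity (\int[law]_w \sum_(j : J) (al j w.1 * avg (be j) (obsn w) * Y w)).
  by apply: eq_Rintegral => w _; rewrite mulr_suml.
rewrite (sample_Rintegral_sum prior gv); last by move=> j; exact: sample_tameM.
pose f j y := \sum_i
   (avg (be j) y * (avg (fun x => al j x * phi1 x i) y * avg (fun x => phi2 x i) y
               + avg (fun x => al j x * phi2 x i) y * avg (fun x => phi1 x i) y)
     + avg (al j) y * avg (fun x => be j x * phi1 x i) y * avg (fun x => phi2 x i) y
     - 2 * avg (al j) y * avg (be j) y * avg (fun x => phi1 x i) y * avg (fun x => phi2 x i) y).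
have tf j : tame (f j).
  have t1 i : tame (avg (fun x => phi1 x i)) by exact: tame_gibbs.
  have t2 i : tame (avg (fun x => phi2 x i)) by exact: tame_gibbs.
  have t3 i : tame (avg (fun x => al j x * phi1 x i)) by apply: tame_gibbs => //; exact: obsM.
  have t4 i : tame (avg (fun x => al j x * phi2 x i)) by apply: tame_gibbs => //; exact: obsM.
  have t5 i : tame (avg (fun x => be j x * phi1 x i)) by apply: tame_gibbs => //; exact: obsM.
  have t6 : tame (avg (al j)) by exact: tame_gibbs.
  have t7 : tame (fun y => 2 * avg (al j) y) by apply: tameM => //; exact: tame_cst.
  apply: tame_sum => i.
  exact: (tameB (tameD (tameM (tame_b j) (tameD (tameM (t3 i) (t2 i)) (tameM (t4 i) (t1 i))))
    (tameM (tameM t6 (t5 i)) (t2 i))) (tameM (tameM (tameM t7 (tame_b j)) (t1 i)) (t2 i))).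
transitivity (\sum_(j : J) EE (f j)).
  by apply: eq_bigr => j _; rewrite (planted_score prior gv op op' (oal j) (obe j)).
rewrite -(EE_sum prior xi_obs gv)//; apply: eq_EE => y.
have fE j : f j y = avg (be j) y * avg (fun x => al j x * ovl y a (xi x)) y
    + avg (al j) y * avg (fun x => be j x * ovl y (s *m D) (xi x)) y
    - avg (al j) y * avg (be j) y * p y.
  have h1 := sum_gibbs_weighted s D y (oal j) (mulr0 sg); rewrite sD in h1.
  have h2 := sum_gibbs_weighted D s y (oal j) (mul0r sg); rewrite ss in h2.
  have h3 := sum_gibbs_weighted s D y (obe j) (mulr0 sg); rewrite sD in h3.
  have h4 := half_overlap y.
  have oo f' c : obs f' -> obs (fun x => f' x * ovl y c (xi x)).
    by move=> ?; apply: obsM => //; exact: overlap_obs.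
  have -> : avg (fun x => al j x * ovl y a (xi x)) y =
      avg (fun x => al j x * ovl y (s *m D) (xi x)) y + avg (fun x => al j x * ovl y (D *m s) (xi x)) y.
    rewrite -(gibbsD prior op); [|exact: oo|exact: oo].
    by apply: eq_gibbs => x; rewrite -mulrDr -ovlD addrC aD.
  have -> : p y = 2 * (2^-1 * p y) by rewrite mulrA divff ?mul1r// pnatr_eq0.
  rewrite -h1 -h2 -h3 -h4 /f mulrDr !mulr_sumr -!big_split/= -sumrB.
  by apply: eq_bigr => i _; ring.
under eq_bigr => j _ do rewrite fE.
have oo f' c : obs f' -> obs (fun x => f' x * ovl y c (xi x)).
  by move=> ?; apply: obsM => //; exact: overlap_obs.
have pull (u v : J -> X -> R) c : (forall j, obs (v j)) ->
    \sum_j avg (u j) y * avg (fun x => v j x * ovl y c (xi x)) y =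
    avg (fun x => (\sum_j avg (u j) y * v j x) * ovl y c (xi x)) y.
  move=> ov; transitivity (avg (fun x => \sum_j avg (u j) y * (v j x * ovl y c (xi x))) y).
    rewrite (gibbs_sum prior op); last by move=> j; apply: obsZ; exact: oo.
    by apply: eq_bigr => j _; rewrite (gibbsZ prior op)//; exact: oo.
  by apply: eq_gibbs => x; rewrite mulr_suml; apply: eq_bigr => j _; rewrite mulrA.
have alE j : avg (al j) y = (b y *m a) j.1 j.2.
  rewrite /al (_ : (fun w => _) = (fun w => \sum_k a k j.2 * xi w j.1 k)); last first.
    by apply/funext => w; rewrite mxE; apply: eq_bigr => k _; rewrite mulrC.
  rewrite (gibbs_sum prior op); last by move=> k; exact: obsZ.
  by rewrite mxE; apply: eq_bigr => k _; rewrite (gibbsZ prior op)// mxE mulrC.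
have beE j : avg (be j) y = b y j.1 j.2 by rewrite mxE.
rewrite sumrB big_split/= (pull _ _ _ oal) (pull _ _ _ obe).
have -> : avg (fun x => (\sum_j avg (be j) y * al j x) * ovl y a (xi x)) y =
    avg (fun x => ovl y a (xi x) * ovl y a (xi x)) y.
  apply: eq_gibbs => x; congr (_ * _); rewrite -sum_overlap.
  by apply: eq_bigr => j _; rewrite beE mulrC.
have -> : avg (fun x => (\sum_j avg (al j) y * be j x) * ovl y (s *m D) (xi x)) y =
    2^-1 * avg (fun x => ovl y a (xi x) * ovl y a (xi x)) y
    + avg (fun x => ovl y a (xi x) * ovl y twist (xi x)) y.
  rewrite -(gibbsZ prior op)// -(gibbsD prior op)//; last by apply: obsZ.
  apply: eq_gibbs => x; have -> : \sum_j avg (al j) y * be j x = ovl y a (xi x).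
    by rewrite -sum_overlap'; apply: eq_bigr => j _; rewrite alE.
  by rewrite twistE ovlD ovlZ; ring.
have -> : \sum_j avg (al j) y * avg (be j) y * p y = p y ^+ 2.
  rewrite -mulr_suml expr2; congr (_ * _).
  transitivity (\sum_(j : J) (b y *m a) j.1 j.2 * b y j.1 j.2).
    by apply: eq_bigr => j _; rewrite alE beE.
  by rewrite sum_overlap'.
move: (avg _ y) (avg _ y) (p y ^+ 2) => u v w; by field.
Qed.

Lemma EE_sqr_le f : tame f -> EE f ^+ 2 <= EE (fun y => f y ^+ 2).
Proof.
move=> tf; set m := EE f.
have tf2 : tame (fun y => f y ^+ 2) by under eq_fun do rewrite expr2; exact: tameM.
have tm : tame (fun y => 2 * m * f y) by apply: tameM => //; exact: tame_cst.
have tc : tame (fun _ : I -> R => m ^+ 2) by exact: tame_cst.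
have : EE (fun=> 0) <= EE (fun y => f y ^+ 2 - 2 * m * f y + m ^+ 2).
  apply: (EE_le prior xi_obs gv).
  - exact: tame_cst.
  - by apply: tameD => //; exact: tameB.
  - by move=> y; have := sqr_ge0 (f y - m); rewrite sqrrB; lra.
rewrite (EE_cst prior xi_obs gv) (EE_D prior xi_obs gv)//; last exact: tameB.
rewrite (EE_B prior xi_obs gv)// (EE_Z prior xi_obs gv)// (EE_cst prior xi_obs gv) -/m.
by move: (EE _) => u; lra.
Qed.

Lemma tame_overlap_var : tame (fun y => overlap_var prior xi sg s y).
Proof.
apply: tame_mxdot => i j; last first.
  apply: tame_mulmx => k l; first exact: tame_mean_mx.
  by under eq_fun do rewrite mxE; exact: tame_mean_mx.
under eq_fun do rewrite summxE; apply: tame_sum => k.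
by under eq_fun do rewrite mxE; exact: tame_cov.
Qed.

(** The mean of the square of half the signal overlap minus the score is
    nonnegative. All terms of its expansion are known; the second moment of the
    overlap at a fixed observation is at least the mean of the square of [p]. *)
Lemma overlap_fluctuation :
  EE (fun y => p y ^+ 2) - EE (fun y => p y) ^+ 2 <=
  4 * \int[law]_w (Y w - 2^-1 * EE (fun y => p y)) ^+ 2
  + 4 * (fnorm a * (fnorm s * fnorm D)) * EE (fun y => overlap_var prior xi sg s y).
Proof.
have aux (q' Q' V' m' T' e' w : R) : Q' <= q' -> m' ^+ 2 <= Q' -> - (w * T') <= e' ->
    0 <= 4^-1 * q' + (- 1 * (3 / 2 * q' - Q' + e') + (V' + (m' * (2^-1 * m') + - (4^-1 * m' ^+ 2)))) ->
    Q' - m' ^+ 2 <= 4 * V' + 4 * w * T'.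
  by lra.
set m := EE (fun y => p y); set Q := EE (fun y => p y ^+ 2).
set T := EE (fun y => overlap_var prior xi sg s y).
have tp2 : tame (fun y => p y ^+ 2) by under eq_fun do rewrite expr2; apply: tameM; exact: tame_p.
have qQ : Q <= q.
  apply: (EE_le prior xi_obs gv) => //; first exact: tame_overlap_prod.
  by move=> y; have := overlap_sqr_le prior xi_obs sg s y a; under eq_gibbs do rewrite expr2.
have mQ : m ^+ 2 <= Q by apply: EE_sqr_le; exact: tame_p.
have eT : `|e| <= fnorm a * (fnorm s * fnorm D) * T.
  have tT := tame_overlap_var.
  have H y : `|avg (fun x => ovl y a (xi x) * ovl y twist (xi x)) y| <=
      fnorm a * (fnorm s * fnorm D) * overlap_var prior xi sg s y.
    apply: le_trans (overlap_antisym_le prior xi_obs sg s y a twist_antisym) _.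
    rewrite ler_wpM2r ?(overlap_var_ge0 prior xi_obs)// ler_wpM2l ?fnorm_ge0//.
    exact: twist_le.
  rewrite ler_norml -mulNr -!(EE_Z prior xi_obs gv)//; apply/andP; split.
    apply: (EE_le prior xi_obs gv); [|exact: tame_overlap_prod|].
      by apply: tameM => //; exact: tame_cst.
    by move=> y; have := H y; rewrite ler_norml mulNr => /andP[].
  apply: (EE_le prior xi_obs gv); [exact: tame_overlap_prod| |].
    by apply: tameM => //; exact: tame_cst.
  by move=> y; apply: le_trans (ler_norm _) (H y).
have stS := sample_tame_signal_overlap.
have stc k : sample_tame g (fun=> k) by exact: sample_tame_cst.
have stY' : sample_tame g (fun w => Y w - 2^-1 * m) by exact: sample_tameB.
set V := \int[law]_w (Y w - 2^-1 * m) ^+ 2.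
have st2 : sample_tame g (fun w => (Y w - 2^-1 * m) ^+ 2).
  by under eq_fun do rewrite expr2; exact: sample_tameM.
(* The integrand is [(2^-1 * signal_overlap w - Y w) ^+ 2], arranged so that the
   square centred at the mean of [Y] appears. *)
have : 0 <= \int[law]_w (4^-1 * (signal_overlap w * signal_overlap w)
     + (- 1 * (signal_overlap w * Y w) + ((Y w - 2^-1 * m) ^+ 2
     + (m * Y w + (- (4^-1 * m ^+ 2)))))).
  apply: Rintegral_ge0 => w _.
  have := sqr_ge0 (2^-1 * signal_overlap w - Y w).
  move: (signal_overlap w) (Y w) => u v; lra.
have s1 : sample_tame g (fun w => 4^-1 * (signal_overlap w * signal_overlap w)).
  by apply: sample_tameM => //; exact: sample_tameM.
have s2 : sample_tame g (fun w => - 1 * (signal_overlap w * Y w)).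
  by apply: sample_tameM => //; exact: sample_tameM.
have s3 : sample_tame g (fun w => m * Y w) by exact: sample_tameM.
have s4 : sample_tame g (fun w => m * Y w + (- (4^-1 * m ^+ 2))) by exact: sample_tameD.
have s5 : sample_tame g (fun w => (Y w - 2^-1 * m) ^+ 2 + (m * Y w + (- (4^-1 * m ^+ 2)))).
  exact: sample_tameD.
have s6 : sample_tame g (fun w => - 1 * (signal_overlap w * Y w) + ((Y w - 2^-1 * m) ^+ 2
     + (m * Y w + (- (4^-1 * m ^+ 2))))) by exact: sample_tameD.
rewrite !(sample_RintegralD prior gv)// (sample_Rintegral_cst prior).
rewrite !(sample_RintegralZ prior gv)//; [|exact: sample_tameM|exact: sample_tameM].
rewrite planted_overlap_sqr planted_overlap_score planted_score_mean -/m -/Q -/V.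
have /andP[eT1 _] : - (fnorm a * (fnorm s * fnorm D) * T) <= e <=
  fnorm a * (fnorm s * fnorm D) * T by rewrite -ler_norml.
exact: aux qQ mQ eT1.
Qed.

End GradientFluctuation.

(** * Product laws and Gaussian matrices *)

Lemma eq_integral_parts {R : realType} {d d'} {T : measurableType d}
    {S : measurableType d'} (mu : probability T R) (nu : probability S R)
    (f : T -> \bar R) (h : S -> \bar R) :
  (\int[mu]_w f^\+ w = \int[nu]_w h^\+ w)%E ->
  (\int[mu]_w f^\- w = \int[nu]_w h^\- w)%E ->
  (\int[mu]_w f w = \int[nu]_w h w)%E.
Proof. by move=> E1 E2; rewrite [LHS]integralE [RHS]integralE E1 E2. Qed.

Section ProductAssoc.
Local Open Scope ereal_scope.
Context {R : realType} {d1 d2 d3} {T1 : measurableType d1} {T2 : measurableType d2}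
  {T3 : measurableType d3} (m1 : probability T1 R) (m2 : probability T2 R)
  (m3 : probability T3 R).

Definition assoc (w : T1 * T2 * T3) : T1 * (T2 * T3) := (w.1.1, (w.1.2, w.2)).

Lemma measurable_assoc : measurable_fun setT assoc.
Proof.
have m11 : measurable_fun setT (fun w : T1 * T2 * T3 => w.1.1).
  exact: (measurableT_comp measurable_fst measurable_fst).
have m12 : measurable_fun setT (fun w : T1 * T2 * T3 => w.1.2).
  exact: (measurableT_comp measurable_snd measurable_fst).
by apply/measurable_fun_pair => //; apply/measurable_fun_pair.
Qed.

Lemma ge0_integral_assoc (F : T1 * (T2 * T3) -> \bar R) :
  measurable_fun setT F -> (forall w, 0 <= F w) ->
  \int[(m1 \x m2) \x m3]_w F (assoc w) = \int[m1 \x (m2 \x m3)]_w F w.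
Proof.
move=> mF F0; have mFa : measurable_fun setT (fun w => F (assoc w)).
  exact: measurableT_comp mF measurable_assoc.
pose m12 : probability (T1 * T2)%type R := m1 \x m2.
pose m23 : probability (T2 * T3)%type R := m2 \x m3.
have F0a w : 0 <= F (assoc w) by [].
pose H := fubini_F m3 (fun w => F (assoc w)).
have mH : measurable_fun setT H := measurable_fun_fubini_tonelli_F _ mFa F0a.
have H0 p : 0 <= H p by exact: integral_ge0.
etransitivity.
  exact: (@fubini_tonelli1 _ _ _ _ _ m12 m3 (fun w => F (assoc w)) mFa F0a).
etransitivity; first exact: (@fubini_tonelli1 _ _ _ _ _ m1 m2 H mH H0).
symmetry; etransitivity.
  exact: (@fubini_tonelli1 _ _ _ _ _ m1 m23 F mF F0).
apply: eq_integral => x _.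
have mFx : measurable_fun setT (fun w => F (x, w)).
  exact: (measurableT_comp mF (pair1_measurable x)).
exact: (@fubini_tonelli1 _ _ _ _ _ m2 m3 (fun w => F (x, w)) mFx (fun w => F0 (x, w))).
Qed.

Lemma integral_assoc (F : T1 * (T2 * T3) -> \bar R) : measurable_fun setT F ->
  \int[(m1 \x m2) \x m3]_w F (assoc w) = \int[m1 \x (m2 \x m3)]_w F w.
Proof.
move=> mF.
have E1 := ge0_integral_assoc (measurable_funepos mF) (funepos_ge0 F).
have E2 := ge0_integral_assoc (measurable_funeneg mF) (funeneg_ge0 F).
pose m12 : probability (T1 * T2)%type R := m1 \x m2.
pose m23 : probability (T2 * T3)%type R := m2 \x m3.
pose mu : probability (T1 * T2 * T3)%type R := m12 \x m3.
pose nu : probability (T1 * (T2 * T3))%type R := m1 \x m23.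
apply: (@eq_integral_parts _ _ _ _ _ mu nu).
  by rewrite -E1; apply: eq_integral => w _; rewrite !funeposE.
by rewrite -E2; apply: eq_integral => w _; rewrite !funenegE.
Qed.

End ProductAssoc.

Section BoundedRows.
Context {R : realType} {d} {T : measurableType d} (P : probability T R).

Definition all_rows n (B : set T) : set (n.-tuple T) := [set x | forall i, B (tnth x i)].

Lemma measurable_all_rows n (B : set T) : measurable B -> measurable (@all_rows n B).
Proof.
move=> mB; have -> : @all_rows n B = \bigcap_(i in [set: 'I_n]) ((@tnth _ T ^~ i) @^-1` B).
  by apply/seteqP; split=> x; [move=> H i _; exact: H|move=> H i; exact: H].
apply: fin_bigcap_measurable; first exact: finite_finset.
by move=> i _; rewrite -[X in measurable X]setTI; exact: measurable_tnth.
Qed.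

Lemma power_prob_all_rows n (B : set T) : measurable B -> P B = 1%E ->
  power_prob P n (@all_rows n B) = 1%E.
Proof.
move=> mB PB; elim: n => [|n ih].
  rewrite /= diracE (_ : _ \in _ = true)//; apply/mem_set => -[].
  by [].
rewrite /= /distribution/= /pushforward.
have -> : @cons_pair _ T n @^-1` all_rows B = B `*` @all_rows n B.
  apply/seteqP; split=> [[x y] /= H|[x y] /= [Bx By] i].
    split; first by have := H ord0; rewrite tnth_cons_pair0.
    by move=> i; have := H (lift ord0 i); rewrite tnth_cons_pairS.
  have [->|] := eqVneq i ord0; first by rewrite tnth_cons_pair0.
  by rewrite eq_sym => /unlift_some[j -> _]; rewrite tnth_cons_pairS; exact: By.
have mBn : measurable (@all_rows n B) by exact: measurable_all_rows.
have -> : ((P \x power_prob P n) (B `*` @all_rows n B) = P B * power_prob P n (@all_rows n B))%E.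
  exact: product_measure1E.
by rewrite ih PB mule1.
Qed.

End BoundedRows.

Section TupleMatrix.
Context {R : realType}.

Lemma measurable_tuple_mx m n i j :
  measurable_fun setT (fun x : m.-tuple (n.-tuple R) => tuple_mx x i j).
Proof.
under eq_fun do rewrite mxE.
exact: (measurableT_comp (@measurable_tnth _ _ _ j) (@measurable_tnth _ _ _ i)).
Qed.

Lemma measurable_row_fnorm n :
  measurable_fun setT (fun v : n.-tuple R => fnorm (\row_i tnth v i)).
Proof.
have E v : fnorm (\row_i tnth v i) = Num.sqrt (\sum_(i < n) tnth v i * tnth v i).
  rewrite /fnorm mxdotE big_ord1; congr (Num.sqrt _); apply: eq_bigr => i _.
  by rewrite !mxE.
under eq_fun do rewrite E.
have mS : measurable_fun setT (fun v : n.-tuple R => \sum_(i < n) tnth v i * tnth v i).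
  by apply: measurable_sum => i; apply: measurable_funM; exact: measurable_tnth.
have msq : measurable_fun setT (@Num.sqrt R).
  by apply: continuous_measurable_fun; exact: sqrt_continuous.
exact: measurableT_comp msq mS.
Qed.

Lemma gaussian_matrix m n : gaussian_vector (gaussian_prob m n)
  (fun (w : m.-tuple (n.-tuple R)) (i : 'I_m * 'I_n) => tuple_mx w i.1 i.2).
Proof.
have H1 := gaussian_vector_power n (@std_normal_gaussian_vector R).
have H2 : gaussian_vector (power_prob (std_normal R) n) (fun w (j : 'I_n) => tnth w j).
  apply: (gaussian_vector_reindex (s := fun j : 'I_n => (j, ord0 : 'I_1)) (s' := fst) _ _ H1).
    by [].
  by move=> [j k] /=; rewrite (ord1 k).
have H3 := gaussian_vector_power m H2.
rewrite (_ : (fun _ _ => _) = (fun (w : m.-tuple (n.-tuple R)) (i : 'I_m * 'I_n) =>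
  tnth (tnth w i.1) i.2)) //.
by apply/funext => w; apply/funext => i; rewrite mxE.
Qed.

End TupleMatrix.

(** * The gradient for a fixed sample *)

Section PathwiseGradient.
Context {R : realType} {N K : nat}.
Local Notation I := (('I_N * 'I_N) + ('I_N * 'I_K))%type.
Context {dX} {X : measurableType dX} (prior : probability X R)
  (xi : X -> 'M[R]_(N, K)) (Bx : R).
Hypothesis Bx0 : 0 <= Bx.
Hypothesis xi_obs : forall i j, obs (fun w => xi w i j).
Hypothesis xi_bound : forall w, fnorm (xi w) <= Bx.
Implicit Types (sg : R) (s h a D : 'M[R]_K) (z : I -> R) (x : 'M[R]_(N, K)).

(** The derivative of [ln Z] when [s] moves in the direction [D] and the observation
    of the signal [x] in the noise [z] moves along. The signal is arbitrary, because
    the gradient has to exist for every sample. *)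
Definition path_score sg s z x D : R :=
  score prior (phi xi sg s) (phi xi 0 D) (feat 0 D x) (fun k => z k + feat sg s x k).

Lemma featD c D D' x k : feat 0 (c *: D + D') x k = c * feat 0 D x k + feat 0 D' x k.
Proof.
case: k => [ij|ik] /=; first by rewrite !mul0r mulr0 addr0.
by rewrite mulmxDr -scalemxAr !mxE.
Qed.

Lemma path_score_linear sg s z x c D D' :
  path_score sg s z x (c *: D + D') = c * path_score sg s z x D + path_score sg s z x D'.
Proof.
have op := phi_obs xi_obs sg s.
have op' E := phi_obs xi_obs 0 E.
rewrite /path_score /score.
have E1 k : gibbs prior (phi xi sg s) (fun w => phi xi 0 (c *: D + D') w k) (fun k => z k + feat sg s x k)
   = c * gibbs prior (phi xi sg s) (fun w => phi xi 0 D w k) (fun k => z k + feat sg s x k)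
   + gibbs prior (phi xi sg s) (fun w => phi xi 0 D' w k) (fun k => z k + feat sg s x k).
  rewrite -(gibbsZ prior op)//; last exact: op'.
  rewrite -(gibbsD prior op)//; [|by apply: obsZ; exact: op'|exact: op'].
  by apply: eq_gibbs => w; exact: featD.
have E2 k : gibbs prior (phi xi sg s)
     (fun w => phi xi 0 (c *: D + D') w k * phi xi sg s w k) (fun k => z k + feat sg s x k)
   = c * gibbs prior (phi xi sg s) (fun w => phi xi 0 D w k * phi xi sg s w k) (fun k => z k + feat sg s x k)
   + gibbs prior (phi xi sg s) (fun w => phi xi 0 D' w k * phi xi sg s w k) (fun k => z k + feat sg s x k).
  have oD E : obs (fun w => phi xi 0 E w k * phi xi sg s w k).
    by apply: obsM; [exact: op'|exact: op].
  rewrite -(gibbsZ prior op)// -(gibbsD prior op)//; last exact: obsZ.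
  by apply: eq_gibbs => w; rewrite mulrA -mulrDl; congr (_ * _); exact: featD.
have S (J : finType) (u u1 u2 v : J -> R) : (forall k, u k = c * u1 k + u2 k) ->
    \sum_k v k * u k = c * (\sum_k v k * u1 k) + \sum_k v k * u2 k.
  by move=> E; rewrite mulr_sumr -big_split/=; apply: eq_bigr => k _; rewrite E; ring.
have S' (J : finType) (u u1 u2 v : J -> R) : (forall k, u k = c * u1 k + u2 k) ->
    \sum_k u k * v k = c * (\sum_k u1 k * v k) + \sum_k u2 k * v k.
  by move=> E; rewrite mulr_sumr -big_split/=; apply: eq_bigr => k _; rewrite E; ring.
have S3 (J : finType) (u u1 u2 : J -> R) : (forall k, u k = c * u1 k + u2 k) ->
    \sum_k u k = c * (\sum_k u1 k) + \sum_k u2 k.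
  by move=> E; rewrite mulr_sumr -big_split/=; apply: eq_bigr => k _; rewrite E.
have aux (p p1 p2 q q1 q2 t t1 t2 : R) : p = c * p1 + p2 -> q = c * q1 + q2 ->
    t = c * t1 + t2 -> p + q - t = c * (p1 + q1 - t1) + (p2 + q2 - t2).
  by move=> -> -> ->; ring.
apply: aux; first exact: S.
  by apply: S' => k; exact: featD.
exact: S3.
Qed.

Lemma path_score0 sg s z x : path_score sg s z x 0 = 0.
Proof.
have := path_score_linear sg s z x (-1) 0 0; rewrite scaler0 addr0.
by move: (path_score _ _ _ _ _) => u; lra.
Qed.

Lemma path_score_sum sg s z x (J : Type) (r : seq J) (F : J -> R) (D : J -> 'M[R]_K) :
  path_score sg s z x (\sum_(j <- r) F j *: D j) = \sum_(j <- r) F j * path_score sg s z x (D j).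
Proof.
elim: r => [|j r ih]; first by rewrite !big_nil path_score0.
by rewrite !big_cons path_score_linear ih.
Qed.

Lemma ln_partition_derive sg z x h a : posdef h -> sym_mx a ->
  is_derive (0 : R) 1 (fun e => ln (partition_function prior (phi xi sg (psd_sqrt (h + e *: a)))
      (fun k => z k + feat sg (psd_sqrt (h + e *: a)) x k)))
    (path_score sg (psd_sqrt h) z x (lyapunov (psd_sqrt h) a)).
Proof.
move=> hp sa; have [r [B Q]] := sqrt_path sg hp sa.
have FP := coef_feature_path Bx0 xi_obs xi_bound Q.
have [r0 B0 sgB sB sgd sd _] := Q.
pose B' := B * (fnorm x ^+ 2 + fnorm x).
have B'0 : 0 <= B' by rewrite mulr_ge0// addr_ge0 ?sqr_ge0 ?fnorm_ge0.
pose zs (e : R) k := z k + feat sg (psd_sqrt (h + e *: a)) x k.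
pose zs' (e : R) k := feat 0 (lyapunov (psd_sqrt (h + e *: a)) a) x k.
have dz (e : R) : `|e - 0| < r -> forall k, is_derive e 1 (zs^~ k) (zs' e k).
  move=> er k; apply: (der_eq (derD (der_cst (z k) e) (feat_derive x k (sgd e er) (sd e er)))).
  by rewrite add0r.
have zB (e : R) : `|e - 0| < r -> forall k, `|zs e k| <= \sum_i `|z i| + B' /\ `|zs' e k| <= \sum_i `|z i| + B'.
  move=> er k; have [s1 s2] := sgB e er; have [s3 s4] := sB e er.
  have zk : `|z k| <= \sum_i `|z i| by rewrite (bigD1 k)//= lerDl sumr_ge0.
  have z0 : 0 <= \sum_i `|z i| by exact: sumr_ge0.
  have f1 := feat_bound B0 s1 s3 (lexx (fnorm x)) k.
  have f2 := feat_bound B0 s2 s4 (lexx (fnorm x)) k.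
  split; last by apply: le_trans f2 _; rewrite lerDr.
  by apply: le_trans (ler_normD _ _) _; exact: lerD.
have o1 : obs (fun _ : X => 1 : R) by exact: obs_cst.
have Dm := moment_is_derive prior FP o1 dz zB.
have op := phi_obs xi_obs sg (psd_sqrt (h + 0 *: a)).
have Z0 : 0 < partition_function prior (phi xi sg (psd_sqrt (h + 0 *: a))) (zs 0).
  exact: partition_function_gt0.
apply: (der_eq (der_ln Z0 Dm)).
rewrite -[LHS]/(gibbs _ _ _ _) /path_score /score.
have h0 : h + 0 *: a = h by rewrite scale0r addr0.
rewrite /zs /zs' !h0 in op *.
have op' := phi_obs xi_obs 0 (lyapunov (psd_sqrt h) a).
set y := (fun k => z k + _); set D := lyapunov _ _ in op' *.
set avg := gibbs prior (phi xi sg (psd_sqrt h)).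
have oA k : obs (fun w => y k * phi xi 0 D w k) by apply: obsZ; exact: op'.
have oB k : obs (fun w => feat 0 D x k * phi xi sg (psd_sqrt h) w k) by apply: obsZ; exact: op.
have oC k : obs (fun w => phi xi 0 D w k * phi xi sg (psd_sqrt h) w k).
  by apply: obsM; [exact: op'|exact: op].
transitivity (avg (fun w => \sum_k (y k * phi xi 0 D w k)
    + \sum_k (feat 0 D x k * phi xi sg (psd_sqrt h) w k)
    - \sum_k phi xi 0 D w k * phi xi sg (psd_sqrt h) w k) y).
  apply: eq_gibbs => w; rewrite mul1r /dot; congr (_ + _ - _).
    by apply: eq_bigr => k _; rewrite mulrC.
  by apply: eq_bigr => k _; rewrite mulrC.
rewrite /avg (gibbsB prior op); [|by apply: obsD; exact: obs_sum|exact: obs_sum].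
rewrite (gibbsD prior op); [|exact: obs_sum|exact: obs_sum].
rewrite !(gibbs_sum prior op)//; congr (_ + _ - _); apply: eq_bigr => k _.
  by rewrite (gibbsZ prior op)//; exact: op'.
by rewrite (gibbsZ prior op)//; exact: op.
Qed.

(** Pairing with these matrices extracts the entries of a symmetric matrix; they are
    not orthonormal, but their norm is at most 1. *)
Definition sym_unit (k l : 'I_K) : 'M[R]_K := 2^-1 *: (delta_mx k l + delta_mx l k).

Lemma sym_unit_sym k l : sym_mx (sym_unit k l).
Proof. by rewrite /sym_mx/= linearZ/= linearD/= !trmx_delta addrC. Qed.

Lemma sum_sym_unit a : sym_mx a ->
  \sum_(kl : 'I_K * 'I_K) a kl.1 kl.2 *: sym_unit kl.1 kl.2 = a.
Proof.
move=> sa; have E : \sum_(kl : 'I_K * 'I_K) a kl.1 kl.2 *: delta_mx kl.1 kl.2 = a.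
  by rewrite [RHS]matrix_sum_delta pair_bigA.
have E' : \sum_(kl : 'I_K * 'I_K) a kl.1 kl.2 *: delta_mx kl.2 kl.1 = a.
  rewrite -[RHS]sa -[in RHS]E linear_sum/=; apply: eq_bigr => kl _.
  by rewrite linearZ/= trmx_delta.
transitivity (2^-1 *: (\sum_(kl : 'I_K * 'I_K) a kl.1 kl.2 *: delta_mx kl.1 kl.2
    + \sum_(kl : 'I_K * 'I_K) a kl.1 kl.2 *: delta_mx kl.2 kl.1)).
  rewrite -big_split/= scaler_sumr; apply: eq_bigr => kl _.
  by rewrite /sym_unit scalerA mulrC -scalerA -scalerDr.
by rewrite E E' -mulr2n -(scaler_nat 2 a) scalerA mulVf ?scale1r// pnatr_eq0.
Qed.

Lemma sym_unit_dot k l a : sym_mx a -> mxdot (sym_unit k l) a = a k l.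
Proof.
move=> sa; have dE i j : mxdot (delta_mx i j) a = a i j.
  rewrite mxdotE (bigD1 i)//= [X in _ + X]big1 ?addr0; last first.
    by move=> k' ki; rewrite big1// => l' _; rewrite mxE (negbTE ki) mul0r.
  rewrite (bigD1 j)//= [X in _ + X]big1 ?addr0; last first.
    by move=> l' lj; rewrite mxE (negbTE lj) andbF mul0r.
  by rewrite mxE !eqxx mul1r.
rewrite mxdotZl mxdotDl !dE; have -> : a l k = a k l by rewrite -[in LHS]sa mxE.
by field.
Qed.

Lemma sym_unit_fnorm k l : fnorm (sym_unit k l) <= 1.
Proof.
have d1 i j : fnorm (delta_mx i j : 'M[R]_K) = 1.
  rewrite /fnorm mxdotE (bigD1 i)//= [X in _ + X]big1 ?addr0; last first.
    by move=> k' ki; rewrite big1// => l' _; rewrite mxE (negbTE ki) mul0r.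
  rewrite (bigD1 j)//= [X in _ + X]big1 ?addr0; last first.
    by move=> l' lj; rewrite mxE (negbTE lj) andbF mul0r.
  by rewrite mxE !eqxx mul1r sqrtr1.
have := fnormD (delta_mx k l : 'M[R]_K) (delta_mx l k).
rewrite !d1 fnormZ ger0_norm//; move: (fnorm _) => u; lra.
Qed.

(** The score is linear in the direction, so that its values at the symmetric units
    are the entries of a matrix. *)
Definition path_gradient sg s z x : 'M[R]_K :=
  \matrix_(k, l) path_score sg s z x (lyapunov s (sym_unit k l)).

Lemma path_gradient_dot sg s z x a : sym_mx a ->
  mxdot a (path_gradient sg s z x) = path_score sg s z x (lyapunov s a).
Proof.
move=> sa; rewrite -[in RHS](sum_sym_unit sa) lyapunov_sum path_score_sum.
rewrite mxdotE pair_bigA; apply: eq_bigr => kl _.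
by rewrite [path_gradient _ _ _ _ _ _]mxE.
Qed.

Lemma path_gradient_sym sg s z x : sym_mx (path_gradient sg s z x).
Proof.
apply/matrixP => k l; rewrite !mxE; congr (path_score _ _ _ _ (lyapunov _ _)).
by rewrite /sym_unit addrC.
Qed.

Lemma ln_partition_gradient sg z x h : posdef h ->
  is_gradient (fun k => ln (partition_function prior (phi xi sg (psd_sqrt k))
      (fun i => z i + feat sg (psd_sqrt k) x i))) h
    (path_gradient sg (psd_sqrt h) z x).
Proof.
move=> hp; split; first exact: path_gradient_sym.
move=> a sa; apply: is_derive_within_two_sided; rewrite mxdotC path_gradient_dot//.
exact: ln_partition_derive.
Qed.

End PathwiseGradient.

(** * The free energy as an entropy *)

Section Identification.
Context {R : realType} {K : nat} (P : probability (K.-tuple R) R) (M : R) (N : nat).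
Hypothesis PM : P [set v | fnorm (\row_i tnth v i) <= M] = 1%E.
Local Notation I := (('I_N * 'I_N) + ('I_N * 'I_K))%type.
Local Notation X := (N.-tuple (K.-tuple R)).
Local Notation G := (N.-tuple (N.-tuple R) * N.-tuple (K.-tuple R))%type.
Implicit Types (t sg : R) (s h a : 'M[R]_K).

Definition prior : probability X R := power_prob P N.
Definition noise_law : probability G R := (gaussian_prob N N \x gaussian_prob N K)%E.

Definition noise (w : G) (k : I) : R :=
  match k with
  | inl ij => tuple_mx w.1 ij.1 ij.2
  | inr ik => tuple_mx w.2 ik.1 ik.2
  end.

Lemma noise_gaussian : gaussian_vector noise_law noise.
Proof.
exact: (gaussian_vector_prod (@gaussian_matrix R N N) (@gaussian_matrix R N K)).
Qed.

Definition bounded_rows : set X := all_rows [set v | fnorm (\row_i tnth v i) <= M].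

Let measurable_ball : measurable [set v : K.-tuple R | fnorm (\row_i tnth v i) <= M].
Proof.
have := @measurable_row_fnorm R K measurableT `]-oo, M]%classic.
rewrite setTI => H; rewrite (_ : [set _ | _] = (fun v : K.-tuple R =>
  fnorm (\row_i tnth v i)) @^-1` `]-oo, M]); first exact: H.
by apply/seteqP; split => v /=; rewrite in_itv.
Qed.

Lemma measurable_support : measurable bounded_rows.
Proof. exact: measurable_all_rows. Qed.

Lemma prior_support : prior bounded_rows = 1%E.
Proof. exact: power_prob_all_rows. Qed.

Lemma prior_supportC : prior (~` bounded_rows) = 0%E.
Proof. by rewrite probability_setC ?prior_support ?subee//; exact: measurable_support. Qed.

(** The cut-off makes the signal bounded everywhere without changing its law. *)
Definition signal (x : X) : 'M[R]_(N, K) := \1_bounded_rows x *: tuple_mx x.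

Definition signal_bound : R := Num.sqrt N%:R * `|M|.

Lemma signal_bound_ge0 : 0 <= signal_bound.
Proof. by rewrite mulr_ge0// sqrtr_ge0. Qed.

Lemma signal_support x : bounded_rows x -> signal x = tuple_mx x.
Proof. by move=> Sx; rewrite /signal indicE mem_set// scale1r. Qed.

Lemma signal_le x : fnorm (signal x) <= signal_bound.
Proof.
have [Sx|Sx] := pselect (bounded_rows x); last first.
  by rewrite /signal indicE memNset// scale0r fnorm0 signal_bound_ge0.
rewrite signal_support//; apply: le_sqr; first exact: signal_bound_ge0.
rewrite /signal_bound exprMn (sqr_sqrtr (ler0n R N)) -normrX (ger0_norm (sqr_ge0 M)) fnorm_sqrE.
apply: (@le_trans _ _ (\sum_(i < N) M ^+ 2)); last by rewrite sumr_const card_ord mulr_natl.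
apply: ler_sum => i _; have := Sx i; rewrite /= => Mi.
have M0 : 0 <= M by exact: le_trans (fnorm_ge0 _) Mi.
apply: (@le_trans _ _ (fnorm (\row_j tnth (tnth x i) j) ^+ 2)).
  rewrite fnorm_sqrE big_ord1; apply: ler_sum => j _; by rewrite !mxE.
by rewrite lerXn2r ?nnegrE ?fnorm_ge0.
Qed.

Lemma signal_obs i j : obs (fun x => signal x i j).
Proof.
split; last first.
  exists signal_bound => x; exact: le_trans (entry_le_fnorm _ _ _) (signal_le x).
have E x : signal x i j = \1_bounded_rows x * tuple_mx x i j by rewrite /signal mxE.
under eq_fun do rewrite E; apply: measurable_funM; last exact: measurable_tuple_mx.
apply: measurable_indic; exact: measurable_support.
Qed.

Lemma eq_integral_support (f f' : X -> \bar R) : measurable_fun setT f ->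
  measurable_fun setT f' -> (forall x, bounded_rows x -> f x = f' x) ->
  (\int[prior]_x f x = \int[prior]_x f' x)%E.
Proof.
move=> mf mf' ff'; apply: ae_eq_integral => //.
exists (~` bounded_rows); split; [exact: measurableC measurable_support|exact: prior_supportC|].
by move=> x /= H Sx; apply: H => _; exact: ff'.
Qed.

Local Notation law := (prior \x noise_law)%E.

Lemma eq_integral_sample_support (f f' : X * G -> \bar R) : measurable_fun setT f ->
  measurable_fun setT f' -> (forall w, bounded_rows w.1 -> f w = f' w) ->
  (\int[law]_w f w = \int[law]_w f' w)%E.
Proof.
move=> mf mf' ff'.
pose lw : probability (X * G)%type R := (prior \x noise_law)%E.
apply: (@ae_eq_integral _ _ _ lw) => //.
have mC : measurable (~` bounded_rows) by exact: measurableC measurable_support.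
exists (~` bounded_rows `*` setT); split.
- exact: measurableX.
- transitivity (prior (~` bounded_rows) * noise_law setT)%E; first exact: product_measure1E.
  by rewrite prior_supportC mul0e.
by move=> w /= H; split => //= Sx; apply: H => _; exact: ff'.
Qed.

(** The signal may be replaced by its bounded version, since they agree almost
    surely. *)
Lemma integral_sample_law (f f' : X * G -> \bar R) : measurable_fun setT f ->
  measurable_fun setT f' -> (forall w, bounded_rows w.1 -> f w = f' w) ->
  (\int[sample_law P N]_w f (assoc w) = \int[law]_w f' w)%E.
Proof.
move=> mf mf' ff'; rewrite -(eq_integral_sample_support mf mf' ff').
exact: integral_assoc.
Qed.

Definition full_observation sg s (w : X * G) (k : I) : R :=
  noise w.2 k + feat sg s (tuple_mx w.1) k.

Lemma measurable_feat sg s k : measurable_fun setT (fun x : X => feat sg s (tuple_mx x) k).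
Proof.
case: k => [ij|ik] /=.
  apply: measurable_funM => //; under eq_fun do rewrite mxE.
  apply: measurable_sum => l; apply: measurable_funM; first exact: measurable_tuple_mx.
  by under eq_fun do rewrite mxE; exact: measurable_tuple_mx.
under eq_fun do rewrite mxE; apply: measurable_sum => l; apply: measurable_funM => //.
exact: measurable_tuple_mx.
Qed.

Lemma measurable_full_observation sg s k : measurable_fun setT (full_observation sg s ^~ k).
Proof.
apply: measurable_funD; last first.
  exact: (measurableT_comp (measurable_feat sg s k) measurable_fst).
by case: noise_gaussian => m _; exact: (measurableT_comp (m k) measurable_snd).
Qed.

Local Notation phi0 := (phi signal).

Lemma full_observation_support sg s w : bounded_rows w.1 ->
  full_observation sg s w = observation noise (phi0 sg s) w.
Proof.
by move=> Sw; apply/funext => k; rewrite /full_observation /observation /phi signal_support.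
Qed.

(** Completing the square: the Hamiltonian is the exponent of the likelihood. *)
Lemma hamiltonianE (w : sample N) t h (x : 'M[R]_(N, K)) : (0 < N)%N -> 0 <= t -> psd h ->
  hamiltonian w t h x =
  dot (feat (Num.sqrt (t / N%:R)) (psd_sqrt h) x)
    (full_observation (Num.sqrt (t / N%:R)) (psd_sqrt h) (assoc w))
  - 2^-1 * dot (feat (Num.sqrt (t / N%:R)) (psd_sqrt h) x)
       (feat (Num.sqrt (t / N%:R)) (psd_sqrt h) x).
Proof.
move=> N0 t0 hp; set sg := Num.sqrt _; set s := psd_sqrt h.
have sg2 : sg * sg = t / N%:R by rewrite -expr2 sqr_sqrtr// divr_ge0.
have s2 : s *m s = h by exact: psd_sqrtK.
have sT : s^T = s by exact: psd_sym (psd_sqrt_psd hp).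
have dotD : dot (feat sg s x) (full_observation sg s (assoc w)) =
    dot (feat sg s x) (noise (assoc w).2) + dot (feat sg s x) (feat sg s (tuple_mx w.1.1)).
  by rewrite /dot -big_split/=; apply: eq_bigr => k _; rewrite mulrDr.
have gramE (u v : 'M[R]_(N, K)) : mxdot (u *m u^T) (v *m v^T) = fnorm (u^T *m v) ^+ 2.
  by rewrite fnorm_sqr -[RHS]mxdot_tr trmx_mul trmxK [RHS]mxdot_mull trmxK mxdot_mulr trmxK mulmxA.
have sE (u v : 'M[R]_(N, K)) : mxdot (u *m s) (v *m s) = mxdot h (u^T *m v).
  by rewrite mxdot_mull -s2 mxdot_mulr sT mulmxA.
rewrite dotD !dot_feat !gramE !sE sg2 /hamiltonian -/sg -/s.
have -> : dot (feat sg s x) (noise (assoc w).2) =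
    sg * mxdot x (tuple_mx w.1.2 *m x) + mxdot s (x^T *m tuple_mx w.2).
  have -> : mxdot s (x^T *m tuple_mx w.2) = mxdot (x *m s) (tuple_mx w.2).
    by rewrite mxdot_mull.
  have -> : mxdot x (tuple_mx w.1.2 *m x) = mxdot (x *m x^T) (tuple_mx w.1.2).
    by rewrite mxdot_mulr trmxK.
  rewrite /dot sum_index !mxdotE; congr (_ + _).
  rewrite mulr_sumr; apply: eq_bigr => i _; rewrite mulr_sumr.
  by apply: eq_bigr => j _; rewrite /= mulrA.
have N0' : N%:R != 0 :> R by rewrite pnatr_eq0 -lt0n.
move: (mxdot _ _) (mxdot _ _) (mxdot _ _) (mxdot _ _) (fnorm _ ^+ 2) (fnorm _ ^+ 2) => *; clearbody sg.
by field.
Qed.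

Lemma free_energyE (w : sample N) t h : (0 < N)%N -> 0 <= t -> psd h ->
  free_energy P w t h = N%:R^-1 *
    ln (partition_function prior (phi0 (Num.sqrt (t / N%:R)) (psd_sqrt h))
      (full_observation (Num.sqrt (t / N%:R)) (psd_sqrt h) (assoc w))).
Proof.
move=> N0 t0 hp; rewrite /free_energy; congr (_ * ln _).
set sg := Num.sqrt _; set s := psd_sqrt h; set y := full_observation _ _ _.
rewrite /partition_function /moment /Rintegral; congr fine.
have mdot (f : X -> I -> R) (z : X -> I -> R) :
    (forall k, measurable_fun setT (f ^~ k)) -> (forall k, measurable_fun setT (z ^~ k)) ->
    measurable_fun setT (fun x => dot (f x) (z x)).
  by move=> mf mz; apply: measurable_sum => k; exact: measurable_funM.
apply: eq_integral_support.
- apply/measurable_EFinP; apply: measurableT_comp => //.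
  have E x : hamiltonian w t h (tuple_mx x) = dot (feat sg s (tuple_mx x)) y
      - 2^-1 * dot (feat sg s (tuple_mx x)) (feat sg s (tuple_mx x)) by exact: hamiltonianE.
  under eq_fun do rewrite E.
  apply: measurable_funB; first by apply: mdot => k; [exact: measurable_feat|].
  by apply: measurable_funM => //; apply: mdot => k; exact: measurable_feat.
- apply/measurable_EFinP; apply: measurable_funM => //.
  by apply: measurable_dens; exact: phi_obs signal_obs _ _.
- move=> x Sx; rewrite mul1r hamiltonianE// /dens /phi signal_support//.
Qed.

Lemma mean_free_energyE t h : (0 < N)%N -> 0 <= t -> psd h ->
  mean_free_energy P N t h =
  N%:R^-1 * entropy prior signal noise_law noise (Num.sqrt (t / N%:R)) (psd_sqrt h).
Proof.
move=> N0 t0 hp; set sg := Num.sqrt _; set s := psd_sqrt h.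
pose op := phi_obs signal_obs sg s.
pose L y := ln (partition_function prior (phi0 sg s) y).
have tL : tame L by exact: tame_ln_partition.
have := planted_mean prior noise_gaussian op (obs_cst 1) tL.
under eq_Rintegral do rewrite mul1r.
rewrite -[in RHS]/(partition_function _ _ _) => H.
rewrite /entropy /EE -H -(sample_RintegralZ prior noise_gaussian); last first.
  exact: (sample_tame_observation noise_gaussian op tL).
rewrite /mean_free_energy unlock /Rintegral; congr fine.
transitivity (\int[sample_law P N]_w (N%:R^-1 * L (full_observation sg s (assoc w)))%:E)%E.
  by apply: eq_integral => w _; congr EFin; exact: free_energyE.
have mL z : (forall k, measurable_fun [set: X * G] (z ^~ k)) ->
    measurable_fun setT (fun w => N%:R^-1 * L (z w)).
  by move=> mz; apply: measurable_funM => //; case: tL => + _; exact.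
apply: (@integral_sample_law (fun w => (N%:R^-1 * L (full_observation sg s w))%:E)).
- by apply/measurable_EFinP; apply: mL => k; exact: measurable_full_observation.
- apply/measurable_EFinP; apply: mL => k.
  exact: (measurable_observation noise_gaussian op k).
- by move=> w Sw; rewrite full_observation_support.
Qed.

End Identification.

(** * Bounds on the mean square overlap *)

Section OverlapBounds.
Context {R : realType} {N K : nat}.
Local Notation I := (('I_N * 'I_N) + ('I_N * 'I_K))%type.
Context {dX} {X : measurableType dX} (prior : probability X R)
  (xi : X -> 'M[R]_(N, K)) (Bx : R).
Hypothesis Bx0 : 0 <= Bx.
Hypothesis xi_obs : forall i j, obs (fun w => xi w i j).
Hypothesis xi_bound : forall w, fnorm (xi w) <= Bx.
Context {dG} {G : measurableType dG} (gam : probability G R) (g : G -> I -> R).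
Hypothesis gv : gaussian_vector gam g.
Variables (sg : R) (s : 'M[R]_K).
Local Notation EE := (EE prior xi gam g sg s).
Local Notation b := (mean_mx prior xi sg s).
Local Notation mg := (mean_gram prior xi sg s).
Local Notation om := (overlap_mean prior xi gam g sg s).
Local Notation S := (square_mean prior xi gam g sg s).
Local Notation T := (EE (fun y => coord_var prior xi sg s y)).
Local Notation Theta := (EE (fun y => overlap_var prior xi sg s y)).
Local Notation p a y := (mxdot a ((b y)^T *m b y)).

Let op : obs_features (phi xi sg s). Proof. exact: phi_obs. Qed.

Lemma tame_coord_var : tame (fun y => coord_var prior xi sg s y).
Proof.
apply: tame_sum => k; apply: tame_mxdot => i j;
  by under eq_fun do rewrite mxE; exact: tame_cov.
Qed.

Let tgg : tame (fun y => mxdot (mg y) (mg y)).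
Proof. by apply: tame_mxdot => i j; exact: tame_mean_gram. Qed.

Let tp2 a : tame (fun y => p a y ^+ 2).
Proof. by under eq_fun do rewrite expr2; apply: tameM; exact: tame_p. Qed.

Lemma fnorm_sqr_units (c : 'M[R]_K) : sym_mx c ->
  fnorm c ^+ 2 = \sum_(kl : 'I_K * 'I_K) mxdot (sym_unit kl.1 kl.2) c ^+ 2.
Proof.
move=> sc; rewrite fnorm_sqrE pair_bigA; apply: eq_bigr => kl _.
by rewrite sym_unit_dot.
Qed.

Let gram_sym y : sym_mx ((b y)^T *m b y).
Proof. by rewrite /sym_mx/= trmx_mul trmxK. Qed.

Let tbb : tame (fun y => fnorm ((b y)^T *m b y) ^+ 2).
Proof.
under eq_fun do rewrite (fnorm_sqr_units (gram_sym _)).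
by apply: tame_sum => kl; exact: tp2.
Qed.

Lemma mean_gram_ge y : fnorm ((b y)^T *m b y) ^+ 2 <= mxdot (mg y) (mg y).
Proof.
have -> : fnorm ((b y)^T *m b y) ^+ 2 = mxdot (b y *m (b y)^T) (b y *m (b y)^T).
  by rewrite fnorm_sqr mxdot_mull trmxK mulmxA mxdot_mulr trmxK.
rewrite (mean_gramE prior xi_obs) mxdotDl !mxdotDr.
have h1 := overlap_var_ge0 prior xi_obs sg s y; rewrite /overlap_var in h1.
have h2 := mxdot_ge0 (\sum_k cov_coord prior xi sg s y k).
rewrite (mxdotC (b y *m (b y)^T) (\sum_k cov_coord prior xi sg s y k)).
move: h1 h2; move: (mxdot _ _) (mxdot _ _) (mxdot _ _) => u v w; lra.
Qed.

Lemma sum_unit_sqr : EE (fun y => fnorm ((b y)^T *m b y) ^+ 2) =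
  \sum_(kl : 'I_K * 'I_K) EE (fun y => p (sym_unit kl.1 kl.2) y ^+ 2).
Proof.
rewrite -(EE_sum prior xi_obs gv); last by move=> kl; exact: tp2.
by apply: eq_EE => y; exact: fnorm_sqr_units.
Qed.

Lemma overlap_mean_units : fnorm om ^+ 2 =
  \sum_(kl : 'I_K * 'I_K) EE (fun y => p (sym_unit kl.1 kl.2) y) ^+ 2.
Proof.
rewrite fnorm_sqr_units; last exact: overlap_mean_sym.
by apply: eq_bigr => kl _; rewrite (overlap_meanE prior xi_obs gv).
Qed.

(** Jensen's inequality, once for the replicas and once for the observation. *)
Lemma overlap_le_square : fnorm om ^+ 2 <= S.
Proof.
rewrite (square_meanE prior xi_obs gv).
apply: (@le_trans _ _ (EE (fun y => fnorm ((b y)^T *m b y) ^+ 2))); last first.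
  by apply: (EE_le prior xi_obs gv) => // y; exact: mean_gram_ge.
rewrite sum_unit_sqr overlap_mean_units; apply: ler_sum => kl _.
by apply: (EE_sqr_le prior xi_obs gv); exact: tame_p.
Qed.

Lemma square_mean_le : S <= (Bx ^+ 2) ^+ 2.
Proof.
rewrite (square_meanE prior xi_obs gv) -[leRHS](EE_cst prior xi_obs gv sg s).
apply: (EE_le prior xi_obs gv) => //; first exact: tame_cst.
move=> y; rewrite mxdotE.
have o2 i j : obs (fun w => ((xi w *m (xi w)^T) i j) ^+ 2).
  by under eq_fun do rewrite expr2; apply: obsM; exact: obs_gram.
apply: (@le_trans _ _ (gibbs prior (phi xi sg s) (fun w => \sum_i \sum_j
    ((xi w *m (xi w)^T) i j) ^+ 2) y)).
  rewrite (gibbs_sum prior op); last by move=> i; exact: obs_sum.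
  apply: ler_sum => i _; rewrite (gibbs_sum prior op)//; apply: ler_sum => j _.
  by rewrite -expr2 mxE; apply: gibbs_sqr_le => //; exact: obs_gram.
rewrite -[leRHS](gibbs_cst prior op _ y); apply: le_gibbs => //.
- by apply: obs_sum => i; exact: obs_sum.
- exact: obs_cst.
move=> w; rewrite -fnorm_sqrE lerXn2r ?nnegrE ?fnorm_ge0 ?sqr_ge0//.
apply: le_trans (fnormM _ _) _; rewrite fnorm_tr expr2.
by apply: ler_pM; rewrite ?fnorm_ge0.
Qed.

Lemma mean_coord_var_ge0 : 0 <= T.
Proof.
rewrite -[leLHS](EE_cst prior xi_obs gv sg s 0); apply: (EE_le prior xi_obs gv).
- exact: tame_cst.
- exact: tame_coord_var.
- by move=> y; exact: coord_var_ge0.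
Qed.

Lemma mean_overlap_var_ge0 : 0 <= Theta.
Proof.
rewrite -[leLHS](EE_cst prior xi_obs gv sg s 0); apply: (EE_le prior xi_obs gv).
- exact: tame_cst.
- exact: tame_overlap_var.
- by move=> y; exact: overlap_var_ge0.
Qed.

(** Here the square root of the mean of [coord_var], hence of the Laplacian, enters:
    this is the reason for a fractional power of it in the final estimate. *)
Lemma mean_overlap_var_le : Theta ^+ 2 <= K%:R * (Bx ^+ 2) ^+ 2 * T.
Proof.
have tT := tame_overlap_var prior xi_obs sg s.
have tT2 : tame (fun y => overlap_var prior xi sg s y ^+ 2).
  by under eq_fun do rewrite expr2; exact: tameM.
apply: le_trans (EE_sqr_le prior xi_obs gv sg s tT) _.
rewrite -(EE_Z prior xi_obs gv); last exact: tame_coord_var.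
apply: (EE_le prior xi_obs gv) => //.
  by apply: tameM; [exact: tame_cst|exact: tame_coord_var].
move=> y; apply: le_trans (overlap_var_le prior Bx0 xi_obs xi_bound sg s y) _.
by rewrite mulrAC.
Qed.

Variables (D : 'M[R]_K -> 'M[R]_K) (cD V : R).
Hypothesis ss : s^T = s.
Hypothesis DP : forall a, sym_mx a -> fnorm a <= 1 ->
  [/\ (D a)^T = D a, D a *m s + s *m D a = a, fnorm s * fnorm (D a) <= cD &
   \int[(prior \x gam)%E]_w (score prior (phi xi sg s) (phi xi 0 (D a)) (phi xi 0 (D a) w.1)
      (observation g (phi xi sg s) w) - 2^-1 * EE (fun y => p a y)) ^+ 2 <= V].

(** The two sources of fluctuation are added up, the second one entry by entry. *)
Lemma square_overlap_le : S - fnorm om ^+ 2 <=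
  K%:R * T + 2 * Theta + K%:R ^+ 2 * (4 * V + 4 * cD * Theta).
Proof.
have tT := tame_overlap_var prior xi_obs sg s.
have tV := tame_coord_var.
have h1 : S - EE (fun y => fnorm ((b y)^T *m b y) ^+ 2) <= K%:R * T + 2 * Theta.
  rewrite (square_meanE prior xi_obs gv) -(EE_B prior xi_obs gv)//.
  have tKT : tame (fun y => K%:R * coord_var prior xi sg s y) by apply: tameM => //; exact: tame_cst.
  have t2T : tame (fun y => 2 * overlap_var prior xi sg s y) by apply: tameM => //; exact: tame_cst.
  rewrite -!(EE_Z prior xi_obs gv)// -(EE_D prior xi_obs gv)//.
  apply: (EE_le prior xi_obs gv); [exact: tameB|exact: tameD|].
  by move=> y; exact: square_overlap_gap.
have h2 : EE (fun y => fnorm ((b y)^T *m b y) ^+ 2) - fnorm om ^+ 2 <=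
    K%:R ^+ 2 * (4 * V + 4 * cD * Theta).
  rewrite sum_unit_sqr overlap_mean_units -sumrB.
  have -> : K%:R ^+ 2 * (4 * V + 4 * cD * Theta) =
      \sum_(kl : 'I_K * 'I_K) (4 * V + 4 * cD * Theta).
    by rewrite sumr_const card_prod card_ord -[RHS]mulr_natl natrM expr2.
  apply: ler_sum => kl _.
  have sa : sym_mx (sym_unit kl.1 kl.2 : 'M[R]_K) by exact: sym_unit_sym.
  have a1 := @sym_unit_fnorm R K kl.1 kl.2.
  have [sD aD nD VD] := DP sa a1.
  apply: le_trans (overlap_fluctuation prior xi_obs gv sg sa ss sD aD) _.
  apply: lerD; first by rewrite ler_wpM2l.
  rewrite ler_wpM2r ?mean_overlap_var_ge0// ler_wpM2l//.
  rewrite -[leRHS]mul1r; apply: ler_pM => //; first exact: fnorm_ge0.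
  by rewrite mulr_ge0 ?fnorm_ge0.
by have := lerD h1 h2; rewrite addrA subrK.
Qed.

End OverlapBounds.

(** The estimates of the fluctuations combined: [rho ^+ 4] is the Laplacian over
    [n], up to the multiple of the norm of the inverse of [h] that is added to it. *)
Lemma final_bound {R : realType} (k n M S O T Th V r kap rho : R) :
  1 <= k -> 0 < n -> 1 <= kap -> 0 <= rho -> 0 <= r -> 0 <= O -> 0 <= T -> 0 <= Th ->
  S <= ((n * M ^+ 2)) ^+ 2 ->
  T <= 2 * n ^+ 2 * rho ^+ 4 ->
  Th ^+ 2 <= k * (n * M ^+ 2) ^+ 2 * T ->
  V <= n ^+ 2 * r ->
  S - O <= k * T + 2 * Th + k ^+ 2 * (4 * V + 4 * (k * kap) * Th) ->
  (S - O) / (2 * n ^+ 2) <=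
   (k + (1 + 2 * k ^+ 3) * (2 * k * M ^+ 2) + M ^+ 4 + 2 * k ^+ 2) * (kap * rho)
   + (k + (1 + 2 * k ^+ 3) * (2 * k * M ^+ 2) + M ^+ 4 + 2 * k ^+ 2) * r.
Proof.
move=> k1 n0 kap1 rho0 r0 O0 T0 Th0 SM TN ThT Vr H.
have k0 : 0 <= k by lra.
set A := (1 + 2 * k ^+ 3) * (2 * k * M ^+ 2).
have q1 : 0 <= 1 + 2 * k ^+ 3 by rewrite addr_ge0// mulr_ge0// exprn_ge0.
have q2 : 0 <= 2 * k * M ^+ 2 by rewrite mulr_ge0 ?sqr_ge0// mulr_ge0.
have A0 : 0 <= A by rewrite /A mulr_ge0.
have M40 : 0 <= M ^+ 4 by rewrite exprn_even_ge0.
have k20 : 0 <= 2 * k ^+ 2 by rewrite mulr_ge0// sqr_ge0.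
have kr0 : 0 <= kap * rho by rewrite mulr_ge0//; lra.
set C := k + A + M ^+ 4 + 2 * k ^+ 2.
have n2 : 0 < n ^+ 2 by rewrite exprn_gt0.
have n22 : 0 < 2 * n ^+ 2 by rewrite mulr_gt0.
have rC : 2 * k ^+ 2 * r <= C * r by rewrite ler_wpM2r// /C; lra.
have kapr : rho <= kap * rho by rewrite ler_peMl.
(* For [rho] above 1 the trivial bound on [S] is enough. *)
have [rho1|rho1] := lerP rho 1; last first.
  have h1 : (S - O) / (2 * n ^+ 2) <= M ^+ 4.
    rewrite ler_pdivrMr//; apply: (@le_trans _ _ S); first by rewrite gerBl.
    apply: le_trans SM _; have -> : (n * M ^+ 2) ^+ 2 = n ^+ 2 * M ^+ 4 by ring.
    by have := mulr_ge0 (ltW n2) M40; lra.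
  have h2 : M ^+ 4 <= C * (kap * rho).
    have h3 : 1 <= kap * rho by apply: le_trans kapr; exact: ltW.
    apply: (@le_trans _ _ C); first by rewrite /C; lra.
    by rewrite ler_peMr// /C; lra.
  have : 0 <= C * r by rewrite mulr_ge0// /C; lra.
  lra.
have Thb : Th <= 2 * k * n ^+ 2 * rho ^+ 2 * M ^+ 2.
  apply: le_sqr.
    by rewrite mulr_ge0 ?sqr_ge0// mulr_ge0 ?sqr_ge0// mulr_ge0 ?sqr_ge0// mulr_ge0.
  apply: le_trans ThT _.
  apply: (@le_trans _ _ (k * (n * M ^+ 2) ^+ 2 * (2 * n ^+ 2 * rho ^+ 4))).
    by rewrite ler_wpM2l// mulr_ge0// sqr_ge0.
  set W := n ^+ 4 * M ^+ 4 * rho ^+ 4.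
  have e4 (x : R) : 0 <= x ^+ 4 by rewrite exprn_even_ge0.
  have W0 : 0 <= W by rewrite /W mulr_ge0 ?e4// mulr_ge0 ?e4.
  have -> : k * (n * M ^+ 2) ^+ 2 * (2 * n ^+ 2 * rho ^+ 4) = 2 * k * W by rewrite /W; ring.
  have -> : (2 * k * n ^+ 2 * rho ^+ 2 * M ^+ 2) ^+ 2 = 4 * k ^+ 2 * W by rewrite /W; ring.
  rewrite ler_wpM2r//; nra.
have r2 : rho ^+ 2 <= rho by rewrite expr2 ler_piMl.
have r4 : rho ^+ 4 <= rho.
  by rewrite (exprM rho 2 2) (le_trans _ r2)// expr2 ler_piMl ?sqr_ge0// (le_trans r2).
rewrite ler_pdivrMr//; apply: le_trans H _.
have t1 : k * T <= n ^+ 2 * (2 * k * (kap * rho)).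
  apply: (@le_trans _ _ (k * (2 * n ^+ 2 * rho ^+ 4))); first by rewrite ler_wpM2l.
  have -> : k * (2 * n ^+ 2 * rho ^+ 4) = n ^+ 2 * (2 * k * rho ^+ 4) by ring.
  apply: ler_wpM2l; first exact: ltW.
  apply: ler_wpM2l; first by rewrite mulr_ge0.
  exact: le_trans r4 kapr.
have t2 : k ^+ 2 * (4 * V) <= n ^+ 2 * (4 * k ^+ 2 * r).
  have -> : n ^+ 2 * (4 * k ^+ 2 * r) = k ^+ 2 * (4 * (n ^+ 2 * r)) by ring.
  by rewrite ler_wpM2l ?sqr_ge0// ler_wpM2l.
have t3 : (2 + 4 * k ^+ 3 * kap) * Th <= n ^+ 2 * (2 * A * (kap * rho)).
  apply: (@le_trans _ _ ((2 * (1 + 2 * k ^+ 3) * kap) * Th)).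
    rewrite ler_wpM2r//.
    have -> : 2 * (1 + 2 * k ^+ 3) * kap = 2 * kap + 4 * k ^+ 3 * kap by ring.
    by rewrite lerD2r ler_peMr.
  have kk : 0 <= 2 * (1 + 2 * k ^+ 3) * kap.
    by apply: mulr_ge0; [exact: mulr_ge0|lra].
  apply: le_trans (ler_wpM2l kk Thb) _.
  have -> : 2 * (1 + 2 * k ^+ 3) * kap * (2 * k * n ^+ 2 * rho ^+ 2 * M ^+ 2)
    = n ^+ 2 * (2 * A * (kap * rho ^+ 2)) by rewrite /A; ring.
  apply: ler_wpM2l; first exact: ltW.
  apply: ler_wpM2l; first by rewrite mulr_ge0.
  by apply: ler_wpM2l => //; lra.
have split3 : k * T + 2 * Th + k ^+ 2 * (4 * V + 4 * (k * kap) * Th) =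
    k * T + (2 + 4 * k ^+ 3 * kap) * Th + k ^+ 2 * (4 * V) by ring.
rewrite split3.
have t4 : k * T + (2 + 4 * k ^+ 3 * kap) * Th + k ^+ 2 * (4 * V) <=
    n ^+ 2 * (2 * k * (kap * rho)) + n ^+ 2 * (2 * A * (kap * rho)) + n ^+ 2 * (4 * k ^+ 2 * r).
  by rewrite !lerD.
apply: le_trans t4 _.
have -> : n ^+ 2 * (2 * k * (kap * rho)) + n ^+ 2 * (2 * A * (kap * rho)) + n ^+ 2 * (4 * k ^+ 2 * r)
  = ((k + A) * (kap * rho) + 2 * k ^+ 2 * r) * (2 * n ^+ 2) by ring.
rewrite ler_wpM2r ?(ltW n22)// lerD// ler_wpM2r// /C; lra.
Qed.

(** * Derivatives of the free energy *)

Section Scaling.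
Context {R : realType}.

Lemma is_derive_within_scale (D : set R) (f : R -> R) (c x d : R) :
  is_derive_within D f x d -> is_derive_within D (fun e => c * f e) x (c * d).
Proof.
move=> H; rewrite /is_derive_within.
have -> : (fun e => e^-1 * (c * f (x + e) - c * f x)) =
    (fun e => c * (e^-1 * (f (x + e) - f x))).
  by apply/funext => e; ring.
by apply: cvgM H; exact: cvg_cst.
Qed.

Lemma is_gradient_scale K (f : 'M[R]_K -> R) (c : R) h G :
  is_gradient f h G -> is_gradient (fun k => c * f k) h (c *: G).
Proof.
move=> [sG dG]; split; first exact: sym_mxZ.
by move=> a sa; rewrite mxdotZl; exact: is_derive_within_scale (dG a sa).
Qed.

Lemma sym_basis_sym K (i j : 'I_K) : sym_mx (sym_basis i j : 'M[R]_K).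
Proof.
rewrite /sym_basis; case: eqP => _; first by rewrite /sym_mx/= trmx_delta.
by apply: sym_mxZ; rewrite /sym_mx/= linearD/= !trmx_delta addrC.
Qed.

End Scaling.

Section FreeEnergy.
Context {R : realType} {K : nat} (P : probability (K.-tuple R) R) (M : R) (N : nat).
Hypothesis PM : P [set v | fnorm (\row_i tnth v i) <= M] = 1%E.
Hypothesis N0 : (0 < N)%N.
Variable t : R.
Hypothesis t0 : 0 <= t.
Local Notation I := (('I_N * 'I_N) + ('I_N * 'I_K))%type.
Local Notation X := (N.-tuple (K.-tuple R)).
Local Notation G := (N.-tuple (N.-tuple R) * N.-tuple (K.-tuple R))%type.
Local Notation pr := (prior P N).
Local Notation gam := (noise_law (R := R) (K := K) N).
Local Notation xi := (signal (K := K) M (N := N)).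
Local Notation nz := (noise (R := R) (K := K) (N := N)).
Local Notation sg := (Num.sqrt (t / N%:R)).
Local Notation om s := (overlap_mean pr xi gam nz sg s).
Local Notation sm s := (square_mean pr xi gam nz sg s).
Local Notation EE s := (EE pr xi gam nz sg s).
Implicit Types (h a : 'M[R]_K).

Let xo i j : obs (fun w => xi w i j). Proof. exact: signal_obs. Qed.
Let xb w : fnorm (xi w) <= signal_bound M N. Proof. exact: signal_le. Qed.
Let B0 : 0 <= signal_bound M N. Proof. exact: signal_bound_ge0. Qed.
Let gv : gaussian_vector gam nz. Proof. exact: noise_gaussian. Qed.

Lemma mean_free_energy_gradient h : psd h ->
  is_gradient (mean_free_energy P N t) h (N%:R^-1 *: (2^-1 *: om (psd_sqrt h))).
Proof.
move=> hp; have H := is_gradient_scale N%:R^-1 (entropy_gradient pr B0 xo xb gv sg hp).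
apply: (is_gradient_eq hp _ H) => k kp.
by rewrite (mean_free_energyE PM N0 t0 kp).
Qed.

Lemma mean_free_energy_time h : psd h ->
  is_time_derivative (fun u => mean_free_energy P N u h) t
    (N%:R^-1 * (N%:R^-1 / 2 * sm (psd_sqrt h))).
Proof.
move=> hp; have Ni : 0 < N%:R^-1 :> R by rewrite invr_gt0 ltr0n.
have sT := psd_sym (psd_sqrt_psd hp).
have H := entropy_time_derivative (prior := pr) B0 xo xb gv Ni t0 sT.
have H' := is_derive_within_scale (c := N%:R^-1) H.
apply: is_derive_within_eq H' => // u /= u0.
by rewrite (mean_free_energyE PM N0 u0 hp).
Qed.

Lemma mean_free_energy_second h a : posdef h -> sym_mx a ->
  derivable (derive1 (fun e : R => mean_free_energy P N t (h + e *: a))) 0 1 /\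
  derive1n 2 (fun e : R => mean_free_energy P N t (h + e *: a)) 0 =
  N%:R^-1 * (2^-1 * EE (psd_sqrt h) (fun y => curvature pr xi sg (psd_sqrt h) y a)).
Proof.
move=> hp sa; apply: (entropy_laplacian_direction B0 xo xb gv hp sa) => e ep.
exact: (mean_free_energyE PM N0 t0 ep).
Qed.

(** The diagonal directions add up to [coord_var], and the other directions
    contribute nonnegative terms. *)
Lemma laplacian_ge h : posdef h ->
  N%:R^-1 * (2^-1 * EE (psd_sqrt h) (fun y => coord_var pr xi sg (psd_sqrt h) y)) <=
  laplacian (mean_free_energy P N t) h.
Proof.
move=> hp; set s := psd_sqrt h.
have Ni : 0 <= N%:R^-1 :> R by rewrite invr_ge0.
pose c (i j : 'I_K) : R := N%:R^-1 * (2^-1 * EE s (fun y => curvature pr xi sg s y (sym_basis i j))).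
have c0 i j : 0 <= c i j.
  rewrite /c mulr_ge0// mulr_ge0// -[leLHS](EE_cst pr xo gv sg s 0).
  apply: (EE_le pr xo gv); [exact: tame_cst|exact: tame_curvature|].
  by move=> y; apply: (curvature_ge0 pr xo); exact: sym_basis_sym.
have -> : laplacian (mean_free_energy P N t) h = \sum_(i < K) \sum_(j < K | (i <= j)%N) c i j.
  apply: eq_bigr => i _; apply: eq_bigr => j _.
  by have [_ ->] := mean_free_energy_second hp (@sym_basis_sym R K i j).
have -> : EE s (fun y => coord_var pr xi sg s y) =
    \sum_(i < K) EE s (fun y => curvature pr xi sg s y (sym_basis i i)).
  rewrite -(EE_sum pr xo gv); last by move=> i; exact: tame_curvature.
  apply: eq_EE => y; apply: eq_bigr => i _.
  by rewrite /sym_basis eqxx curvature_delta.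
rewrite !mulr_sumr; apply: ler_sum => i _.
by rewrite (bigD1 i)//= lerDl sumr_ge0.
Qed.

Lemma free_energy_gradient (w : sample N) h : posdef h ->
  is_gradient (free_energy P w t) h
   (N%:R^-1 *: path_gradient pr xi sg (psd_sqrt h) (noise (assoc w).2) (tuple_mx (assoc w).1)).
Proof.
move=> hp; have H := is_gradient_scale N%:R^-1
  (ln_partition_gradient pr B0 xo xb sg (noise (assoc w).2) (tuple_mx (assoc w).1) hp).
apply: (is_gradient_eq (posdef_psd hp) _ H) => k kp.
by rewrite (free_energyE PM w N0 t0 kp).
Qed.

Lemma measurable_path_score h D : measurable_fun setT (fun u : X * G =>
  path_score pr xi sg (psd_sqrt h) (noise u.2) (tuple_mx u.1) D).
Proof.
set s := psd_sqrt h.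
have op := phi_obs xo sg s; have op' := phi_obs xo 0 D.
have mfo k := measurable_full_observation (K := K) (N := N) sg s k.
have mg al : obs al -> measurable_fun setT (fun u : X * G =>
    gibbs pr (phi xi sg s) al (full_observation sg s u)).
  by move=> oa; have [mt _] := tame_gibbs pr op oa; exact: (mt _ _ _ mfo).
have mf D' k : measurable_fun setT (fun u : X * G => feat 0 D' (tuple_mx u.1) k).
  exact: (measurableT_comp (measurable_feat 0 D' k) measurable_fst).
apply: measurable_funB; last first.
  by apply: measurable_sum => k; apply: mg; apply: obsM; [exact: op'|exact: op].
apply: measurable_funD; apply: measurable_sum => k; apply: measurable_funM.
- exact: mfo.
- by apply: mg; exact: op'.
- exact: mf.
- by apply: mg; exact: op.
Qed.

(** The norm of the fluctuation of the gradient dominates its pairing with [a], which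
    is the fluctuation of the score; in the latter the signal may be replaced by
    its bounded version. *)
Lemma gradient_variance_ge h a : posdef h -> sym_mx a -> fnorm a <= 1 ->
  ((N%:R^-1 ^+ 2 * \int[(pr \x gam)%E]_w (score pr (phi xi sg (psd_sqrt h))
      (phi xi 0 (lyapunov (psd_sqrt h) a)) (phi xi 0 (lyapunov (psd_sqrt h) a) w.1)
      (observation nz (phi xi sg (psd_sqrt h)) w)
      - 2^-1 * mxdot a (om (psd_sqrt h))) ^+ 2)%:E <= gradient_variance P N t h)%E.
Proof.
move=> hp sa a1; set s := psd_sqrt h; set D := lyapunov s a; set m := mxdot a (om s).
have op := phi_obs xo sg s; have op' := phi_obs xo 0 D.
pose ps (u : X * G) : R := path_score pr xi sg s (noise u.2) (tuple_mx u.1) D.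
have mps : measurable_fun setT ps by exact: measurable_path_score.
pose Y (w : X * G) := score pr (phi xi sg s) (phi xi 0 D) (phi xi 0 D w.1)
  (observation nz (phi xi sg s) w).
have stY : sample_tame nz Y := sample_tame_score pr gv op op'.
have stY2 : sample_tame nz (fun w => (Y w - 2^-1 * m) ^+ 2).
  under eq_fun do rewrite expr2.
  by apply: sample_tameM; apply: sample_tameB => //; exact: sample_tame_cst.
pose gr (u : X * G) := path_gradient pr xi sg s (noise u.2) (tuple_mx u.1).
have psE u : mxdot a (gr u) = ps u by exact: path_gradient_dot.
have E1 (w : sample N) : gradient (free_energy P w t) h - gradient (mean_free_energy P N t) h
    = N%:R^-1 *: (gr (assoc w) - 2^-1 *: om s).
  rewrite (gradientE (posdef_psd hp) (free_energy_gradient w hp)).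
  rewrite (gradientE (posdef_psd hp) (mean_free_energy_gradient (posdef_psd hp))).
  by rewrite -scalerBr.
have -> : gradient_variance P N t h =
    (\int[sample_law P N]_w (fnorm (N%:R^-1 *: (gr (assoc w) - 2^-1 *: om s)) ^+ 2)%:E)%E.
  by rewrite /gradient_variance unlock; apply: eq_integral => w _; rewrite E1.
pose f (u : X * G) := (N%:R^-1 ^+ 2 * (ps u - 2^-1 * m) ^+ 2)%:E.
have mf : measurable_fun setT f.
  apply/measurable_EFinP; apply: measurable_funM => //.
  under eq_fun do rewrite expr2.
  by apply: measurable_funM; exact: measurable_funB.
have mf' : measurable_fun setT (fun w => (N%:R^-1 ^+ 2 * (Y w - 2^-1 * m) ^+ 2)%:E).
  by apply/measurable_EFinP; apply: measurable_funM => //; case: stY2.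
have st' : sample_tame nz (fun w => N%:R^-1 ^+ 2 * (Y w - 2^-1 * m) ^+ 2).
  by apply: sample_tameM => //; exact: sample_tame_cst.
rewrite -(sample_RintegralZ pr gv); last exact: stY2.
rewrite /Rintegral fineK; last first.
  apply: (integrable_fin_num measurableT); exact: (sample_tame_integrable pr gv st').
have <- : (\int[sample_law P N]_w f (assoc w) =
    \int[(pr \x gam)%E]_w (N%:R^-1 ^+ 2 * (Y w - 2^-1 * m) ^+ 2)%:E)%E.
  have psY (u : X * G) : bounded_rows M u.1 -> ps u = Y u.
    move=> Su; rewrite /Y -(full_observation_support sg s Su).
    have -> : phi xi 0 D u.1 = feat 0 D (tuple_mx u.1) by rewrite /phi (signal_support Su).
    by [].
  have ff' (u : X * G) : bounded_rows M u.1 -> f u = (N%:R^-1 ^+ 2 * (Y u - 2^-1 * m) ^+ 2)%:E.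
    by move=> Su; rewrite /f (psY u Su).
  exact: (integral_sample_law PM mf mf' ff').
apply: ge0_le_integral.
- exact: measurableT.
- move=> w _; rewrite /f lee_fin; apply: mulr_ge0; exact: sqr_ge0.
- exact: (measurableT_comp mf (@measurable_assoc _ _ _ _ _ _)).
- have mgr : measurable_fun setT (fun u : X * G => (fnorm (N%:R^-1 *: (gr u - 2^-1 *: om s)) ^+ 2)%:E).
    apply/measurable_EFinP; under eq_fun do rewrite fnorm_sqrE.
    apply: measurable_sum => k; apply: measurable_sum => l.
    under eq_fun do rewrite expr2.
    have me : measurable_fun setT (fun u : X * G => (N%:R^-1 *: (gr u - 2^-1 *: om s)) k l).
      under eq_fun do rewrite mxE.
      apply: measurable_funM => //; under eq_fun do rewrite mxE.
      apply: measurable_funD => //; under eq_fun do rewrite mxE.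
      exact: measurable_path_score.
    exact: measurable_funM.
  exact: (measurableT_comp mgr (@measurable_assoc _ _ _ _ _ _)).
move=> w _; rewrite /f lee_fin -psE.
have -> : N%:R^-1 ^+ 2 * (mxdot a (gr (assoc w)) - 2^-1 * m) ^+ 2 =
    mxdot a (N%:R^-1 *: (gr (assoc w) - 2^-1 *: om s)) ^+ 2.
  by rewrite mxdotZr mxdotBr mxdotZr exprMn.
set Q := N%:R^-1 *: _; apply: le_trans (mxdot_le_sqr _ _) _.
rewrite -!fnorm_sqr ler_piMl ?sqr_ge0// expr2 mulr_ile1 ?fnorm_ge0//.
Qed.

End FreeEnergy.

(** * Constants *)

Section Constants.
Context {R : realType}.

Lemma condition_number_ge1 K (h : 'M[R]_K) : (1 <= K)%N -> posdef h ->
  1 <= fnorm h * fnorm (invmx h).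
Proof.
move=> K1 hp; apply: le_trans (fnormM h (invmx h)).
rewrite mulmxV ?posdef_unit// fnorm_scalar normr1 mul1r -[leLHS]sqrtr1.
by apply: ler_wsqrtr; rewrite ler1n.
Qed.

(** The norm of the root is of the order of the square root of the norm of [h], and
    its coercivity of that of the norm of the inverse. *)
Lemma lyapunov_sqrt_le K (h a : 'M[R]_K) : (1 <= K)%N -> posdef h -> fnorm a <= 1 ->
  fnorm (psd_sqrt h) * fnorm (lyapunov (psd_sqrt h) a) <=
  K%:R * (fnorm h * fnorm (invmx h)).
Proof.
move=> K1 hp a1; set kap := fnorm h * fnorm (invmx h).
have kap1 : 1 <= kap by exact: condition_number_ge1.
have kap0 : 0 <= kap by exact: le_trans kap1.
have k0 : 0 <= K%:R :> R by [].
have c0 := coercivity_ge0 h.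
have la : fnorm (lyapunov (psd_sqrt h) a) <= coercivity h.
  by apply: le_trans (lyapunov_fnorm_le a hp) _; rewrite ler_piMr.
apply: (@le_trans _ _ (fnorm (psd_sqrt h) * coercivity h)).
  by rewrite ler_wpM2l ?fnorm_ge0.
apply: le_sqr; first by rewrite mulr_ge0.
rewrite exprMn; apply: (@le_trans _ _ ((Num.sqrt K%:R * fnorm h) *
    (K%:R * Num.sqrt K%:R * fnorm (invmx h)))).
  apply: ler_pM; rewrite ?sqr_ge0//.
    exact: sqrt_fnorm_sqr_le (posdef_psd hp).
  exact: coercivity_sqr_le.
have -> : Num.sqrt K%:R * fnorm h * (K%:R * Num.sqrt K%:R * fnorm (invmx h)) =
    K%:R ^+ 2 * kap.
  transitivity (K%:R * Num.sqrt K%:R ^+ 2 * kap); first by rewrite /kap; ring.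
  by rewrite (sqr_sqrtr k0) -expr2.
by rewrite exprMn ler_wpM2l ?sqr_ge0// expr2 ler_peMl.
Qed.

Lemma rho_pow4 (n l : R) : 0 < n -> 0 <= l ->
  (n `^ (- 4^-1) * l `^ 4^-1) ^+ 4 = l / n.
Proof.
move=> n0 l0; rewrite exprMn -!powR_mulrn ?powR_ge0// -!powRrM mulNr mulVf ?pnatr_eq0//.
by rewrite powRr1// powRN powRr1 1?ltW// mulrC.
Qed.

End Constants.

Theorem proposition1p2 (R : realType) (K : nat) (hK : (1 <= K)%N) (M : R) :
  exists C : R,
  forall P : probability (K.-tuple R) R,
  P [set v | fnorm (\row_i tnth v i) <= M] = 1%E ->
  forall (N : nat), (1 <= N)%N ->
  forall (t : R) (h : 'M[R]_K), 0 <= t -> psd h ->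
  let F := free_energy P (N := N) in
  let Fbar := mean_free_energy P N in
  let dtFbar := time_derivative (fun s => Fbar s h) t in
  let gradFbar := gradient (Fbar t) h in
  let lapFbar := laplacian (Fbar t) h in
  (* the derivatives in the statement exist *)
  [/\ exists d, is_time_derivative (fun s => Fbar s h) t d,
      exists G, is_gradient (Fbar t) h G &
      posdef h ->
        (forall w, exists G, is_gradient (F w t) h G) /\
        (forall (i j : 'I_K), (i <= j)%N ->
           derivable (derive1 (fun e : R => Fbar t (h + e *: sym_basis i j))) 0 1)]
  /\
  [/\ posdef h -> 0 <= lapFbar + C * fnorm (invmx h),
      0 <= dtFbar - 2 * fnorm gradFbar ^+ 2 &
      ((dtFbar - 2 * fnorm gradFbar ^+ 2)%:E <=
        if `[< posdef h >] then
          C%:E * condition_number h * (N%:R `^ (- 4^-1))%:E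
            * ((lapFbar + C * fnorm (invmx h)) `^ 4^-1)%:E
          + C%:E * gradient_variance P N t h
        else +oo)%E].
Proof.
pose k : R := K%:R.
(* In this order the terms account for [coord_var], for [overlap_var], for a large
   Laplacian and for the variance of the gradient. *)
pose C : R := k + (1 + 2 * k ^+ 3) * (2 * k * M ^+ 2) + M ^+ 4 + 2 * k ^+ 2.
have k1 : 1 <= k by rewrite /k ler1n.
have k0 : 0 <= k by exact: le_trans k1.
have C0 : 0 < C.
  have a0 : 0 <= (1 + 2 * k ^+ 3) * (2 * k * M ^+ 2).
    by apply: mulr_ge0; [rewrite addr_ge0// mulr_ge0// exprn_ge0|rewrite mulr_ge0 ?sqr_ge0// mulr_ge0].
  have b0 : 0 <= M ^+ 4 by rewrite exprn_even_ge0.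
  have c0 : 0 <= 2 * k ^+ 2 by rewrite mulr_ge0// sqr_ge0.
  by rewrite /C; lra.
exists C => P PM N N1 t h t0 hp F Fbar dtFbar gradFbar lapFbar.
have n0 : 0 < N%:R :> R by rewrite ltr0n.
pose n : R := N%:R.
have xo := signal_obs (K := K) M (N := N).
have xb := signal_le (K := K) M (N := N).
have B0 := signal_bound_ge0 M N.
have gv := noise_gaussian (R := R) (K := K) N.
have time := mean_free_energy_time PM N1 t0 hp.
have grad := mean_free_energy_gradient PM N1 t0 hp.
pose s := psd_sqrt h; pose sg := Num.sqrt (t / N%:R).
pose pr := prior P N; pose gam := noise_law (R := R) (K := K) N.
pose xi := signal (K := K) M (N := N); pose nz := noise (R := R) (K := K) (N := N).
set S := square_mean _ _ _ _ _ _ in time.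
set om := overlap_mean _ _ _ _ _ _ in grad.
have OS : fnorm om ^+ 2 <= S by exact: overlap_le_square.
have val : dtFbar - 2 * fnorm gradFbar ^+ 2 = (S - fnorm om ^+ 2) / (2 * n ^+ 2).
  rewrite /dtFbar (time_derivativeE t0 time) /gradFbar (gradientE hp grad).
  rewrite !fnormZ !exprMn -!normrX !ger0_norm ?sqr_ge0// -/n.
  by move: (fnorm om ^+ 2) => u; field; rewrite gt_eqF.
have n22 : 0 < 2 * n ^+ 2 by rewrite mulr_gt0// exprn_gt0.
have nonneg : 0 <= dtFbar - 2 * fnorm gradFbar ^+ 2.
  by rewrite val divr_ge0 ?subr_ge0// ltW.
pose T := EE pr xi gam nz sg s (fun y => coord_var pr xi sg s y).
have T0 : 0 <= T by exact: mean_coord_var_ge0.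
have lapT : posdef h -> N%:R^-1 * (2^-1 * T) <= lapFbar by move=> hpd; exact: laplacian_ge.
have lap0 : posdef h -> 0 <= lapFbar.
  by move=> /lapT; apply: le_trans; rewrite mulr_ge0 ?invr_ge0// mulr_ge0.
have lp0 : posdef h -> 0 <= lapFbar + C * fnorm (invmx h).
  by move=> hpd; rewrite addr_ge0 ?lap0// mulr_ge0 ?fnorm_ge0// ltW.
split.
  split.
  - by eexists; exact: time.
  - by eexists; exact: grad.
  move=> hpd; split.
    by move=> w; eexists; exact: (free_energy_gradient PM N1 t0 w hpd).
  move=> i j _; have [H _] := mean_free_energy_second PM N1 t0 hpd (@sym_basis_sym R K i j).
  exact: H.
split => //; case: asboolP => [hpd|_]; last exact: leey.
rewrite /condition_number asboolT//.
set lp := lapFbar + _; set kap := fnorm h * _.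
have lp0' : 0 <= lp by exact: lp0.
have gv0 : (0 <= gradient_variance P N t h)%E.
  rewrite /gradient_variance unlock; apply: integral_ge0 => w _.
  by rewrite lee_fin sqr_ge0.
set rho := N%:R `^ (- 4^-1) * lp `^ 4^-1.
have rho0 : 0 <= rho by rewrite mulr_ge0 ?powR_ge0.
have kap1 : 1 <= kap by exact: condition_number_ge1.
have -> : (C%:E * kap%:E * (N%:R `^ (- 4^-1))%:E * (lp `^ 4^-1)%:E)%E = (C * (kap * rho))%:E.
  by rewrite -!EFinM /rho; congr EFin; ring.
case E : (gradient_variance P N t h) gv0 => [r| |//] gv0; last first.
  by rewrite gt0_muley ?lte_fin// addey ?leey.
rewrite -EFinM -EFinD lee_fin val.
pose Th := EE pr xi gam nz sg s (fun y => overlap_var pr xi sg s y).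
apply: (@final_bound R k n M S (fnorm om ^+ 2) T Th (n ^+ 2 * r) r kap rho) => //.
- exact: sqr_ge0.
- exact: mean_overlap_var_ge0.
- have -> : n * M ^+ 2 = signal_bound M N ^+ 2.
    by rewrite /signal_bound exprMn (sqr_sqrtr (ler0n R N)) -normrX (ger0_norm (sqr_ge0 M)).
  exact: square_mean_le.
- rewrite /rho rho_pow4//; have := lapT hpd.
  have ll : lapFbar <= lp by rewrite lerDl mulr_ge0 ?fnorm_ge0// ltW.
  move=> /le_trans/(_ ll) H.
  have -> : 2 * n ^+ 2 * (lp / N%:R) = 2 * n * lp by rewrite -/n; field; rewrite gt_eqF.
  have -> : T = 2 * n * (N%:R^-1 * (2^-1 * T)) by rewrite -/n; field; rewrite gt_eqF.
  by rewrite ler_wpM2l// mulr_ge0.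
- have -> : n * M ^+ 2 = signal_bound M N ^+ 2.
    by rewrite /signal_bound exprMn (sqr_sqrtr (ler0n R N)) -normrX (ger0_norm (sqr_ge0 M)).
  exact: mean_overlap_var_le.
apply: (@square_overlap_le _ _ _ _ _ pr xi xo _ _ gam nz gv sg s (fun a => lyapunov s a) (k * kap) (n ^+ 2 * r)).
- exact: psd_sym (psd_sqrt_psd hp).
move=> a sa a1; split.
- exact: lyapunov_sym.
- exact: lyapunovE.
- exact: lyapunov_sqrt_le.
have := gradient_variance_ge PM N1 t0 hpd sa a1; rewrite E lee_fin.
rewrite (overlap_meanE pr xo gv) => H.
rewrite -(@ler_pM2l _ (N%:R^-1 ^+ 2)) ?exprn_gt0 ?invr_gt0//.
apply: le_trans H _; rewrite mulrA -exprMn mulVf ?gt_eqF// expr1n mul1r//.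
Qed.
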